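(* For each $N$, let $\mathbf T_1,\dots,\mathbf T_q$ be $N\times N$ (deterministic, complex) diagonal matrices ($q$ fixed) such that, for all $m,n\in\{1,\dots,q\}$, as $N\to\infty$, $$\operatorname{Tr}\mathbf T_m=0,\quad\frac1N\operatorname{Tr}\mathbf T_m\mathbf T_n^*\to\sigma^2_{m,n},\quad\frac1N\operatorname{Tr}\mathbf T_m\mathbf T_n\to\tau^2_{m,n},\quad\forall k\ge1,\ \frac1N\operatorname{Tr}(\mathbf T_m\mathbf T_m^* )^k=O(1).$$ Let $\mathbf u_{t_1},\dots,\mathbf u_{t_p}$ be $p$ distinct columns of an $N\times N$ Haar-distributed unitary matrix ($p$ fixed). Then $$\Big(\sqrt N\,\langle\mathbf u_{t_i},\mathbf T_m\mathbf u_{t_j}\rangle\Big)_{1\le i\le p,\ 1\le j\le p,\ 1\le m\le q}$$ converges in distribution, as $N\to\infty$, to a centered complex Gaussian vector $(\mathcal G_{i,j,m})_{1\le i\le p,\ 1\le j\le p,\ 1\le m\le q}$ with covariance $$\mathbb E[\mathcal G_{i,j,m}\mathcal G_{k,\ell,n}]=\delta_{i,\ell}\delta_{j,k}\,\tau^2_{m,n},\qquad\mathbb E[\mathcal G_{i,j,m}\overline{\mathcal G_{k,\ell,n}}]=\delta_{i,k}\delta_{j,\ell}\,\sigma^2_{m,n}.$$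
   Context: Here $\langle\mathbf u,\mathbf v\rangle=\mathbf u^*\mathbf v$. $\sigma^2_{m,n}$ and $\tau^2_{m,n}$ denote complex numbers. A centered complex Gaussian vector is a $\mathbb C^d$-valued random vector whose real and imaginary parts are jointly Gaussian and centered. *)

(* Defs.v *)
From HB Require Import structures.
From mathcomp Require Import all_boot all_order all_algebra.
From mathcomp Require Import all_classical all_reals all_analysis.
From mathcomp Require Import complex.

Set Implicit Arguments.
Unset Strict Implicit.
Unset Printing Implicit Defensive.

Import Order.TTheory GRing.Theory Num.Theory.
Import numFieldNormedType.Exports.

Local Open Scope classical_set_scope.
Local Open Scope ring_scope.
Local Open Scope sesquilinear_scope.

(* The usual topology of the complex plane: [R[i]] is normed over itself by the
   modulus. *)
HB.instance Definition _ (R : realType) := PseudoPointedMetric.copy R[i] R[i]^o.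
HB.instance Definition _ (R : realType) := NormedModule.copy R[i] R[i]^o.

Notation borel T := (g_sigma_algebraType (@open T)).

(* <u, v> = u^* v, conjugate-linear in the first argument *)
Definition cdot (R : realType) (n : nat) (u v : 'cV[R[i]]_n) : R[i] :=
  (u ^t* *m v) ord0 ord0.

(* Left invariance and total mass 1 characterize the Haar measure of the compact
   group U(n), here seen as a law on matrices carried by the unitary ones. *)
Definition is_haar (R : realType) (n : nat)
    (mu : probability (borel 'M[R[i]]_n) R) : Prop :=
  mu [set V | V \is unitarymx] = 1%E /\
  forall V : 'M[R[i]]_n, V \is unitarymx ->
  forall A : set (borel 'M[R[i]]_n), measurable A ->
    mu (mulmx V @^-1` A) = mu A.

(* [C^I] with its product topology *)
Notation cspace R I := {ptws I -> R[i]}.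

Definition cvg_in_distribution (R : realType) (V : topologicalType)
    (d : nat -> measure_display) (Om : forall n, measurableType (d n))
    (P : forall n, probability (Om n) R) (X : forall n, Om n -> V)
    (d' : measure_display) (Om' : measurableType d') (P' : probability Om' R)
    (Y : Om' -> V) : Prop :=
  forall f : V -> R, continuous f -> bounded_fun f ->
    ('E_(P n)[f \o X n] @[n --> \oo] --> 'E_P'[f \o Y])%E.

(* Normal law, possibly degenerate: the library's [normal_prob m s] is the normal
   law of standard deviation [`|s|] only for [s != 0] ([normal_prob m 0] is
   uniform on [0, 1]). *)
Definition gaussian_rv (R : realType) (d : measure_display)
    (Om : measurableType d) (P : probability Om R) (X : Om -> R) : Prop :=
  exists m s : R, forall A : set R, measurable A ->
    P (X @^-1` A) = if s == 0 then dirac m A else normal_prob m s A.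

(* The real and imaginary parts are jointly Gaussian (each of their real linear
   combinations is Gaussian) and centered. *)
Definition centered_gaussian_vector (R : realType) (I : finType)
    (d : measure_display) (Om : measurableType d) (P : probability Om R)
    (G : {RV P >-> borel (cspace R I)}) : Prop :=
  (forall a b : I -> R,
     gaussian_rv P
       (fun w => \sum_(k : I)
          (a k * complex.Re (G w k) + b k * complex.Im (G w k)))) /\
  (forall k : I, 'E_P[fun w => complex.Re (G w k)]%E = 0%E /\
                 'E_P[fun w => complex.Im (G w k)]%E = 0%E).

Definition cexpectation (R : realType) (d : measure_display)
    (Om : measurableType d) (P : probability Om R) (Z : Om -> R[i]) : R[i] :=
  Complex (fine 'E_P[fun w => complex.Re (Z w)]%E)
          (fine 'E_P[fun w => complex.Im (Z w)]%E).

(* Main.v *)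
Require Import Defs.
From HB Require Import structures.
From mathcomp Require Import all_boot all_order all_algebra.
From mathcomp Require Import all_classical all_reals all_analysis.
From mathcomp Require Import complex.
From mathcomp Require Import measurable_realfun.
From mathcomp Require Import ring lra.

Set Implicit Arguments.
Unset Strict Implicit.
Unset Printing Implicit Defensive.

Import Order.TTheory GRing.Theory Num.Theory.
Import numFieldNormedType.Exports.

Local Open Scope classical_set_scope.
Local Open Scope ring_scope.
Local Open Scope sesquilinear_scope.

(** The proof characterizes the limit law by its characteristic function and
    computes that of the left-hand side by an integration by parts on the
    unitary group.

    Write n for the dimension, u_i for the chosen columns of the Haar unitary
    matrix V and Y_ij(b) = <u_i, diag(b) u_j>; these are the bilinear forms [bil].
    A real linear form of the vector of the theorem is X = sqrt n sum_ij Y_ij(h_ij)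
    with conj(h_ij) = h_ji and sum_a h_ij(a) = 0.  Invariance of the Haar measure
    under left multiplication by unitary matrices close to the identity gives
    E[D_ab F] = 0, where D_ab is the complexified derivative of F along the
    matrix unit (a, b) of the Lie algebra ([haar_deriv]).  Applied to products, it
    becomes an integration by parts formula ([haar_ibp]).  Taking for F
    a conjugate bilinear form shows that E|Y_ij(b)|^2 = O(1/n) for traceless b
    ([haar_bil_var0]).  Taking for F the exponential e^{isX} shows that
       E[X e^{isX}] = i s v_n E[e^{isX}] + O(s / sqrt n),
    where v_n = sum_ij (1/n) sum_a h_ij(a) h_ji(a) ([haar_quad_char]): the terms
    that are left over are products of two fluctuations Y, or deviations of Y
    from its mean, and the variance bound controls both.  So s |-> E[e^{isX}]
    nearly solves f' = - s v_n f, and E[e^{iX}] is close to exp(- v_n / 2)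
    ([ode_bound], [stat_char]).  The hypotheses on traces make v_n converge
    to the quadratic form [cov_form] of the announced covariances.

    Convergence in distribution follows from a continuity theorem
    ([levy_continuity]) for laws with bounded second moments.  It rests on an
    explicit approximation ([trig_approx]): a bounded continuous f on C^I differs
    from some trigonometric polynomial g by at most e (1 + |y|^2) everywhere.
    Such a g is a Bernstein polynomial in the variables
    (1 + sin (y_j / L)) / 2.

    The Gaussian vector is a linear image of independent standard normal
    variables on a product space; the matrix of the linear map is a factor
    B B^T of the covariance matrix ([psd_factor], [gaussian_vector_exists]), which
    is positive as a limit of the numbers v_n.  That a variable with
    characteristic function exp(- s^2 v / 2) has the normal law comes from the
    characteristic function of the normal density, computed by one more
    integration by parts ([normal_char]), and from the uniqueness part of the
    continuity theorem ([law_eq], [char_gaussian]). *)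

(** * Complex numbers and complex expectations *)

Section cplx.
Variable R : realType.
Implicit Types z w : R[i].

Lemma Re_continuous : continuous (@complex.Re R).
Proof.
move=> x; apply: (iffRL (@cvgrPdist_lt _ _ _ (nbhs x) _ _ _)) => /= e e0.
have e0' : 0 < (e%:C)%C by rewrite ltcR.
near=> y.
have : `|x - y| < (e%:C)%C.
  near: y. 
  by apply/nbhs_ballP; exists (e%:C)%C.
rewrite -ltcR; apply: le_lt_trans.
by rewrite -raddfB; exact: normc_ge_Re.
Unshelve. all: by end_near. Qed.

Lemma normc_ge_Im (x : R[i]) : (`|complex.Im x|%:C)%C <= `|x|.
Proof.
by case: x => a b; rewrite normc_def lecR /= -sqrtr_sqr ler_wsqrtr// lerDr sqr_ge0.
Qed.

Lemma Im_continuous : continuous (@complex.Im R).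
Proof.
move=> x; apply: (iffRL (@cvgrPdist_lt _ _ _ (nbhs x) _ _ _)) => /= e e0.
have e0' : 0 < (e%:C)%C by rewrite ltcR.
near=> y.
have : `|x - y| < (e%:C)%C.
  near: y. 
  by apply/nbhs_ballP; exists (e%:C)%C.
rewrite -ltcR; apply: le_lt_trans.
by rewrite -raddfB; exact: normc_ge_Im.
Unshelve. all: by end_near. Qed.

Lemma normc_le_ReIm (x : R[i]) : `|x| <= ((`|complex.Re x| + `|complex.Im x|)%:C)%C.
Proof.
rewrite [X in `|X| <= _]complexE (le_trans (ler_normD _ _))// normrM.
rewrite [X in X * _](_ : _ = 1) ?mul1r; last by rewrite normc_def/= expr0n expr1n add0r sqrtr1.
by rewrite !normc_def/= !expr0n /= !addr0 !sqrtr_sqr -rmorphD/=.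
Qed.

Lemma Complex_continuous (T : topologicalType) (f g : T -> R) :
  continuous f -> continuous g -> continuous (fun x => Complex (f x) (g x)).
Proof.
move=> cf cg x; apply: (iffRL (@cvgrPdist_lt _ _ _ (nbhs x) _ _ _)) => /= e e0.
have [er e0'] : e = ((complex.Re e)%:C)%C /\ 0 < complex.Re e.
  by move: e0; case: e => a b; rewrite ltcE /= => /andP[/eqP -> ->].
have h0 : 0 < complex.Re e / 2 by rewrite divr_gt0.
have Hf := iffLR (@cvgrPdist_lt _ _ _ (nbhs x) _ _ _) (cf x) _ h0.
have Hg := iffLR (@cvgrPdist_lt _ _ _ (nbhs x) _ _ _) (cg x) _ h0.
near=> y.
apply: (le_lt_trans (normc_le_ReIm _)).
rewrite er ltcR /= (splitr (complex.Re e)) ltrD//.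
  by near: y; exact: Hf.
by near: y; exact: Hg.
Unshelve. all: by end_near. Qed.

(** [Num.conj] on [R[i]] unfolds to the conjugation of pairs, which computes on
    explicit real and imaginary parts. *)
Lemma conjE (z : R[i]) : z^* = (z^*)%C.
Proof. by []. Qed.

Lemma conj_continuous : continuous (fun z : R[i] => z^*).
Proof.
rewrite (_ : (fun z => _) = fun z => Complex (complex.Re z) (- complex.Im z)).
  apply: Complex_continuous; first exact: Re_continuous.
  by move=> x; apply: (continuous_comp (Im_continuous (x:=x)) (opp_continuous _)).
by apply/funext => -[].
Qed.

Lemma ReM_real (a : R) (z : R[i]) : complex.Re ((a%:C)%C * z) = a * complex.Re z.
Proof. by case: z => x y /=; rewrite mul0r subr0. Qed.

Lemma ImM_real (a : R) (z : R[i]) : complex.Im ((a%:C)%C * z) = a * complex.Im z.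
Proof. by case: z => x y /=; rewrite mul0r addr0. Qed.

Lemma ReM (z w : R[i]) : complex.Re (z * w) =
  complex.Re z * complex.Re w - complex.Im z * complex.Im w.
Proof. by case: z w => [a b] [c d]. Qed.

Lemma ImM (z w : R[i]) : complex.Im (z * w) =
  complex.Re z * complex.Im w + complex.Im z * complex.Re w.
Proof. by case: z w => [a b] [c d]. Qed.

Lemma cge0P (z : R[i]) : 0 <= z -> z = ((complex.Re z)%:C)%C /\ 0 <= complex.Re z.
Proof. by case: z => a b; rewrite lecE /= => /andP[/eqP -> ->]. Qed.

Lemma Re_le (z w : R[i]) : z <= w -> complex.Re z <= complex.Re w.
Proof. by rewrite lecE => /andP[]. Qed.

Lemma Re_ge0_le_norm (z : R[i]) : `|complex.Re z| <= complex.Re `|z|.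
Proof. by have := Re_le (normc_ge_Re z). Qed.

Lemma Im_ge0_le_norm (z : R[i]) : `|complex.Im z| <= complex.Re `|z|.
Proof. by have := Re_le (normc_ge_Im z). Qed.

Lemma norm_le_ReIm (z : R[i]) : complex.Re `|z| <= `|complex.Re z| + `|complex.Im z|.
Proof. by have := Re_le (normc_le_ReIm z). Qed.

Lemma normRe (z : R[i]) : `|z| = ((complex.Re `|z|)%:C)%C.
Proof. by rewrite normc_def. Qed.

End cplx.

Section cexp.
Context d (T : measurableType d) (R : realType) (P : probability T R).
Implicit Types Z W : T -> R[i].

Definition cintegrable Z :=
  P.-integrable setT (EFin \o (fun x => complex.Re (Z x))) /\
  P.-integrable setT (EFin \o (fun x => complex.Im (Z x))).

Lemma cexpectationE Z : cexpectation P Z =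
  Complex (\int[P]_x complex.Re (Z x)) (\int[P]_x complex.Im (Z x)).
Proof. by rewrite /cexpectation unlock. Qed.

Lemma cintegrableD Z W : cintegrable Z -> cintegrable W ->
  cintegrable (fun x => Z x + W x).
Proof.
move=> [Z1 Z2] [W1 W2]; split.
  have := integrableD measurableT Z1 W1; apply: eq_integrable => // x _ /=.
  by rewrite raddfD.
have := integrableD measurableT Z2 W2; apply: eq_integrable => // x _ /=.
by rewrite raddfD.
Qed.

Lemma cexpectationD Z W : cintegrable Z -> cintegrable W ->
  cexpectation P (fun x => Z x + W x) = cexpectation P Z + cexpectation P W.
Proof.
move=> [Z1 Z2] [W1 W2]; rewrite !cexpectationE.
under eq_Rintegral do rewrite raddfD.
under [X in Complex _ X]eq_Rintegral do rewrite raddfD.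
by rewrite !RintegralD.
Qed.

Lemma cintegrableZ c Z : cintegrable Z -> cintegrable (fun x => c * Z x).
Proof.
case: c => a b [Z1 Z2]; split.
  have := integrableB measurableT (integrableZl measurableT a Z1)
     (integrableZl measurableT b Z2).
  by apply: eq_integrable => // x _ /=; case: (Z x).
have := integrableD measurableT (integrableZl measurableT a Z2)
     (integrableZl measurableT b Z1).
by apply: eq_integrable => // x _ /=; case: (Z x).
Qed.

Lemma cexpectationZ c Z : cintegrable Z ->
  cexpectation P (fun x => c * Z x) = c * cexpectation P Z.
Proof.
move=> [Z1 Z2]; rewrite !cexpectationE; case: c => a b.
under eq_Rintegral do rewrite ReM /=.
under [X in Complex _ X]eq_Rintegral do rewrite ImM /=.
have i1 c : P.-integrable setT (EFin \o (fun x => c * complex.Re (Z x))).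
  have := integrableZl measurableT c Z1.
  by apply: eq_integrable.
have i2 c : P.-integrable setT (EFin \o (fun x => c * complex.Im (Z x))).
  have := integrableZl measurableT c Z2.
  by apply: eq_integrable.
by rewrite RintegralB// RintegralD// !RintegralZl.
Qed.

Lemma cintegrable0 : cintegrable (fun=> 0).
Proof. by split; apply: integrable0. Qed.

Lemma cintegrable_cst c : cintegrable (fun=> c).
Proof.
by split; apply: finite_measure_integrable_cst.
Qed.

Lemma cexpectation_cst c : cexpectation P (fun=> c) = c.
Proof.
have PT : P setT = 1%E := probability_setT P.
have E r : \int[P]_x r = r :> R.
  transitivity (r * fine (P setT)); first exact: (Rintegral_cst P measurableT r).
  by rewrite PT mulr1.
rewrite cexpectationE !E.
by case: c.
Qed.

Lemma cintegrable_sum (I : Type) (r : seq I) (Q : pred I) (Z : I -> T -> R[i]) :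
  (forall i, Q i -> cintegrable (Z i)) -> cintegrable (fun x => \sum_(i <- r | Q i) Z i x).
Proof.
move=> h; elim: r => [|i r IH].
  by under eq_fun do rewrite big_nil; exact: cintegrable0.
under eq_fun do rewrite big_cons.
by case qi : (Q i) => //; apply: cintegrableD => //; exact: h.
Qed.

Lemma cexpectation_sum (I : Type) (r : seq I) (Q : pred I) (Z : I -> T -> R[i]) :
  (forall i, Q i -> cintegrable (Z i)) ->
  cexpectation P (fun x => \sum_(i <- r | Q i) Z i x) =
  \sum_(i <- r | Q i) cexpectation P (Z i).
Proof.
move=> h; elim: r => [|i r IH].
  by under eq_fun do rewrite big_nil; rewrite cexpectation_cst big_nil.
under eq_fun do rewrite big_cons.
rewrite big_cons; case: ifPn => // qi.
by rewrite cexpectationD ?IH//; [exact: h|exact: cintegrable_sum].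
Qed.

Lemma cexpectation_ge0 Z : (forall x, 0 <= Z x) -> 0 <= cexpectation P Z.
Proof.
move=> h; rewrite cexpectationE lecE /= eq_sym; apply/andP; split.
  rewrite (@eq_Rintegral _ _ _ _ _ (fun=> 0)) ?Rintegral_cst ?mul0r// => x _.
  by have [-> _] := cge0P (h x).
by apply: Rintegral_ge0 => x _; have [] := cge0P (h x).
Qed.

End cexp.

(** * Bounded continuous functions on the unitary group *)

Lemma borel_open_measurable (V : ptopologicalType) (A : set V) :
  open A -> measurable (A : set (borel V)).
Proof. by move=> oA; exact: sub_gen_smallest. Qed.

Lemma continuous_borel_measurable (R : realType) (V : ptopologicalType) (f : V -> R) :
  continuous f -> measurable_fun [set: borel V] f.
Proof.
move=> /continuousP cf; apply: (measurability _ (RGenOpens.measurableE R)).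
move=> _ [_ [a [b ->] <-]]; rewrite setTI.
by apply: borel_open_measurable; apply: cf; exact: interval_open.
Qed.

Lemma continuous_borel_measurable2 (V W : ptopologicalType) (f : V -> W) :
  continuous f -> @measurable_fun _ _ (borel V) (borel W) setT f.
Proof.
move=> /continuousP cf; apply: (@measurability _ _ (borel V) (borel W) setT f (@open W)) => //.
by move=> _ [a oa <-]; rewrite setTI; apply: borel_open_measurable; apply: cf.
Qed.

Section continuous_complex.
Variables (T : topologicalType) (R : realType).
Implicit Types F G : T -> R[i].

Lemma continuousCD F G : continuous F -> continuous G -> continuous (fun x => F x + G x).
Proof. by move=> cF cG x; apply: cvgD; [exact: cF|exact: cG]. Qed.

Lemma continuousCM F G : continuous F -> continuous G -> continuous (fun x => F x * G x).
Proof. by move=> cF cG x; apply: cvgM; [exact: cF|exact: cG]. Qed.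

Lemma continuousC_norm F : continuous F -> continuous (fun x => `|F x|).
Proof. by move=> cF x; apply: cvg_norm; exact: cF. Qed.

Lemma continuousC_conj F : continuous F -> continuous (fun x => (F x)^*).
Proof. by move=> cF x; apply: (continuous_comp (cF x)); exact: conj_continuous. Qed.

Lemma continuousC_Re F : continuous F -> continuous (fun x => complex.Re (F x)).
Proof. by move=> cF x; apply: (continuous_comp (cF x)); exact: Re_continuous. Qed.

Lemma continuousC_Im F : continuous F -> continuous (fun x => complex.Im (F x)).
Proof. by move=> cF x; apply: (continuous_comp (cF x)); exact: Im_continuous. Qed.

Lemma continuousC_sum (I : Type) (r : seq I)
   (F : I -> T -> R[i]) : (forall i, continuous (F i)) ->
   continuous (fun x => \sum_(i <- r) F i x).
Proof.
move=> h; elim: r => [|i r IH].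
  by under eq_fun do rewrite big_nil; exact: cst_continuous.
under eq_fun do rewrite big_cons.
exact: (continuousCD (h i) IH).
Qed.

End continuous_complex.

Section mx.
Variables (R : realType) (n : nat).
Local Notation M := 'M[R[i]]_n.

Lemma mx_coord_continuous i j : continuous (fun V : M => V i j).
Proof.
move=> V; apply: (iffRL (@cvgrPdist_lt _ _ _ (nbhs V) _ _ _)) => /= e e0.
near=> W.
have : ball V e W.
  near: W.
  by apply/nbhs_ballP; exists e.
by move=> [_ /(_ i j)].
Unshelve. all: by end_near. Qed.

Lemma mx_continuous (T : topologicalType) (F : T -> M) :
  (forall i j, continuous (fun x => F x i j)) -> continuous F.
Proof.
move=> h x A /= [B AB sA].
have : \forall y \near x, forall i j, B i j (F y i j).
  apply: filter_forall => i; apply: filter_forall => j.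
  exact: (h i j x).
apply: filterS => y hy; apply: sA => i j; exact: hy.
Qed.

Lemma mulmx_continuous (V : M) : continuous (fun W : M => V *m W : M).
Proof.
apply: mx_continuous => i j; under eq_fun do rewrite mxE.
apply: continuousC_sum => k; apply: continuousCM; first exact: cst_continuous.
exact: mx_coord_continuous.
Qed.

Lemma measurable_unitary : measurable ([set V | V \is unitarymx] : set (borel M)).
Proof.
rewrite (_ : mkset _ = (fun V : M =>
    complex.Re (\sum_i\sum_j `|(V *m V^t* - 1%:M) i j|)) @^-1` [set 0]).
  rewrite -[X in measurable X]setTI.
  apply: continuous_borel_measurable; [|exact: measurableT|exact: measurable_set1].
  apply: continuousC_Re.
  apply: continuousC_sum => i; apply: continuousC_sum => j.
  apply: continuousC_norm.
  under eq_fun do rewrite !mxE.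
  apply: continuousCD; last exact: cst_continuous.
  apply: continuousC_sum => k; apply: continuousCM.
    exact: mx_coord_continuous.
  under eq_fun do rewrite !mxE.
  by apply: continuousC_conj; exact: mx_coord_continuous.
apply/seteqP; split => V /=.
  move=> /unitarymxP ->; rewrite subrr.
  by rewrite big1// => i _; rewrite big1// => j _; rewrite mxE normr0.
move=> h; apply/unitarymxP/eqP; rewrite -subr_eq0; apply/eqP/matrixP => i j.
rewrite [RHS]mxE; apply/eqP; rewrite -normr_eq0.
have h0 : \sum_i\sum_j `|(V *m V^t* - 1%:M) i j| = 0.
  have : 0 <= \sum_i\sum_j `|(V *m V^t* - 1%:M) i j|.
    by apply: sumr_ge0 => k _; apply: sumr_ge0.
  by move=> /cge0P[-> _]; rewrite h.
have := psumr_eq0P _ h0 (i := i) isT.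
move=> /(_ _)/psumr_eq0P ->//.
by move=> k _; apply: sumr_ge0.
Qed.

Lemma unitary_coord_le1 (V : M) i j : V \is unitarymx -> `|V i j| <= 1.
Proof.
move=> /unitarymxP/matrixP/(_ i i); rewrite !mxE eqxx mulr1n => h.
rewrite -(@expr_le1 _ 2)// -h (bigD1 j)//= !mxE -normCK lerDl.
by apply: sumr_ge0 => k _; rewrite !mxE -normCK exprn_ge0.
Qed.

End mx.

Section nice.
Variables (R : realType) (n : nat).
Local Notation M := 'M[R[i]]_n.
Implicit Types F G : M -> R[i].

(** Functions that the Haar measure can integrate: the bound is asked on the
    unitary matrices only, which carry the measure. *)
Definition nice F := continuous F /\
  exists K : R[i], forall V, V \is unitarymx -> `|F V| <= K.

Lemma nice_cst c : nice (fun=> c).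
Proof. by split; [exact: cst_continuous|exists `|c|]. Qed.

Lemma niceD F G : nice F -> nice G -> nice (fun V => F V + G V).
Proof.
move=> [cF [K hK]] [cG [L hL]]; split.
  exact: (continuousCD cF cG).
exists (K + L) => V uV; apply: (le_trans (ler_normD _ _)).
by apply: lerD; [exact: hK|exact: hL].
Qed.

Lemma niceM F G : nice F -> nice G -> nice (fun V => F V * G V).
Proof.
move=> [cF [K hK]] [cG [L hL]]; split.
  exact: (continuousCM cF cG).
exists (K * L) => V uV; rewrite normrM.
by apply: ler_pM => //; [exact: hK|exact: hL].
Qed.

Lemma niceZ c F : nice F -> nice (fun V => c * F V).
Proof. by move=> ?; apply: niceM => //; exact: nice_cst. Qed.

Lemma niceN F : nice F -> nice (fun V => - F V).
Proof.
move=> h; rewrite (_ : (fun V => _) = (fun V => -1 * F V)); first exact: niceZ.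
by apply/funext => V; rewrite mulN1r.
Qed.

Lemma niceB F G : nice F -> nice G -> nice (fun V => F V - G V).
Proof. by move=> hF hG; apply: niceD => //; exact: niceN. Qed.

Lemma nice_conj F : nice F -> nice (fun V => (F V)^*).
Proof.
move=> [cF [K hK]]; split.
  exact: continuousC_conj.
by exists K => V uV; rewrite norm_conjC; exact: hK.
Qed.

Lemma nice_sum (I : Type) (r : seq I) (F : I -> M -> R[i]) :
  (forall i, nice (F i)) -> nice (fun V => \sum_(i <- r) F i V).
Proof.
move=> h; elim: r => [|i r IH].
  by under eq_fun do rewrite big_nil; exact: nice_cst.
by under eq_fun do rewrite big_cons; apply: niceD.
Qed.

Lemma nice_coord i j : nice (fun V => V i j).
Proof.
by split; [exact: mx_coord_continuous|exists 1 => V; exact: unitary_coord_le1].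
Qed.

Lemma nice_mulmx (W : M) F : W \is unitarymx -> nice F -> nice (fun V => F (W *m V)).
Proof.
move=> uW [cF [K hK]]; split.
  move=> V; apply: (continuous_comp (@mulmx_continuous _ _ W V)); exact: cF.
by exists K => V uV; apply: hK; exact: mul_unitarymx.
Qed.

Lemma nice_Re F : nice F -> nice (fun V => ((complex.Re (F V))%:C)%C).
Proof.
move=> [cF [K hK]]; split.
  apply: Complex_continuous; last exact: cst_continuous.
  exact: continuousC_Re.
exists K => V uV; rewrite (le_trans _ (hK V uV))// normc_def/= expr0n/= addr0.
by rewrite sqrtr_sqr; exact: normc_ge_Re.
Qed.

Lemma nice_Im F : nice F -> nice (fun V => ((complex.Im (F V))%:C)%C).
Proof.
move=> [cF [K hK]]; split.
  apply: Complex_continuous; last exact: cst_continuous.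
  exact: continuousC_Im.
exists K => V uV; rewrite (le_trans _ (hK V uV))// normc_def/= expr0n/= addr0.
by rewrite sqrtr_sqr; exact: normc_ge_Im.
Qed.

End nice.

Section haar_expectation.
Variables (R : realType) (n : nat).
Local Notation M := 'M[R[i]]_n.
Variable mu : probability (borel M) R.
Hypothesis Hmu : is_haar mu.
Implicit Types F G : M -> R[i].

Lemma haar_ae : mu (~` [set V | V \is unitarymx]) = 0%E.
Proof.
have [mu1 _] := Hmu.
rewrite probability_setC; last exact: measurable_unitary.
by rewrite mu1 subee.
Qed.

Lemma nice_integrable (f : M -> R) : continuous f ->
  (exists K, forall V, V \is unitarymx -> `|f V| <= K) ->
  mu.-integrable setT (EFin \o f).
Proof.
move=> cf [K hK].
have mf := continuous_borel_measurable cf.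
apply/(@negligible_integrable _ _ _ mu _ (~` [set V | V \is unitarymx])) => //.
- by apply: measurableC; exact: measurable_unitary.
- exact/measurable_EFinP.
- exact: haar_ae.
rewrite setDE setCK setTI.
apply: measurable_bounded_integrable => //.
- exact: measurable_unitary.
- by have [h _] := Hmu; rewrite [X in (X < _)%E]h ltry.
- exact: measurable_funTS.
exists K; split; first exact: num_real.
by move=> x Kx V /= uV; apply: (le_trans (hK _ uV)); exact: ltW.
Qed.

Lemma nice_cintegrable F : nice F -> cintegrable mu F.
Proof.
move=> [cF [K hK]]; split; apply: nice_integrable.
- exact: continuousC_Re.
- exists (complex.Re K) => V uV; apply: (le_trans (Re_ge0_le_norm _)).
  by apply: Re_le; exact: hK.
- exact: continuousC_Im.
- exists (complex.Re K) => V uV; apply: (le_trans (Im_ge0_le_norm _)).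
  by apply: Re_le; exact: hK.
Qed.

Lemma haar_Rintegral_eq (f g : M -> R) : continuous f -> continuous g ->
  (forall V, V \is unitarymx -> f V = g V) -> \int[mu]_V f V = \int[mu]_V g V.
Proof.
move=> cf cg h; congr fine; apply: ae_eq_integral => //.
- by apply/measurable_EFinP; exact: continuous_borel_measurable.
- by apply/measurable_EFinP; exact: continuous_borel_measurable.
exists (~` [set V | V \is unitarymx]); split.
- by apply: measurableC; exact: measurable_unitary.
- exact: haar_ae.
by move=> V /= hV uV; apply: hV => _; rewrite h.
Qed.

Lemma haar_eq F G : nice F -> nice G ->
  (forall V, V \is unitarymx -> F V = G V) ->
  cexpectation mu F = cexpectation mu G.
Proof.
move=> [cF _] [cG _] h; rewrite !cexpectationE; congr Complex;
  apply: haar_Rintegral_eq.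
- exact: (continuousC_Re cF).
- exact: (continuousC_Re cG).
- by move=> V uV; rewrite h.
- exact: (continuousC_Im cF).
- exact: (continuousC_Im cG).
- by move=> V uV; rewrite h.
Qed.

Lemma haar_ge0 F : nice F -> (forall V, V \is unitarymx -> 0 <= F V) ->
  0 <= cexpectation mu F.
Proof.
move=> nF h.
rewrite (@haar_eq F (fun V => `|F V|))//.
- exact: cexpectation_ge0.
- have [cF [K hK]] := nF; split.
    exact: continuousC_norm.
  by exists K => V uV; rewrite normr_id hK.
- by move=> V uV; rewrite ger0_norm// h.
Qed.

Lemma haarB F G : nice F -> nice G ->
  cexpectation mu (fun V => F V - G V) = cexpectation mu F - cexpectation mu G.
Proof.
move=> nF nG; rewrite -mulN1r -cexpectationZ; last exact: nice_cintegrable.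
rewrite -cexpectationD; [|exact: nice_cintegrable|].
  by congr cexpectation; apply/funext => V; rewrite mulN1r.
by apply: nice_cintegrable; exact: niceZ.
Qed.

Lemma haar_le F G : nice F -> nice G -> (forall V, V \is unitarymx -> F V <= G V) ->
  cexpectation mu F <= cexpectation mu G.
Proof.
move=> nF nG h; rewrite -subr_ge0 -haarB//; apply: haar_ge0.
  exact: niceB.
by move=> V uV; rewrite subr_ge0 h.
Qed.

(** The factor 2 comes from bounding the real and the imaginary part of the
    expectation separately. *)
Lemma haar_norm F G : nice F -> nice G ->
  (forall V, V \is unitarymx -> `|F V| <= G V) ->
  `|cexpectation mu F| <= cexpectation mu G *+ 2.
Proof.
move=> nF nG h.
have E0 : \int[mu]_x (0:R) = 0.
  by rewrite (Rintegral_cst mu measurableT (0:R)) mul0r.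
have bnd (H : M -> R[i]) (r : R) : nice H ->
    (forall V, V \is unitarymx -> - G V <= H V <= G V) ->
    cexpectation mu H = (r%:C)%C -> `|r| <= complex.Re (cexpectation mu G).
  move=> nH hH eH; rewrite ler_norml; apply/andP; split.
    have : cexpectation mu (fun V => - 1 * G V) <= cexpectation mu H.
      apply: haar_le => //; first exact: niceZ.
      by move=> V uV; rewrite mulN1r; have /andP[] := hH V uV.
    rewrite cexpectationZ; last exact: nice_cintegrable.
    by rewrite mulN1r eH => /Re_le; rewrite raddfN.
  have : cexpectation mu H <= cexpectation mu G.
    by apply: haar_le => // V uV; have /andP[] := hH V uV.
  by rewrite eH => /Re_le.
have h1 : `|complex.Re (cexpectation mu F)| <= complex.Re (cexpectation mu G).
  apply: (bnd _ _ (nice_Re nF)); last by rewrite !cexpectationE /= E0.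
  move=> V uV; have [e _] := cge0P (le_trans (normr_ge0 _) (h V uV)).
  rewrite e -rmorphN /= !lecR -ler_norml.
  by apply: (le_trans (Re_ge0_le_norm _)); apply: Re_le; exact: h.
have h2 : `|complex.Im (cexpectation mu F)| <= complex.Re (cexpectation mu G).
  apply: (bnd _ _ (nice_Im nF)); last by rewrite !cexpectationE /= E0.
  move=> V uV; have [e _] := cge0P (le_trans (normr_ge0 _) (h V uV)).
  rewrite e -rmorphN /= !lecR -ler_norml.
  by apply: (le_trans (Im_ge0_le_norm _)); apply: Re_le; exact: h.
have g0 : 0 <= cexpectation mu G.
  by apply: haar_ge0 => // V uV; apply: le_trans (h V uV).
have [-> _] := cge0P g0.
apply: (le_trans (normc_le_ReIm _)).
by rewrite mulr2n -rmorphD /= lecR lerD.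
Qed.

(** The left invariance of the measure of sets, transported to integrals by
    pushing the measure forward. *)
Lemma haar_invariance W F : W \is unitarymx -> nice F ->
  cexpectation mu (fun V => F (W *m V)) = cexpectation mu F.
Proof.
move=> uW nF; have nFW := nice_mulmx uW nF.
have mW : @measurable_fun _ _ (borel M) (borel M) setT (mulmx W).
  by apply: continuous_borel_measurable2; exact: mulmx_continuous.
have key (f : M -> R) : continuous f ->
    mu.-integrable setT (EFin \o (fun V : M => f (W *m V))) ->
    \int[mu]_V f (W *m V) = \int[mu]_V f V.
  move=> cf ifW; congr fine.
  transitivity (\int[pushforward mu (mulmx W : borel M -> borel M)]_y (f y)%:E)%E.
    rewrite (@integral_pushforward _ _ (borel M) (borel M) R _ mW mu setT (EFin \o f))//.
    by apply/measurable_EFinP; exact: continuous_borel_measurable.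
  apply: eq_measure_integral => A mA _.
  by have [_ /(_ W uW A mA)] := Hmu.
have [cF _] := nF; have [i1 i2] := nice_cintegrable nFW.
rewrite !cexpectationE; congr Complex.
  exact: (key (fun V => complex.Re (F V)) (continuousC_Re cF)).
exact: (key (fun V => complex.Im (F V)) (continuousC_Im cF)).
Qed.

End haar_expectation.

(** * Taylor estimates *)

Section trig_estimates.
Variable R : realType.
Implicit Types x y h : R.

Lemma sin_le_norm x : `|sin x| <= `|x|.
Proof.
wlog x0 : x / 0 <= x.
  move=> H; have [x0|x0] := leP 0 x; first exact: H.
  by rewrite -(normrN x) -(normrN (sin x)) -sinN H// oppr_ge0 ltW.
move: x0; rewrite le_eqVlt => /orP[/eqP<-|x0]; first by rewrite sin0.
have [c _ e] := @MVT R sin cos 0 x x0 (fun y _ => is_derive_sin y)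
   (continuous_subspaceT (@continuous_sin R)).
move: e; rewrite sin0 !subr0 => ->.
by rewrite normrM ler_piMl// cos_max.
Qed.

(** Half-angle formula: [1 - cos x = 2 sin^2 (x / 2)]. *)
Lemma onem_cos_le x : 1 - cos x <= x ^+ 2 / 2.
Proof.
have -> : 1 - cos x = (sin (x / 2)) ^+ 2 *+ 2.
  rewrite [in LHS](_ : x = (x / 2) *+ 2); last by rewrite -mulr_natr divfK.
  by rewrite cos_mulr2n; have := cos2Dsin2 (x / 2); rewrite !mulr2n; lra.
have := sin_le_norm (x / 2).
rewrite -ler_sqr ?nnegrE// !real_normK ?num_real// => H.
have e : (x / 2) ^+ 2 = x ^+ 2 / 4 by field.
by move: H; rewrite e -mulr_natr; lra.
Qed.

Lemma norm_onem_cos_le x : `|1 - cos x| <= `|x|.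
Proof.
have -> : 1 - cos x = (sin (x / 2)) ^+ 2 *+ 2.
  rewrite [in LHS](_ : x = (x / 2) *+ 2); last by rewrite -mulr_natr divfK.
  by rewrite cos_mulr2n; have := cos2Dsin2 (x / 2); rewrite !mulr2n; lra.
rewrite normrMn normrX expr2.
have h := sin_le_norm (x/2).
have h2 : `|sin (x/2)| <= 1 by exact: sin_max.
rewrite normrM [X in _ <= _ * X]ger0_norm// in h.
have := normr_ge0 (sin (x/2)).
rewrite mulr2n; nra.
Qed.

Lemma sin_sub_le x : `|sin x - x| <= x ^+ 2.
Proof.
wlog x0 : x / 0 <= x.
  move=> H; have [x0|x0] := leP 0 x; first exact: H.
  by rewrite -(normrN (sin x - x)) opprD -sinN -(sqrrN x) H// oppr_ge0 ltW.
move: x0; rewrite le_eqVlt => /orP[/eqP<-|x0].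
  by rewrite sin0 subrr normr0 sqr_ge0.
have [c cx e] := @MVT R sin cos 0 x x0 (fun y _ => is_derive_sin y)
   (continuous_subspaceT (@continuous_sin R)).
move: e; rewrite sin0 !subr0 => ->.
have -> : cos c * x - x = - ((1 - cos c) * x) by ring.
rewrite normrN normrM expr2 (ger0_norm (ltW x0)) ler_pM2r//.
apply: (le_trans (norm_onem_cos_le _)).
move: cx; rewrite in_itv/= => /andP[c0 cx].
by rewrite gtr0_norm// ltW.
Qed.

Lemma cos_taylor y h : `|cos (y + h) - cos y + h * sin y| <= h ^+ 2 *+ 2.
Proof.
rewrite cosD.
have -> : cos y * cos h - sin y * sin h - cos y + h * sin y =
  - (cos y * (1 - cos h)) - sin y * (sin h - h) by ring.
apply: (le_trans (ler_normB _ _)); rewrite normrN !normrM.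
have h1 : `|cos y| <= 1 by exact: cos_max.
have h2 : `|sin y| <= 1 by exact: sin_max.
have h3 := onem_cos_le h.
have h4 := sin_sub_le h.
rewrite [X in _ * X + _]ger0_norm; last by rewrite subr_ge0 cos_le1.
have h5 : 0 <= 1 - cos h by rewrite subr_ge0 cos_le1.
have := sqr_ge0 h; have := normr_ge0 (sin h - h).
have := normr_ge0 (sin y); have := normr_ge0 (cos y).
rewrite mulr2n; nra.
Qed.

Lemma sin_taylor y h : `|sin (y + h) - sin y - h * cos y| <= h ^+ 2 *+ 2.
Proof.
rewrite sinD.
have -> : sin y * cos h + cos y * sin h - sin y - h * cos y =
  - (sin y * (1 - cos h)) + cos y * (sin h - h) by ring.
apply: (le_trans (ler_normD _ _)); rewrite normrN !normrM.
have h1 : `|cos y| <= 1 by exact: cos_max.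
have h2 : `|sin y| <= 1 by exact: sin_max.
have h3 := onem_cos_le h.
have h4 := sin_sub_le h.
rewrite [X in _ * X + _]ger0_norm; last by rewrite subr_ge0 cos_le1.
have h5 : 0 <= 1 - cos h by rewrite subr_ge0 cos_le1.
have := sqr_ge0 h; have := normr_ge0 (sin h - h).
have := normr_ge0 (sin y); have := normr_ge0 (cos y).
rewrite mulr2n; nra.
Qed.

End trig_estimates.

Section modulus.
Variable R : realType.
Implicit Types z w : R[i].

(** The modulus with values in [R], so that real inequalities can be combined by
    the decision procedures for ordered fields; the norm of [R[i]] takes its
    values in [R[i]]. *)
Definition nm z : R := complex.Re `|z|.

Lemma nmE z : `|z| = ((nm z)%:C)%C.
Proof. exact: normRe. Qed.

Lemma nm_ge0 z : 0 <= nm z.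
Proof. exact: (le_trans (normr_ge0 _) (Re_ge0_le_norm z)). Qed.

Lemma nmM z w : nm (z * w) = nm z * nm w.
Proof. by apply: complexI; rewrite rmorphM /= -!nmE normrM. Qed.

Lemma nmD z w : nm (z + w) <= nm z + nm w.
Proof. by rewrite -lecR rmorphD /= -!nmE ler_normD. Qed.

Lemma nmN z : nm (- z) = nm z.
Proof. by apply: complexI; rewrite -!nmE normrN. Qed.

Lemma nmB z w : nm (z - w) <= nm z + nm w.
Proof. by rewrite -(nmN w) nmD. Qed.

Lemma nmJ z : nm z^* = nm z.
Proof. by apply: complexI; rewrite -!nmE norm_conjC. Qed.

Lemma nm_real (t : R) : nm ((t%:C)%C) = `|t|.
Proof. by apply: complexI; rewrite -!nmE normc_def/= expr0n /= addr0 sqrtr_sqr. Qed.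

Lemma nm_i : nm 'i = 1.
Proof. by apply: complexI; rewrite -nmE normCi. Qed.

Lemma nm_sqr z : (((nm z) ^+ 2)%:C)%C = z * z^*.
Proof. by rewrite -normCK nmE rmorphXn. Qed.

Lemma nm0 : nm 0 = 0. Proof. by rewrite /nm normr0. Qed.

Lemma nm_sum (I : Type) (r : seq I) (P : pred I) (F : I -> R[i]) :
  nm (\sum_(i <- r | P i) F i) <= \sum_(i <- r | P i) nm (F i).
Proof.
elim/big_rec2 : _ => [|i y z _ h]; first by rewrite nm0.
by apply: (le_trans (nmD _ _)); rewrite lerD2l.
Qed.

Definition expi (y : R) : R[i] := Complex (cos y) (sin y).

Lemma nm_expi y : nm (expi y) = 1.
Proof. by apply: complexI; rewrite -nmE normc_def/= cos2Dsin2 sqrtr1. Qed.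

Lemma expi_taylor (x y : R) :
  nm (expi y - expi x - 'i * ((y - x)%:C)%C * expi x) <= (y - x) ^+ 2 *+ 4.
Proof.
have -> : expi y - expi x - 'i * ((y - x)%:C)%C * expi x =
  Complex (cos y - cos x + (y - x) * sin x) (sin y - sin x - (y - x) * cos x).
  by rewrite -complexiE /expi; apply/eqP; rewrite eq_complex /=; apply/andP; split;
    apply/eqP; ring.
apply: (le_trans (norm_le_ReIm _)) => /=.
have := cos_taylor x (y - x); have := sin_taylor x (y - x).
have -> : x + (y - x) = y by ring.
by rewrite -[4%N]/(2 + 2)%N mulrnDr; lra.
Qed.

End modulus.

(** * Infinitesimal invariance of the Haar measure *)

Section rotation.
Variables (R : realType) (n : nat).
Local Notation M := 'M[R[i]]_n.
Implicit Types x : 'cV[R[i]]_n.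

(** The Cayley transform of [i t x x^*], for a vector [x] of square norm [s], is
    [1 + c x x^*] with [c = i t / (1 - i t s / 2)]; this is [c].  The curve is rational in
    [t] and stays in the unitary group, so the exponential of matrices is avoided. *)
Definition rot_coef (s t : R) : R[i] :=
  Complex (- (t ^+ 2 * s / 2) / (1 + t ^+ 2 * s ^+ 2 / 4)) (t / (1 + t ^+ 2 * s ^+ 2 / 4)).

Lemma rot_coef_unitary s t :
  rot_coef s t + (rot_coef s t)^* + rot_coef s t * (rot_coef s t)^* * (s%:C)%C = 0.
Proof.
have D0 : 1 + t ^+ 2 * s ^+ 2 / 4 != 0.
  by rewrite gt_eqF// ltr_wpDr// mulr_ge0// mulr_ge0// sqr_ge0.
apply/eqP; rewrite eq_complex /=; apply/andP; split; apply/eqP; field.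
  by move: D0; apply: contra => /eqP h; apply/eqP; lra.
by move: D0; apply: contra => /eqP h; apply/eqP; lra.
Qed.

Lemma rot_coef_lin s t : 0 <= s -> 0 <= t <= 1 ->
  nm (rot_coef s t - 'i * (t%:C)%C) <= (s + s ^+ 2) * t ^+ 2.
Proof.
move=> s0 /andP[t0 t1].
have D0 : 1 <= 1 + t ^+ 2 * s ^+ 2 / 4.
  by rewrite lerDl// mulr_ge0// mulr_ge0// sqr_ge0.
have D1 : 0 < 1 + t ^+ 2 * s ^+ 2 / 4 by rewrite (lt_le_trans ltr01).
apply: (le_trans (norm_le_ReIm _)).
rewrite -complexiE /=.
set D := 1 + _ in D0 D1 *.
have -> : - (t ^+ 2 * s / 2) / D - (0 * t - 1 * 0) = - ((t ^+ 2 * s / 2) / D) by ring.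
have -> : t / D - (0 * 0 + 1 * t) = - ((t * (t ^+ 2 * s ^+ 2 / 4)) / D).
  by rewrite /D; field; rewrite gt_eqF//; move: D1; rewrite /D; lra.
rewrite !normrN.
have dle (u : R) : 0 <= u -> `|u / D| <= u.
  move=> u0; rewrite ger0_norm; last by rewrite divr_ge0// ltW.
  by rewrite ler_pdivrMr// ler_peMr.
have a1 : 0 <= t ^+ 2 * s / 2 by rewrite divr_ge0// mulr_ge0// sqr_ge0.
have a2 : 0 <= t * (t ^+ 2 * s ^+ 2 / 4).
  by rewrite mulr_ge0// divr_ge0// mulr_ge0// sqr_ge0.
apply: (le_trans (lerD (dle _ a1) (dle _ a2))).
have t2 : 0 <= t ^+ 2 by exact: sqr_ge0.
have ts : 0 <= t ^+ 2 * s by rewrite mulr_ge0.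
have tss : 0 <= t ^+ 2 * s ^+ 2 by rewrite mulr_ge0// sqr_ge0.
nra.
Qed.

Definition sqn x : R := \sum_a nm (x a ord0) ^+ 2.

Lemma sqn_ge0 x : 0 <= sqn x.
Proof. by apply: sumr_ge0 => a _; exact: sqr_ge0. Qed.

Lemma sqnE x : x^t* *m x = (((sqn x)%:C)%C)%:M.
Proof.
apply/matrixP => i j; rewrite !mxE !ord1 eqxx mulr1n /sqn rmorph_sum /=.
apply: eq_bigr => a _; rewrite nm_sqr !mxE mulrC.
by [].
Qed.

Definition rot x (t : R) : M := 1%:M + rot_coef (sqn x) t *: (x *m x^t*).

Lemma rot_unitary x t : rot x t \is unitarymx.
Proof.
have pc : (x *m x^t*)^t* = x *m x^t*.
  apply/matrixP => i j; rewrite !mxE rmorph_sum; apply: eq_bigr => k _.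
  by rewrite !mxE rmorphM /= conjCK mulrC.
have pp : (x *m x^t*) *m (x *m x^t*) = ((sqn x)%:C)%C *: (x *m x^t*).
  by rewrite mulmxA -(mulmxA x) sqnE mul_mx_scalar -scalemxAl.
apply/unitarymxP; rewrite /rot; set c := rot_coef _ _.
have -> : (1%:M + c *: (x *m x^t*)) ^t* = 1%:M + c^* *: (x *m x^t*).
  apply/matrixP => i j; move/matrixP : pc => /(_ i j); rewrite !mxE => pc.
  by rewrite rmorphD rmorphM /= pc (eq_sym j i); case: eqP; rewrite ?rmorph1 ?rmorph0.
rewrite mulmxDl mul1mx mulmxDr mulmx1 -scalemxAl -scalemxAr pp !scalerA.
rewrite -addrA -scalerDl addrC -[RHS]add0r; congr (_ + _).
by rewrite -scalerDl addrA [c^* + c]addrC rot_coef_unitary scale0r.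
Qed.

End rotation.

Section derivation.
Variables (R : realType) (n : nat).
Local Notation M := 'M[R[i]]_n.
Implicit Types (x : 'cV[R[i]]_n) (F G : M -> R[i]) (D E : 'I_n -> 'I_n -> M -> R[i]).

(** The derivative in the direction [i x x^*] of a function whose complexified
    partial derivatives are [D a b]. *)
Definition dir x D (V : M) : R[i] :=
  'i * \sum_a \sum_b x a ord0 * (x b ord0)^* * D a b V.

(** The remainder is quadratic, uniformly over the unitary group: such expansions
    can be integrated term by term. *)
Definition has_deriv F D := [/\ nice F, (forall a b, nice (D a b)) &
  forall x, exists2 K : R, 0 <= K & forall t : R, 0 <= t <= 1 ->
    forall V, V \is unitarymx ->
    nm (F (rot x t *m V) - F V - (t%:C)%C * dir x D V) <= K * t ^+ 2].

Lemma nice_bound F : nice F ->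
  exists2 K : R, 0 <= K & forall V, V \is unitarymx -> nm (F V) <= K.
Proof.
move=> [_ [K hK]]; exists `|complex.Re K| => // V uV.
by apply: (le_trans (Re_le (hK V uV))); exact: ler_norm.
Qed.

Lemma nice_dir x D : (forall a b, nice (D a b)) -> nice (dir x D).
Proof.
by move=> h; apply: niceZ; apply: nice_sum => a; apply: nice_sum => b; apply: niceZ.
Qed.

Lemma dirD x D E V : dir x (fun a b V => D a b V + E a b V) V = dir x D V + dir x E V.
Proof.
rewrite /dir -mulrDr -big_split; congr (_ * _); apply: eq_bigr => a _ /=.
by rewrite -big_split; apply: eq_bigr => b _ /=; rewrite mulrDr.
Qed.

Lemma dirM x D F V : dir x (fun a b V => D a b V * F V) V = dir x D V * F V.
Proof.
rewrite /dir -mulrA mulr_suml; congr (_ * _); apply: eq_bigr => a _ /=.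
by rewrite mulr_suml; apply: eq_bigr => b _ /=; rewrite mulrA.
Qed.

Lemma eq_dir x D E V : (forall a b, D a b V = E a b V) -> dir x D V = dir x E V.
Proof.
by move=> h; congr (_ * _); apply: eq_bigr => a _; apply: eq_bigr => b _; rewrite h.
Qed.

Lemma has_deriv_cst c : has_deriv (fun=> c) (fun _ _ _ => 0).
Proof.
split; [exact: nice_cst|by move=> *; exact: nice_cst|].
move=> x; exists 0 => // t _ V _.
rewrite /dir big1 ?mulr0; last by move=> a _; rewrite big1// => b _; rewrite mulr0.
by rewrite subrr subr0 nm0 mul0r.
Qed.

Lemma has_derivD F D G E : has_deriv F D -> has_deriv G E ->
  has_deriv (fun V => F V + G V) (fun a b V => D a b V + E a b V).
Proof.
move=> [nF nD hF] [nG nE hG]; split; [exact: niceD|by move=> a b; apply: niceD|].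
move=> x; have [K K0 hK] := hF x; have [L L0 hL] := hG x.
exists (K + L) => [|t ht V uV]; first exact: addr_ge0.
rewrite dirD mulrDl; apply: le_trans (lerD (hK t ht V uV) (hL t ht V uV)).
apply: le_trans (nmD _ _); rewrite le_eqVlt; apply/orP; left; apply/eqP.
by congr nm; ring.
Qed.

Lemma has_derivM F D G E : has_deriv F D -> has_deriv G E ->
  has_deriv (fun V => F V * G V) (fun a b V => D a b V * G V + F V * E a b V).
Proof.
move=> [nF nD hF] [nG nE hG]; split; [exact: niceM| |].
  by move=> a b; apply: niceD; apply: niceM.
move=> x; have [K K0 hK] := hF x; have [L L0 hL] := hG x.
have [A A0 hA] := nice_bound nF; have [B B0 hB] := nice_bound nG.
have [dA dA0 hdA] := nice_bound (nice_dir x nD).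
have [dB dB0 hdB] := nice_bound (nice_dir x nE).
exists (K * B + A * L + dA * (L + dB)) => [|t ht V uV].
  by rewrite !addr_ge0 ?mulr_ge0 ?addr_ge0.
rewrite dirD dirM.
have -> : dir x (fun a b V => F V * E a b V) V = F V * dir x E V.
  rewrite mulrC -dirM; apply: eq_dir => a b; exact: mulrC.
have uV' : rot x t *m V \is unitarymx := mul_unitarymx (rot_unitary x t) uV.
have -> : F (rot x t *m V) * G (rot x t *m V) - F V * G V -
   (t%:C)%C * (dir x D V * G V + F V * dir x E V) =
   (F (rot x t *m V) - F V - (t%:C)%C * dir x D V) * G (rot x t *m V) +
   F V * (G (rot x t *m V) - G V - (t%:C)%C * dir x E V) +
   (t%:C)%C * dir x D V * ((G (rot x t *m V) - G V - (t%:C)%C * dir x E V) + (t%:C)%C * dir x E V).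
  ring.
apply: (le_trans (nmD _ _)).
apply: (le_trans (lerD (nmD _ _) (lexx _))).
rewrite (nmM _ (G (rot x t *m V))) (nmM (F V)) (nmM (_ * dir x D V)) (nmM _ (dir x D V)).
have h1 := hK t ht V uV; have h2 := hL t ht V uV.
have h3 : nm (G (rot x t *m V) - G V - (t%:C)%C * dir x E V + (t%:C)%C * dir x E V) <=
   L * t ^+ 2 + t * dB.
  apply: (le_trans (nmD _ _)); apply: lerD => //.
  rewrite nmM nm_real ger0_norm; last by case/andP: ht.
  by apply: ler_wpM2l; [case/andP: ht|exact: hdB].
case/andP: ht => t0 t1.
rewrite nm_real ger0_norm//.
have g1 : nm (F (rot x t *m V) - F V - (t%:C)%C * dir x D V) * nm (G (rot x t *m V)) <=
   K * t ^+ 2 * B by apply: ler_pM; rewrite ?nm_ge0 ?hB.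
have g2 : nm (F V) * nm (G (rot x t *m V) - G V - (t%:C)%C * dir x E V) <= A * (L * t ^+ 2).
  by apply: ler_pM; rewrite ?nm_ge0 ?hA.
have g3 : t * nm (dir x D V) * nm (G (rot x t *m V) - G V - (t%:C)%C * dir x E V + (t%:C)%C * dir x E V)
   <= t * dA * (L * t ^+ 2 + t * dB).
  by apply: ler_pM; rewrite ?nm_ge0 ?mulr_ge0 ?nm_ge0// ler_wpM2l// hdA.
apply: (le_trans (lerD (lerD g1 g2) g3)).
have -> : t * dA * (L * t ^+ 2 + t * dB) = dA * (L * t + dB) * t ^+ 2 by ring.
rewrite [leRHS](_ : _ = K * t ^+ 2 * B + A * (L * t ^+ 2) + dA * (L + dB) * t ^+ 2); last by ring.
rewrite lerD2l ler_wpM2r ?sqr_ge0// ler_wpM2l// lerD2r -[leRHS]mulr1.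
exact: ler_wpM2l.
Qed.

Lemma has_derivZ c F D : has_deriv F D ->
  has_deriv (fun V => c * F V) (fun a b V => c * D a b V).
Proof.
move=> h; have := has_derivM (has_deriv_cst c) h.
rewrite (_ : (fun a b V => 0 * F V + c * D a b V) = (fun a b V => c * D a b V))//.
by apply/funext => a; apply/funext => b; apply/funext => V; rewrite mul0r add0r.
Qed.

Lemma has_deriv_sum (I : Type) (r : seq I) (F_ : I -> M -> R[i]) (D_ : I -> 'I_n -> 'I_n -> M -> R[i]) :
  (forall i : I, has_deriv (F_ i) (D_ i)) ->
  has_deriv (fun V => \sum_(i <- r) F_ i V) (fun a b V => \sum_(i <- r) D_ i a b V).
Proof.
move=> h; elim: r => [|i r IH].
  under eq_fun do rewrite big_nil.
  rewrite (_ : (fun (a b : 'I_n) (V : M) => \sum_(i <- [::]) D_ i a b V) =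
    (fun _ _ _ => 0)); first exact: has_deriv_cst.
  by apply/funext => a; apply/funext => b; apply/funext => V; rewrite big_nil.
under eq_fun do rewrite big_cons.
rewrite (_ : (fun (a b : 'I_n) (V : M) => \sum_(j <- i :: r) D_ j a b V) =
    (fun a b V => D_ i a b V + \sum_(j <- r) D_ j a b V)).
  exact: has_derivD.
by apply/funext => a; apply/funext => b; apply/funext => V; rewrite big_cons.
Qed.

(** Conjugating [i x_a conj(x_b) D_ab] changes the sign and exchanges the indices. *)
Lemma has_deriv_conj F D : has_deriv F D ->
  has_deriv (fun V => (F V)^*) (fun a b V => - (D b a V)^*).
Proof.
move=> [nF nD hF]; split; first exact: nice_conj.
  by move=> a b; apply: niceN; exact: nice_conj.
move=> x; have [K K0 hK] := hF x; exists K => // t ht V uV.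
apply: le_trans (hK t ht V uV); rewrite -[leRHS]nmJ.
rewrite le_eqVlt; apply/orP; left; apply/eqP; congr nm.
rewrite !rmorphB /= rmorphM /= [(t%:C)%C^*]conjc_real; congr (_ - _ - _ * _).
rewrite /dir rmorphM /= conjCi rmorph_sum mulNr -mulrN; congr (_ * _).
rewrite exchange_big /= -sumrN; apply: eq_bigr => a _ /=.
rewrite rmorph_sum -sumrN; apply: eq_bigr => b _ /=.
by rewrite !rmorphM /= conjCK mulrN; congr (- (_ * _)); rewrite mulrC.
Qed.

Lemma has_deriv_coord c j :
  has_deriv (fun V => V c j) (fun a b V => (a == c)%:R * V b j).
Proof.
split; first exact: nice_coord.
  by move=> a b; apply: niceZ; exact: nice_coord.
move=> x; have s0 := sqn_ge0 x.
have [B B0 hB] : exists2 B : R, 0 <= B & forall V : M, V \is unitarymx ->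
   nm (x c ord0 * \sum_b (x b ord0)^* * V b j) <= B.
  apply: nice_bound; apply: niceZ; apply: nice_sum => b; apply: niceZ; exact: nice_coord.
exists ((sqn x + sqn x ^+ 2) * B) => [|t ht V uV].
  by rewrite mulr_ge0// addr_ge0// sqr_ge0.
have -> : (rot x t *m V) c j = V c j + rot_coef (sqn x) t * (x c ord0 * \sum_b (x b ord0)^* * V b j).
  rewrite /rot mulmxDl mul1mx mxE -scalemxAl mxE -mulmxA mxE big_ord1.
  congr (_ + _ * (_ * _)); rewrite mxE; apply: eq_bigr => b _.
  by rewrite !mxE.
have -> : dir x (fun a b V => (a == c)%:R * V b j) V = 'i * (x c ord0 * \sum_b (x b ord0)^* * V b j).
  rewrite /dir; congr (_ * _); rewrite (bigD1 c)//= [X in _ + X]big1 ?addr0; last first.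
    by move=> a /negbTE ac; rewrite big1// => b _; rewrite ac mul0r mulr0.
  rewrite mulr_sumr; apply: eq_bigr => b _; rewrite eqxx mul1r mulrA; by [].
set S := x c ord0 * _.
have -> : V c j + rot_coef (sqn x) t * S - V c j - (t%:C)%C * ('i * S) =
   (rot_coef (sqn x) t - 'i * (t%:C)%C) * S by ring.
rewrite nmM mulrAC; apply: ler_pM; rewrite ?nm_ge0//.
  exact: rot_coef_lin.
exact: hB.
Qed.

Lemma has_deriv_expi F D : (forall V, F V = ((complex.Re (F V))%:C)%C) -> has_deriv F D ->
  has_deriv (fun V => expi (complex.Re (F V)))
            (fun a b V => 'i * expi (complex.Re (F V)) * D a b V).
Proof.
move=> rF [nF nD hF].
have nexp : nice (fun V => expi (complex.Re (F V))).
  have [cF _] := nF; split.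
    apply: Complex_continuous => V.
      by apply: (continuous_comp (continuousC_Re cF (x := V))); exact: continuous_cos.
    by apply: (continuous_comp (continuousC_Re cF (x := V))); exact: continuous_sin.
  by exists 1 => V _; rewrite nmE nm_expi.
split => //.
  by move=> a b; apply: niceM => //; apply: niceZ.
move=> x; have [K K0 hK] := hF x.
have [dA dA0 hdA] := nice_bound (nice_dir x nD).
exists (K + (K + dA) ^+ 2 *+ 4) => [|t ht V uV].
  by rewrite addr_ge0// mulrn_wge0// sqr_ge0.
set V' := rot x t *m V.
have h1 := hK t ht V uV.
have -> : dir x (fun a b V => 'i * expi (complex.Re (F V)) * D a b V) V =
  dir x D V * ('i * expi (complex.Re (F V))).
  rewrite -(dirM x D (fun V => 'i * expi (complex.Re (F V)))).
  by apply: eq_dir => a b; rewrite mulrC.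
set y := complex.Re (F V'); set z := complex.Re (F V).
have e : expi y - expi z - (t%:C)%C * (dir x D V * ('i * expi z)) =
  (expi y - expi z - 'i * ((y - z)%:C)%C * expi z) +
  'i * expi z * (F V' - F V - (t%:C)%C * dir x D V).
  rewrite (rF V') (rF V) -/y -/z rmorphB /=; ring.
rewrite e; apply: (le_trans (nmD _ _)); rewrite addrC mulrDl.
apply: lerD.
  by rewrite !nmM nm_i nm_expi !mul1r.
apply: (le_trans (expi_taylor _ _)).
rewrite mulrnAl -exprMn lerMn2r/= -(real_normK (num_real (y - z))).
rewrite lerXn2r ?nnegrE//.
  by rewrite mulr_ge0// ?addr_ge0//; case/andP: ht.
rewrite -nm_real rmorphB /= /y /z -(rF V') -(rF V).
have -> : F V' - F V = (F V' - F V - (t%:C)%C * dir x D V) + (t%:C)%C * dir x D V by ring.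
apply: (le_trans (nmD _ _)); rewrite mulrDl; case/andP: (ht) => t0 t1; apply: lerD.
  apply: (le_trans h1); rewrite ler_wpM2l// expr2.
  by rewrite -[leRHS]mulr1 ler_wpM2l.
by rewrite nmM nm_real ger0_norm// mulrC ler_wpM2r// hdA.
Qed.

Variable mu : probability (borel M) R.
Hypothesis Hmu : is_haar mu.

Lemma haar_nm F K : nice F -> (forall V, V \is unitarymx -> nm (F V) <= K) ->
  nm (cexpectation mu F) <= K *+ 2.
Proof.
move=> nF hF.
have := @haar_norm _ _ _ Hmu _ _ nF (@nice_cst R n ((K)%:C)%C).
rewrite cexpectation_cst => h.
have /Re_le : `|cexpectation mu F| <= ((K)%:C)%C *+ 2.
  by apply: h => V uV; rewrite nmE lecR hF.
by rewrite !mulr2n raddfD.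
Qed.

(** Invariance along the curve [rot x] kills the first-order term for every [x],
    that is [sum_ab x_a conj(x_b) E[D_ab] = 0]; polarization in [x] isolates each
    [E[D_ab]]. *)
Lemma haar_deriv F D a b : has_deriv F D -> cexpectation mu (D a b) = 0.
Proof.
move=> [nF nD hF].
pose m a b := cexpectation mu (D a b).
have Q x : \sum_a \sum_b x a ord0 * (x b ord0)^* * m a b = 0.
  have -> : \sum_a \sum_b x a ord0 * (x b ord0)^* * m a b = - 'i * cexpectation mu (dir x D).
    rewrite cexpectationZ; last first.
      apply: nice_cintegrable => //; apply: nice_sum => {}a; apply: nice_sum => {}b; exact: niceZ.
    rewrite mulrA mulNr -expr2 sqrCi opprK mul1r cexpectation_sum; last first.
      move=> {}a _; apply: nice_cintegrable => //; apply: nice_sum => {}b; exact: niceZ.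
    apply: eq_bigr => {}a _; rewrite cexpectation_sum; last first.
      by move=> {}b _; apply: nice_cintegrable => //; exact: niceZ.
    by apply: eq_bigr => {}b _; rewrite cexpectationZ//; apply: nice_cintegrable.
  suff -> : cexpectation mu (dir x D) = 0 by rewrite mulr0.
  have [K K0 hK] := hF x.
  have ndir := nice_dir x nD.
  have bnd t : 0 <= t <= 1 -> t * nm (cexpectation mu (dir x D)) <= K * t ^+ 2 *+ 2.
    move=> ht; have [t0 _] := andP ht.
    have nrot : nice (fun V => F (rot x t *m V)) by apply: nice_mulmx => //; exact: rot_unitary.
    have nd : nice (fun V => F (rot x t *m V) - F V) by exact: niceB.
    have ndt : nice (fun V => (t%:C)%C * dir x D V) by exact: niceZ.
    have nH : nice (fun V => F (rot x t *m V) - F V - (t%:C)%C * dir x D V) by exact: niceB.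
    have nH0 : forall V : M, V \is unitarymx ->
      nm (F (rot x t *m V) - F V - (t%:C)%C * dir x D V) <= K * t ^+ 2.
      by move=> V uV; exact: hK.
    have := haar_nm nH nH0.
    rewrite haarB// haarB// haar_invariance//; last exact: rot_unitary.
    rewrite subrr sub0r nmN cexpectationZ ?nmM ?nm_real ?ger0_norm//.
    exact: nice_cintegrable.
  apply/eqP; rewrite -normr_eq0 nmE; apply/eqP; congr ((_%:C)%C).
  apply/eqP; rewrite eq_le nm_ge0 andbT; apply/ler_addgt0Pl => e e0.
  rewrite addr0.
  (* t * |E dir| <= 2 K t^2 for all small t: divide by t and let t tend to 0 *)
  pose t := Num.min 1 (e / (K * 2 + 1)).
  have K1 : 0 < K * 2 + 1 by rewrite ltr_wpDl// mulr_ge0.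
  have t0 : 0 < t by rewrite lt_min ltr01 divr_gt0.
  have t1 : t <= 1 by rewrite ge_min lexx.
  have := bnd t; rewrite (ltW t0) t1 => /(_ isT).
  rewrite -mulrnAl expr2 mulrA [X in _ <= X]mulrC ler_pM2l// => h.
  apply: (le_trans h).
  have : t <= e / (K * 2 + 1) by rewrite ge_min lexx orbT.
  rewrite ler_pdivlMr// mulr2n => h2.
  by have := ltW t0; nra.
(* Q says that the sesquilinear form B vanishes on the diagonal *)
pose B x (y : 'cV[R[i]]_n) := \sum_a \sum_b x a ord0 * (y b ord0)^* * m a b : R[i].
have BDl x y z : B (x + y) z = B x z + B y z.
  rewrite /B -big_split; apply: eq_bigr => c _ /=; rewrite -big_split.
  by apply: eq_bigr => e _ /=; rewrite mxE !mulrDl.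
have BDr x y z : B z (x + y) = B z x + B z y.
  rewrite /B -big_split; apply: eq_bigr => c _ /=; rewrite -big_split.
  by apply: eq_bigr => e _ /=; rewrite mxE rmorphD mulrDr mulrDl.
have BZl u x z : B (u *: x) z = u * B x z.
  rewrite /B mulr_sumr; apply: eq_bigr => c _ /=; rewrite mulr_sumr.
  by apply: eq_bigr => e _ /=; rewrite mxE !mulrA.
have BZr u x z : B z (u *: x) = u^* * B z x.
  rewrite /B mulr_sumr; apply: eq_bigr => c _ /=; rewrite mulr_sumr.
  by apply: eq_bigr => e _ /=; rewrite mxE rmorphM /=; ring.
have Bd (c e : 'I_n) : B (delta_mx c ord0) (delta_mx e ord0) = m c e.
  rewrite /B (bigD1 c)//= [X in _ + X]big1 ?addr0; last first.
    by move=> i /negbTE ic; rewrite big1// => j _; rewrite mxE ic !mul0r.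
  rewrite (bigD1 e)//= [X in _ + X]big1 ?addr0; last first.
    by move=> i /negbTE ic; rewrite !mxE ic rmorph0 mulr0 mul0r.
  have d1 (k : 'I_n) : delta_mx k (ord0 : 'I_1) k ord0 = 1 :> R[i] by rewrite mxE !eqxx.
  by rewrite !d1 conjC1 mulr1 mul1r.
have q1 := Q (delta_mx a ord0 + delta_mx b ord0).
have q2 := Q (delta_mx a ord0 + 'i *: delta_mx b ord0).
have qa := Q (delta_mx a ord0).
have qb := Q (delta_mx b ord0).
move: q1 q2 qa qb; rewrite -![\sum_a _]/(B _ _) !(BDl, BDr, BZl, BZr) !Bd conjCi.
rewrite -/(m a b) => q1 q2 qa qb.
rewrite qa qb in q1 q2.
have q3 : m a b + m b a = 0 by rewrite -q1; ring.
have q4 : m a b - m b a = 0.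
  have : 'i * (m b a - m a b) = 0 by rewrite -[RHS]q2; ring.
  move/eqP; rewrite mulf_eq0 (negbTE (neq0Ci _)) /= subr_eq0 => /eqP ->; exact: subrr.
have : m a b * 2 = 0 by rewrite -[RHS]q3; move/eqP: q4; rewrite subr_eq0 => /eqP ->; ring.
by move/eqP; rewrite mulf_eq0 pnatr_eq0 orbF => /eqP.
Qed.

End derivation.

(** * Integration by parts for bilinear forms of columns *)

Section columns.
Variables (R : realType) (n' : nat).
Local Notation n := n'.+1.
Local Notation M := 'M[R[i]]_n.
Variables (p : nat) (t : 'I_p -> 'I_n).
Hypothesis t_inj : injective t.
Implicit Types (be ga h : 'I_n -> R[i]) (i j k l : 'I_p).

(** The bilinear form [u_i^* diag(be) u_j] of the columns [t i] and [t j]. *)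
Definition bil be i j (V : M) : R[i] := \sum_a (V a (t i))^* * be a * V a (t j).

Lemma nice_bil be i j : nice (bil be i j).
Proof.
apply: nice_sum => a; apply: niceM; last exact: nice_coord.
apply: niceM; last exact: nice_cst.
by apply: nice_conj; exact: nice_coord.
Qed.

(** The commutator of [diag(h)] with the matrix unit [(a, b)], between two columns. *)
Definition dbil h k l (a b : 'I_n) (V : M) : R[i] :=
  (h a - h b) * ((V a (t k))^* * V b (t l)).

Lemma has_deriv_bil h k l : has_deriv (bil h k l) (dbil h k l).
Proof.
have := has_deriv_sum (index_enum 'I_n) (fun a => has_derivM
  (has_derivM (has_deriv_conj (has_deriv_coord R a (t k))) (has_deriv_cst n (h a)))
  (has_deriv_coord R a (t l))).
rewrite (_ : (fun a b V => _) = dbil h k l)//.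
apply/funext => a; apply/funext => b; apply/funext => V; rewrite /dbil.
rewrite big_split /= (bigD1 b)//= [X in _ + X + _]big1 ?addr0; last first.
  move=> c; rewrite eq_sym => /negbTE cb.
  by rewrite cb mul0r rmorph0 oppr0 mul0r mulr0 addr0 mul0r.
rewrite (bigD1 a)//= [X in _ + (_ + X)]big1 ?addr0; last first.
  move=> c; rewrite eq_sym => /negbTE cb.
  by rewrite cb mul0r mulr0.
by rewrite !eqxx !mul1r; ring.
Qed.

Lemma col_orth i j (V : M) : V \is unitarymx ->
  \sum_a (V a (t i))^* * V a (t j) = (i == j)%:R.
Proof.
move=> /unitarymxP/mulmx1C/matrixP/(_ (t i) (t j)); rewrite !mxE (inj_eq t_inj) => <-.
by apply: eq_bigr => a _; rewrite !mxE.
Qed.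

Variable mu : probability (borel M) R.
Hypothesis Hmu : is_haar mu.
Local Notation E := (cexpectation mu).

(** [haar_deriv] for [be_a V_{a,tj} conj(V_{b,ti}) g], summed over [a] and [b].  The
    derivative of [V_{a,tj}] brings in [sum_b V_{b,tj} conj(V_{b,ti})], which orthonormality
    of the columns evaluates; that of [conj(V_{b,ti})] gives [n] copies of the bilinear
    form. *)
Lemma haar_ibp be i j g Dg : has_deriv g Dg ->
  n%:R * E (fun V => bil be i j V * g V) =
  (i == j)%:R * (\sum_a be a) * E g +
  E (fun V => \sum_a \sum_b be a * V a (t j) * (V b (t i))^* * Dg a b V).
Proof.
move=> hg; have [ng nDg _] := hg.
(* the Leibniz rule for D_ab on the three factors *)
pose DF a b (V : M) := be a * V b (t j) * (V b (t i))^* * g V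
  - be a * V a (t j) * (V a (t i))^* * g V
  + be a * V a (t j) * (V b (t i))^* * Dg a b V.
have nc (a c : 'I_n) : nice (fun V : M => V a c) by exact: nice_coord.
have nS : nice (fun V => \sum_a \sum_b be a * V a (t j) * (V b (t i))^* * Dg a b V).
  apply: nice_sum => a; apply: nice_sum => b; apply: niceM => //.
  by apply: niceM; [exact: niceZ|exact: nice_conj].
have nDF a b : nice (DF a b).
  have n1 c c' : nice (fun V : M => be a * V c (t j) * (V c' (t i))^* * g V).
    by apply: niceM => //; apply: niceM; [exact: niceZ|exact: nice_conj].
  apply: niceD; first by apply: niceB.
  by apply: niceM => //; apply: niceM; [exact: niceZ|exact: nice_conj].
have E0 a b : E (DF a b) = 0.
  have := haar_deriv Hmu a b (has_derivM (has_derivM (has_derivZ (be a)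
     (has_deriv_coord R a (t j))) (has_deriv_conj (has_deriv_coord R b (t i)))) hg).
  rewrite (_ : (fun V => _) = DF a b)//; apply/funext => V.
  by rewrite /DF !eqxx !mul1r; ring.
have : E (fun V => \sum_a \sum_b DF a b V) = 0.
  rewrite cexpectation_sum; last first.
    by move=> a _; apply: nice_cintegrable => //; apply: nice_sum => b.
  rewrite big1// => a _; rewrite cexpectation_sum ?big1// => b _.
  exact: nice_cintegrable.
rewrite (@haar_eq _ _ _ Hmu _ (fun V => (i == j)%:R * (\sum_a be a) * g V
   + (- n%:R) * (bil be i j V * g V)
   + \sum_a \sum_b be a * V a (t j) * (V b (t i))^* * Dg a b V)).
- rewrite cexpectationD; [|apply: nice_cintegrable => //..]; last first.
    by apply: niceD; apply: niceZ => //; apply: niceM => //; exact: nice_bil.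
  rewrite cexpectationD; [|apply: nice_cintegrable => //..].
  + rewrite !cexpectationZ; [|apply: nice_cintegrable => //..].
    * move=> /eqP; rewrite mulNr addrAC subr_eq0 => /eqP <-; by [].
    * by apply: niceM => //; exact: nice_bil.
  + exact: niceZ.
  + by apply: niceZ; apply: niceM => //; exact: nice_bil.
- by apply: nice_sum => a; apply: nice_sum => b.
- apply: niceD => //; apply: niceD; first exact: niceZ.
  by apply: niceZ; apply: niceM => //; exact: nice_bil.
move=> V uV; rewrite /DF.
under eq_bigr do rewrite big_split /=.
rewrite big_split /=; congr (_ + _).
under eq_bigr do rewrite big_split /=.
rewrite big_split /=; congr (_ + _).
  rewrite exchange_big /= -(col_orth i j uV) mulrAC !mulr_suml; apply: eq_bigr => a _.
  rewrite mulr_sumr; apply: eq_bigr => b _; ring.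
rewrite mulNr /bil mulr_suml mulr_sumr -sumrN; apply: eq_bigr => a _.
by rewrite sumr_const card_ord -mulr_natl; ring.
Qed.

(** Normalized trace, and normalized second absolute moment, of a diagonal. *)
Definition ntr be : R[i] := n%:R^-1 * \sum_a be a.
Definition m2 be : R := n%:R^-1 * \sum_a nm (be a) ^+ 2.

Lemma n_neq0 : n%:R != 0 :> R[i]. Proof. by rewrite pnatr_eq0. Qed.

Lemma haar_bil be i j : E (bil be i j) = (i == j)%:R * ntr be.
Proof.
have := haar_ibp be i j (has_deriv_cst n (1 : R[i])).
rewrite (_ : (fun V => bil be i j V * 1) = bil be i j); last by apply/funext => V; rewrite mulr1.
rewrite cexpectation_cst mulr1.
rewrite (_ : (fun V : M => \sum_a \sum_b be a * V a (t j) * (V b (t i))^* * 0) = fun=> 0); last first.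
  by apply/funext => V; rewrite big1// => a _; rewrite big1// => b _; rewrite mulr0.
rewrite cexpectation_cst addr0 => h.
by apply: (mulfI n_neq0); rewrite h /ntr mulrCA mulVKf// n_neq0.
Qed.

Lemma bil_real_diag (w : 'I_n -> R) i V :
  bil (fun a => ((w a)%:C)%C) i i V = ((\sum_a w a * nm (V a (t i)) ^+ 2)%:C)%C.
Proof.
rewrite rmorph_sum /bil; apply: eq_bigr => a _ /=.
by rewrite rmorphM /= nm_sqr; ring.
Qed.

Lemma cexpectation_real (f : M -> R) :
  E (fun V => ((f V)%:C)%C) = ((\int[mu]_V f V)%:C)%C.
Proof.
rewrite cexpectationE /=; congr Complex.
by rewrite (Rintegral_cst mu measurableT (0:R)) mul0r.
Qed.

Lemma nice_nm2 F : nice F -> nice (fun V : M => ((nm (F V) ^+ 2)%:C)%C).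
Proof.
move=> nF; under eq_fun do rewrite nm_sqr.
by apply: niceM => //; exact: nice_conj.
Qed.

(** By [nm (w - z) <= nm w + nm z] and the arithmetic-geometric mean inequality. *)
Lemma nm_sqrD_le (z w : R[i]) : nm z * nm (w - z) <= 3 / 2 * nm z ^+ 2 + 2^-1 * nm w ^+ 2.
Proof.
have h := nmB w z; have z0 := nm_ge0 z; have w0 := nm_ge0 w.
have := sqr_ge0 (nm z - nm w); nra.
Qed.

(** Integration by parts against the conjugate of the same form: the trace term
    vanishes, and the remaining double sum is bounded, pointwise on the unitary
    group, by diagonal forms whose means are known. *)
Lemma haar_bil_var0 ga i j : \sum_a ga a = 0 ->
  \int[mu]_V nm (bil ga i j V) ^+ 2 <= 4 / n%:R * m2 ga.
Proof.
move=> ga0.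
have := haar_ibp ga i j (has_deriv_conj (has_deriv_bil ga i j)).
rewrite ga0 mulr0 mul0r add0r.
rewrite (_ : (fun V => bil ga i j V * (bil ga i j V)^*) =
   fun V => ((nm (bil ga i j V) ^+ 2)%:C)%C); last first.
  by apply/funext => V; rewrite nm_sqr.
rewrite cexpectation_real.
pose S (V : M) := \sum_a \sum_b ga a * V a (t j) * (V b (t i))^* * - (dbil ga i j b a V)^*.
rewrite -[X in _ = E X]/S => eS.
have nS : nice S.
  have nc (a c : 'I_n) : nice (fun V : M => V a c) by exact: nice_coord.
  apply: nice_sum => a; apply: nice_sum => b; apply: niceM.
    by apply: niceM; [exact: niceZ|exact: nice_conj].
  by apply: niceN; apply: nice_conj; apply: niceZ; apply: niceM => //; exact: nice_conj.
pose w a : R := nm (ga a) ^+ 2.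
have w0 a : 0 <= w a by exact: sqr_ge0.
(* |S| is bounded termwise with nm_sqrD_le; the weights |V_a|^2 |V_b|^2 sum to 1 *)
pose G V : R[i] := (((3 / 2):R)%:C)%C * bil (fun a => ((w a)%:C)%C) j j V +
  (((2^-1):R)%:C)%C * bil (fun a => ((w a)%:C)%C) i i V.
have nG : nice G by apply: niceD; apply: niceZ; exact: nice_bil.
have SG V : V \is unitarymx -> `|S V| <= G V.
  move=> uV; rewrite /G !bil_real_diag//.
  have c1 k : \sum_a nm (V a (t k)) ^+ 2 = 1.
    apply: complexI; rewrite rmorph_sum /= rmorph1.
    have := col_orth k k uV; rewrite eqxx mulr1n => <-.
    by apply: eq_bigr => a _; rewrite nm_sqr mulrC.
  rewrite nmE -!rmorphM -rmorphD /= lecR.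
  apply: (le_trans (nm_sum _ _ _)).
  pose x a := nm (V a (t j)) ^+ 2; pose y b := nm (V b (t i)) ^+ 2.
  have Sx : \sum_a x a = 1 by exact: c1.
  have Sy : \sum_b y b = 1 by exact: c1.
  have -> : 3 / 2 * (\sum_a w a * x a) + 2^-1 * (\sum_b w b * y b) =
     \sum_a \sum_b (3 / 2 * w a + 2^-1 * w b) * (x a * y b).
    transitivity (\sum_a \sum_b (3 / 2 * w a * x a * y b + 2^-1 * w b * y b * x a)); last first.
      by apply: eq_bigr => a _; apply: eq_bigr => b _; ring.
    under [in RHS]eq_bigr do rewrite big_split /=.
    rewrite [in RHS]big_split /=; congr (_ + _).
      rewrite mulr_sumr; apply: eq_bigr => a _; rewrite -mulr_sumr Sy; ring.
    rewrite [in RHS]exchange_big /= mulr_sumr; apply: eq_bigr => a _.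
    by rewrite -mulr_sumr Sx; ring.
  apply: ler_sum => a _; apply: (le_trans (nm_sum _ _ _)); apply: ler_sum => b _.
  rewrite !nmM !nmN /dbil !nmJ !nmM !nmJ.
  have -> : nm (ga a) * nm (V a (t j)) * nm (V b (t i)) *
    (nm (ga b - ga a) * (nm (V b (t i)) * nm (V a (t j)))) =
    (nm (ga a) * nm (ga b - ga a)) * (x a * y b) by rewrite /x /y; ring.
  apply: ler_wpM2r; first by rewrite mulr_ge0// sqr_ge0.
  exact: nm_sqrD_le.
have := haar_norm Hmu nS nG SG.
rewrite -eS {1}/G cexpectationD ?cexpectationZ; [|apply: nice_cintegrable => //..];
  [|exact: nice_bil|exact: nice_bil|apply: niceZ; exact: nice_bil|apply: niceZ; exact: nice_bil].
rewrite !haar_bil !eqxx !mul1r.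
have -> : ntr (fun a => ((w a)%:C)%C) = ((m2 ga)%:C)%C.
  by rewrite /ntr /m2 rmorphM /= rmorph_sum /= fmorphV /= rmorph_nat.
rewrite [X in _ <= X](_ : _ = ((4 * m2 ga)%:C)%C); last first.
  by rewrite mulr2n; apply/eqP; rewrite eq_complex /=; apply/andP; split; apply/eqP; field.
rewrite nmE lecR nmM nm_real.
rewrite [X in X * _](_ : _ = n%:R); last first.
  by apply: complexI; rewrite -nmE normr_nat rmorph_nat.
have I0 : 0 <= \int[mu]_V nm (bil ga i j V) ^+ 2.
  by apply: Rintegral_ge0 => V _; exact: sqr_ge0.
rewrite ger0_norm// => h.
by rewrite mulrAC ler_pdivlMr ?ltr0n// mulrC.
Qed.

Lemma bil_sub be ga i j V : bil (fun a => be a - ga a) i j V = bil be i j V - bil ga i j V.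
Proof. by rewrite /bil -sumrB; apply: eq_bigr => a _; ring. Qed.

Lemma bil_cst c i j V : V \is unitarymx -> bil (fun=> c) i j V = (i == j)%:R * c.
Proof.
move=> uV; rewrite -(col_orth i j uV) mulr_suml; apply: eq_bigr => a _; ring.
Qed.

Lemma sum_sub_ntr be : \sum_a (be a - ntr be) = 0.
Proof.
rewrite sumrB sumr_const card_ord -mulr_natl /ntr mulrA mulfV ?n_neq0// mul1r.
exact: subrr.
Qed.

Lemma m2_sub_ntr be : m2 (fun a => be a - ntr be) <= m2 be.
Proof.
rewrite ler_wpM2l ?invr_ge0//.
have e : ((\sum_a nm (be a - ntr be) ^+ 2)%:C)%C =
   ((\sum_a nm (be a) ^+ 2)%:C)%C - ((n%:R * nm (ntr be) ^+ 2)%:C)%C.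
  rewrite !rmorph_sum rmorphM /= rmorph_nat nm_sqr.
  under eq_bigr do rewrite nm_sqr rmorphB /= mulrBl mulrBr mulrBr.
  rewrite !sumrB; under [in RHS]eq_bigr do rewrite nm_sqr.
  rewrite -mulr_suml -mulr_sumr -mulr_sumr sumr_const card_ord -mulr_natl.
  have eS : \sum_a be a = n%:R * ntr be by rewrite /ntr mulrA mulfV ?n_neq0// mul1r.
  have eSc : \sum_a (be a)^* = n%:R * (ntr be)^*.
    by rewrite -rmorph_sum /= eS rmorphM /= rmorph_nat.
  by rewrite eSc eS -mulr_natl; ring.
move: e; rewrite -rmorphB /= => /complexI ->.
by rewrite gerBl mulr_ge0// sqr_ge0.
Qed.

(** Subtracting the mean from the diagonal reduces to the traceless case. *)
Lemma haar_bil_var be i j :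
  \int[mu]_V nm (bil be i j V - (i == j)%:R * ntr be) ^+ 2 <= 4 / n%:R * m2 be.
Proof.
have := haar_bil_var0 i j (sum_sub_ntr be).
have -> : \int[mu]_V nm (bil (fun a => be a - ntr be) i j V) ^+ 2 =
  \int[mu]_V nm (bil be i j V - (i == j)%:R * ntr be) ^+ 2.
  have n1 : nice (fun V => ((nm (bil (fun a => be a - ntr be) i j V) ^+ 2)%:C)%C).
    by apply: nice_nm2; exact: nice_bil.
  have n2 : nice (fun V => ((nm (bil be i j V - (i == j)%:R * ntr be) ^+ 2)%:C)%C).
    by apply: nice_nm2; apply: niceB; [exact: nice_bil|exact: nice_cst].
  apply: complexI; rewrite -!cexpectation_real//; apply: haar_eq => // V uV.
  by rewrite bil_sub bil_cst.
move=> h; apply: (le_trans h); rewrite ler_wpM2l ?divr_ge0//; exact: m2_sub_ntr.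
Qed.

Section quadratic_form.
Variable h : 'I_p -> 'I_p -> 'I_n -> R[i].
Hypothesis h_conj : forall i j a, (h i j a)^* = h j i a.
Hypothesis h_tr : forall i j, \sum_a h i j a = 0.

Definition sn : R := Num.sqrt n%:R.

Lemma sn_gt0 : 0 < sn. Proof. by rewrite sqrtr_gt0 ltr0n. Qed.
Lemma sn_sqr : sn ^+ 2 = n%:R. Proof. by rewrite sqr_sqrtr// ler0n. Qed.

Definition quad (V : M) : R[i] := (sn%:C)%C * \sum_i \sum_j bil (h i j) i j V.

Lemma quad_real V : quad V = ((complex.Re (quad V))%:C)%C.
Proof.
rewrite RRe_real//; apply/CrealP; rewrite /quad rmorphM /= [(sn%:C)%C^*]conjc_real.
congr (_ * _); rewrite rmorph_sum exchange_big /=; apply: eq_bigr => j _.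
rewrite rmorph_sum /=; apply: eq_bigr => i _.
rewrite rmorph_sum /=; apply: eq_bigr => a _.
by rewrite !rmorphM /= conjCK h_conj; ring.
Qed.

Lemma has_deriv_quad : has_deriv quad
  (fun a b V => (sn%:C)%C * \sum_i \sum_j dbil (h i j) i j a b V).
Proof.
apply: has_derivZ; apply: has_deriv_sum => i; apply: has_deriv_sum => j.
exact: has_deriv_bil.
Qed.

Definition equad (s : R) (V : M) := expi (s * complex.Re (quad V)).

Lemma has_deriv_equad s : has_deriv (equad s)
  (fun a b V => 'i * equad s V * ((s%:C)%C * ((sn%:C)%C * \sum_i \sum_j dbil (h i j) i j a b V))).
Proof.
have r V : (s%:C)%C * quad V = ((complex.Re ((s%:C)%C * quad V))%:C)%C.
  by rewrite ReM_real rmorphM /= -quad_real.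
have := has_deriv_expi r (has_derivZ (s%:C)%C has_deriv_quad).
rewrite (_ : (fun V => expi (complex.Re ((s%:C)%C * quad V))) = equad s); last first.
  by apply/funext => V; rewrite ReM_real.
rewrite (_ : (fun a b V => _) = (fun a b V => 'i * equad s V * ((s%:C)%C * ((sn%:C)%C * \sum_i \sum_j dbil (h i j) i j a b V))))//.
by apply/funext => a; apply/funext => b; apply/funext => V; rewrite ReM_real.
Qed.

(** What the double sum of [haar_ibp] becomes for the derivative of [quad], once the
    orthonormality of the columns is used. *)
Definition wick be i j (V : M) : R[i] := \sum_k \sum_l
  (bil (fun a => be a * h k l a) k j V * (i == l)%:R - bil be k j V * bil (h k l) i l V).

Lemma nice_equad s : nice (equad s).
Proof. by have [] := has_deriv_equad s. Qed.

Lemma nice_wick be i j : nice (wick be i j).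
Proof.
apply: nice_sum => k; apply: nice_sum => l; apply: niceB.
  by apply: niceM; [exact: nice_bil|exact: nice_cst].
by apply: niceM; exact: nice_bil.
Qed.

(** [haar_ibp] for the exponential of the quadratic form. *)
Lemma haar_wick be i j s : \sum_a be a = 0 ->
  (sn%:C)%C * E (fun V => bil be i j V * equad s V) =
  'i * (s%:C)%C * E (fun V => equad s V * wick be i j V).
Proof.
move=> be0; have := haar_ibp be i j (has_deriv_equad s).
rewrite be0 mulr0 mul0r add0r => e.
have sn0 : (sn%:C)%C != 0 :> R[i].
  by apply/eqP => /(congr1 (@complex.Re R))/= /eqP; rewrite gt_eqF// sn_gt0.
apply: (mulfI sn0); rewrite mulrA -expr2 -rmorphXn /= sn_sqr rmorph_nat e.
have nw : nice (fun V => equad s V * wick be i j V).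
  by apply: niceM; [exact: nice_equad|exact: nice_wick].
rewrite mulrA -cexpectationZ; last exact: nice_cintegrable.
have [_ nD _] := has_deriv_equad s.
apply: haar_eq => //.
- apply: nice_sum => a; apply: nice_sum => b; apply: niceM; last exact: nD.
  by apply: niceM; [apply: niceZ|apply: nice_conj]; exact: nice_coord.
- exact: niceZ.
move=> V uV.
have -> : wick be i j V = \sum_k \sum_l \sum_a \sum_b
   be a * V a (t j) * (V b (t i))^* * dbil (h k l) k l a b V.
  apply: eq_bigr => k _; apply: eq_bigr => l _.
  rewrite -(col_orth i l uV) /bil !mulr_suml -sumrB; apply: eq_bigr => a _.
  rewrite !mulr_sumr -sumrB; apply: eq_bigr => b _; rewrite /dbil; ring.
have -> : \sum_k \sum_l \sum_a \sum_b
   be a * V a (t j) * (V b (t i))^* * dbil (h k l) k l a b V =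
   \sum_a \sum_b be a * V a (t j) * (V b (t i))^* * \sum_k \sum_l dbil (h k l) k l a b V.
  under eq_bigr do rewrite exchange_big /=.
  rewrite exchange_big /=; apply: eq_bigr => a _.
  under eq_bigr do rewrite exchange_big /=.
  rewrite exchange_big /=; apply: eq_bigr => b _.
  rewrite mulr_sumr; apply: eq_bigr => k _; rewrite mulr_sumr; exact: eq_bigr.
rewrite !mulr_sumr; apply: eq_bigr => a _; rewrite !mulr_sumr; apply: eq_bigr => b _.
ring.
Qed.

(** The mean of [sum_ij wick (h i j) i j], up to the products of two traceless
    forms: the asymptotic variance of [quad]. *)
Definition qvar : R[i] := \sum_i \sum_j \sum_k \sum_l
  (k == j)%:R * (i == l)%:R * ntr (fun a => h i j a * h k l a).

Definition qerr : R := sn^-1 * \sum_i \sum_j \sum_k \sum_l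
  (1 + 4 * m2 (fun a => h i j a * h k l a) + 4 * m2 (h i j) + 4 * m2 (h k l)).

Lemma m2_ge0 be : 0 <= m2 be.
Proof. by rewrite mulr_ge0 ?invr_ge0// sumr_ge0// => a _; exact: sqr_ge0. Qed.

(** In [E[quad e^{is quad}]], the mean part of [wick] gives [qvar].  What remains
    is either a centered form, of order [n^{-1/2}] in mean square, or a product of
    two traceless forms, of order [n^{-1}]. *)
Lemma haar_quad_char s :
  nm (E (fun V => quad V * equad s V) - 'i * (s%:C)%C * qvar * E (equad s)) <= `|s| * qerr.
Proof.
have nb be i j : nice (bil be i j) by exact: nice_bil.
have ne := nice_equad s.
have ntail i j : nice (fun V => equad s V * wick (h i j) i j V).
  by apply: niceM => //; exact: nice_wick.
have -> : E (fun V => quad V * equad s V) =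
   'i * (s%:C)%C * \sum_i \sum_j E (fun V => equad s V * wick (h i j) i j V).
  transitivity (E (fun V => \sum_i \sum_j (sn%:C)%C * (bil (h i j) i j V * equad s V))).
    congr cexpectation; apply/funext => V; rewrite /quad -mulrA mulr_suml mulr_sumr.
    by apply: eq_bigr => i _; rewrite mulr_suml mulr_sumr.
  have n3 i j : nice (fun V => (sn%:C)%C * (bil (h i j) i j V * equad s V)).
    by apply: niceZ; apply: niceM.
  rewrite cexpectation_sum; last first.
    by move=> i _; apply: nice_cintegrable => //; apply: nice_sum => j.
  rewrite mulr_sumr; apply: eq_bigr => i _; rewrite cexpectation_sum; last first.
    by move=> j _; apply: nice_cintegrable.
  rewrite mulr_sumr; apply: eq_bigr => j _.
  rewrite cexpectationZ ?haar_wick//.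
  by apply: nice_cintegrable => //; apply: niceM.
rewrite -(mulrA ('i * _) qvar) -mulrBr nmM (nmM 'i) nm_i mul1r nm_real; apply: ler_wpM2l => //.
pose Fi i j k l V := equad s V * ((bil (fun a => h i j a * h k l a) k j V - (k == j)%:R *
    ntr (fun a => h i j a * h k l a)) * (i == l)%:R - bil (h i j) k j V * bil (h k l) i l V).
have nFi i j k l : nice (Fi i j k l).
  apply: niceM => //; apply: niceB; last exact: niceM.
  by apply: niceM; [apply: niceB => //; exact: nice_cst|exact: nice_cst].
have -> : \sum_i \sum_j E (fun V => equad s V * wick (h i j) i j V) - qvar * E (equad s) =
  \sum_i \sum_j \sum_k \sum_l E (Fi i j k l).
  rewrite /qvar mulr_suml -sumrB; apply: eq_bigr => i _.
  rewrite mulr_suml -sumrB; apply: eq_bigr => j _.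
  rewrite mulr_suml.
  have n4 k l : nice (fun V => equad s V * (bil (fun a => h i j a * h k l a) k j V * (i == l)%:R - bil (h i j) k j V * bil (h k l) i l V)).
    apply: niceM => //; apply: niceB; last exact: niceM.
    by apply: niceM => //; exact: nice_cst.
  rewrite (_ : (fun V => _) = fun V => \sum_k \sum_l equad s V *
     (bil (fun a => h i j a * h k l a) k j V * (i == l)%:R - bil (h i j) k j V * bil (h k l) i l V)); last first.
    apply/funext => V; rewrite /wick mulr_sumr; apply: eq_bigr => k _; exact: mulr_sumr.
  rewrite cexpectation_sum; last first.
    by move=> k _; apply: nice_cintegrable => //; apply: nice_sum => l.
  rewrite -sumrB; apply: eq_bigr => k _; rewrite cexpectation_sum; last first.
    by move=> l _; apply: nice_cintegrable.
  rewrite mulr_suml -sumrB; apply: eq_bigr => l _.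
  rewrite -cexpectationZ; last exact: nice_cintegrable.
  rewrite -haarB//; last exact: niceZ.
  by congr cexpectation; apply/funext => V; rewrite /Fi; ring.
rewrite /qerr mulr_sumr; apply: (le_trans (nm_sum _ _ _)); apply: ler_sum => i _.
rewrite mulr_sumr; apply: (le_trans (nm_sum _ _ _)); apply: ler_sum => j _.
rewrite mulr_sumr; apply: (le_trans (nm_sum _ _ _)); apply: ler_sum => k _.
rewrite mulr_sumr; apply: (le_trans (nm_sum _ _ _)); apply: ler_sum => l _.
pose Z1 V := bil (fun a => h i j a * h k l a) k j V - (k == j)%:R * ntr (fun a => h i j a * h k l a).
(* |Z1| <= (1 / sn + sn |Z1|^2) / 2 trades a first moment for a second one *)
pose G V : R[i] := ((2^-1 * sn^-1)%:C)%C + (((2^-1 * sn)%:C)%C * ((nm (Z1 V) ^+ 2)%:C)%C +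
   (((2^-1 : R)%:C)%C * ((nm (bil (h i j) k j V) ^+ 2)%:C)%C + ((2^-1:R)%:C)%C * ((nm (bil (h k l) i l V) ^+ 2)%:C)%C)).
have nZ1 : nice Z1 by apply: niceB => //; exact: nice_cst.
have m1 : nice (fun V => ((nm (Z1 V) ^+ 2)%:C)%C) by exact: nice_nm2.
have m2' : nice (fun V => ((nm (bil (h i j) k j V) ^+ 2)%:C)%C) by exact: nice_nm2.
have m3 : nice (fun V => ((nm (bil (h k l) i l V) ^+ 2)%:C)%C) by exact: nice_nm2.
have nG : nice G.
  apply: niceD; first exact: nice_cst.
  by apply: niceD; [exact: niceZ|apply: niceD; exact: niceZ].
have FG V : V \is unitarymx -> `|Fi i j k l V| <= G V.
  move=> _; rewrite nmE /G -!rmorphM -!rmorphD /= lecR /Fi nmM nm_expi mul1r.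
  apply: (le_trans (nmB _ _)); rewrite -/(Z1 V) !nmM.
  have a1 : nm (Z1 V) * nm ((i == l)%:R : R[i]) <= 2^-1 * sn^-1 + 2^-1 * sn * nm (Z1 V) ^+ 2.
    apply: (@le_trans _ _ (nm (Z1 V))).
      rewrite -[leRHS]mulr1 ler_wpM2l ?nm_ge0//.
      by case: eqP => _; rewrite -?(rmorph0 (real_complex R)) -?(rmorph1 (real_complex R)) nm_real ?normr1 ?normr0.
    have s0 := sn_gt0; have s1 : sn * sn^-1 = 1 by rewrite mulfV// gt_eqF.
    have si0 : 0 < sn^-1 by rewrite invr_gt0.
    have := sqr_ge0 (sn * nm (Z1 V) - 1); rewrite sqrrB expr1n mulr1 => q.
    rewrite -(ler_pM2l s0).
    have -> : sn * (2^-1 * sn^-1 + 2^-1 * sn * nm (Z1 V) ^+ 2) =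
      2^-1 * (sn * sn^-1) + 2^-1 * (sn * nm (Z1 V)) ^+ 2 by ring.
    rewrite s1; move: q; rewrite -mulr_natl; lra.
  have a2 : nm (bil (h i j) k j V) * nm (bil (h k l) i l V) <=
     2^-1 * nm (bil (h i j) k j V) ^+ 2 + 2^-1 * nm (bil (h k l) i l V) ^+ 2.
    have := sqr_ge0 (nm (bil (h i j) k j V) - nm (bil (h k l) i l V)); nra.
  by rewrite (addrA (2^-1 * sn^-1)); apply: lerD.
have := haar_norm Hmu (nFi i j k l) nG FG.
have EG : E G = ((2^-1 * sn^-1 + (2^-1 * sn * \int[mu]_V nm (Z1 V) ^+ 2 +
   (2^-1 * \int[mu]_V nm (bil (h i j) k j V) ^+ 2 + 2^-1 * \int[mu]_V nm (bil (h k l) i l V) ^+ 2)))%:C)%C.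
  rewrite /G cexpectationD; [|exact: cintegrable_cst|apply: nice_cintegrable => //]; last first.
    by apply: niceD; [exact: niceZ|apply: niceD; exact: niceZ].
  rewrite cexpectationD; [|apply: nice_cintegrable => //; exact: niceZ|]; last first.
    by apply: nice_cintegrable => //; apply: niceD; exact: niceZ.
  rewrite cexpectationD; [|apply: nice_cintegrable => //; exact: niceZ..].
  rewrite !cexpectationZ; [|exact: nice_cintegrable..].
  rewrite cexpectation_cst !cexpectation_real//.
  by rewrite -!rmorphM -!rmorphD.
rewrite EG nmE -rmorphMn /= lecR => hE; apply: (le_trans hE).
have v1 := haar_bil_var (fun a => h i j a * h k l a) k j.
have v2 := haar_bil_var0 k j (h_tr i j).
have v3 := haar_bil_var0 i l (h_tr k l).
rewrite -[X in \int[mu]_V X V]/(fun V => nm (Z1 V) ^+ 2) in v1.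
have s0 := sn_gt0.
have e1 : 4 / n%:R = 4 * sn^-1 ^+ 2 :> R by rewrite -sn_sqr exprVn.
have i1 : sn^-1 <= 1.
  by rewrite invf_le1// -[leLHS]sqrtr1 ler_wsqrtr// ler1n.
have si0 : 0 < sn^-1 by rewrite invr_gt0.
have g1 := m2_ge0 (fun a => h i j a * h k l a).
have g2 := m2_ge0 (h i j).
have g3 := m2_ge0 (h k l).
rewrite e1 in v1 v2 v3.
have w1 : sn * (\int[mu]_V nm (Z1 V) ^+ 2) <= 4 * sn^-1 * m2 (fun a => h i j a * h k l a).
  have -> : 4 * sn^-1 * m2 (fun a => h i j a * h k l a) =
     sn * (4 * sn^-1 ^+ 2 * m2 (fun a => h i j a * h k l a)).
    by field; rewrite gt_eqF.
  by rewrite ler_pM2l.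
have w2 x : 0 <= x -> 4 * sn^-1 ^+ 2 * x <= 4 * sn^-1 * x.
  by move=> x0; rewrite ler_wpM2r// ler_wpM2l// expr2 ler_piMr// ltW.
have := le_trans v2 (w2 _ g2); have := le_trans v3 (w2 _ g3).
move: w1; rewrite -mulr_natr.
set I1 := \int[mu]_V _; set I2 := \int[mu]_V _; set I3 := \int[mu]_V _.
lra.
Qed.

End quadratic_form.
End columns.

(** * An approximate differential equation for characteristic functions *)

Section quadratic_derivative.
Variable R : realType.

(** Differentiability from a quadratic remainder, which is what the Taylor
    estimates of the sine and cosine give under an integral. *)
Lemma is_derive_quadratic (f : R -> R) (s d K : R) :
  (forall h, `|f (s + h) - f s - h * d| <= K * h ^+ 2) -> is_derive s 1 f d.
Proof.
move=> hK.
have K0 : 0 <= K.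
  by have := hK 1; rewrite expr1n mulr1; apply: le_trans.
have c : h^-1 *: ((f \o shift s) (h *: (1:R)) - f s) @[h --> 0^'] --> d.
  apply/cvgrPdist_le => e e0.
  near=> h.
  have h0 : h != 0 by near: h; exact: nbhs_dnbhs_neq.
  rewrite /= [h *: 1]mulr1 [_ *: _]/(_ * _) (addrC h).
  have -> : d - h^-1 * (f (s + h) - f s) = - (h^-1 * (f (s + h) - f s - h * d)).
    by field.
  rewrite normrN normrM normfV ler_pdivrMl ?normr_gt0//.
  apply: (le_trans (hK h)); rewrite -real_normK ?num_real// expr2 mulrCA ler_pM2l ?normr_gt0//.
  have : `|h| <= e / (K + 1).
    near: h; apply: nbhs_dnbhs; apply/nbhs_ballP; exists (e / (K + 1)) => /=.
      by rewrite divr_gt0// ltr_wpDl.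
    by move=> h; rewrite /ball/= sub0r normrN => /ltW.
  rewrite ler_pdivlMr ?ltr_wpDl//.
  have := normr_ge0 h; nra.
apply: DeriveDef; first by apply/cvg_ex; exists d.
exact: cvg_lim.
Unshelve. all: by end_near. Qed.

(** The function [exp(s^2 v / 2) f(s)] has derivative at most
    [exp(v / 2) eps] on [[0, 1]]; the mean value theorem concludes. *)
Lemma ode_bound (f f' : R -> R) (v eps : R) : 0 <= v ->
  (forall s : R, is_derive s (1:R) f (f' s)) ->
  (forall s, 0 <= s <= 1 -> `|f' s + s * v * f s| <= s * eps) ->
  `|f 1 - expR (- v / 2) * f 0| <= eps.
Proof.
move=> v0 df hf.
have e0 : 0 <= eps.
  have := hf 1; rewrite lexx ler01 !mul1r => /(_ isT) h; exact: (le_trans (normr_ge0 _) h).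
pose g s := expR (s ^+ 2 * v / 2) * f s.
pose g' s := expR (s ^+ 2 * v / 2) * (f' s + s * v * f s).
have dg (s : R) : is_derive s 1 g (g' s).
  have h1 : is_derive s (1:R) (fun s : R => s ^+ 2 * v / 2) (s * v).
    apply: (is_derive_quadratic (K := v / 2)) => h.
    rewrite [X in `|X|](_ : _ = v / 2 * h ^+ 2); last by field.
    by rewrite ger0_norm// mulr_ge0 ?divr_ge0// sqr_ge0.
  have h2 := @is_derive1_comp R expR (fun s : R => s ^+ 2 * v / 2) s _ _ (is_derive_expR _) h1.
  have h3 := is_deriveM h2 (df s).
  apply: (is_derive_eq h3).
  rewrite /= -![_ *: _]/(_ * _) /g'; ring.
have cg : {within `[0, 1], continuous g}.
  by apply: derivable_within_continuous => x _; exact: (@ex_derive _ _ _ _ _ _ _ (dg x)).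
have [c c01 e] := @MVT R g g' 0 1 ltr01 (fun x _ => dg x) cg.
move: c01; rewrite in_itv/= => /andP[c0 c1].
have b : `|g 1 - g 0| <= expR (v / 2) * eps.
  rewrite e subr0 mulr1 normrM ger0_norm ?expR_ge0//.
  apply: ler_pM; rewrite ?expR_ge0//.
    by rewrite ler_expR ler_pM2r// ler_piMl// exprn_ile1// ltW.
  by apply: (le_trans (hf c _)); rewrite ?(ltW c0) ?(ltW c1)// ler_piMl// ltW.
have -> : f 1 - expR (- v / 2) * f 0 = expR (- v / 2) * (g 1 - g 0).
  rewrite /g expr1n mul1r expr0n mul0r mul0r expR0 mul1r mulrBr mulrA -expRD.
  by rewrite mulNr addNr expR0 mul1r.
rewrite normrM ger0_norm ?expR_ge0//.
apply: (@le_trans _ _ (expR (- v / 2) * (expR (v / 2) * eps))).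
  by rewrite ler_wpM2l// expR_ge0.
by rewrite mulrA -expRD mulNr addNr expR0 mul1r.
Qed.

End quadratic_derivative.

Section char.
Context d (T : measurableType d) (R : realType) (P : probability T R).
Implicit Types X Y f g : T -> R.
Local Notation intg f := (P.-integrable setT (EFin \o f)).

Lemma Rintegral_cst1 (r : R) : \int[P]_x r = r.
Proof.
transitivity (r * fine (P setT)); first exact: (Rintegral_cst P measurableT r).
by rewrite (probability_setT P) mulr1.
Qed.

Lemma intg_cst (r : R) : intg (fun=> r).
Proof. exact: finite_measure_integrable_cst. Qed.

Lemma intg_le f g : measurable_fun setT f -> (forall x, `|f x| <= g x) -> intg g -> intg f.
Proof.
move=> mf h; apply: le_integrable => //; first exact/measurable_EFinP.
by move=> x _ /=; rewrite lee_fin (le_trans (h x))// ler_norm.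
Qed.

Lemma intg_bounded f K : measurable_fun setT f -> (forall x, `|f x| <= K) -> intg f.
Proof. by move=> mf h; apply: (intg_le mf h); exact: intg_cst. Qed.

Lemma intgD f g : intg f -> intg g -> intg (fun x => f x + g x).
Proof. by move=> h1 h2; have := integrableD measurableT h1 h2. Qed.

Lemma intgB f g : intg f -> intg g -> intg (fun x => f x - g x).
Proof. by move=> h1 h2; have := integrableB measurableT h1 h2. Qed.

Lemma intgZ c f : intg f -> intg (fun x => c * f x).
Proof. by move=> h1; have := integrableZl measurableT c h1. Qed.

Lemma intg_sum (I : Type) (r : seq I) (F : I -> T -> R) :
  (forall i, intg (F i)) -> intg (fun x => \sum_(i <- r) F i x).
Proof.
move=> h; elim: r => [|i r IH].
  by under eq_fun do rewrite big_nil; exact: intg_cst.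
by under eq_fun do rewrite big_cons; apply: intgD.
Qed.

Lemma Rintegral_sum (I : Type) (r : seq I) (F : I -> T -> R) :
  (forall i, intg (F i)) -> \int[P]_x (\sum_(i <- r) F i x) = \sum_(i <- r) \int[P]_x F i x.
Proof.
move=> h; elim: r => [|i r IH].
  by under eq_Rintegral do rewrite big_nil; rewrite big_nil Rintegral_cst1.
under eq_Rintegral do rewrite big_cons.
by rewrite big_cons -IH RintegralD//; exact: intg_sum.
Qed.

Variable X : T -> R.
Hypothesis mX : measurable_fun setT X.
Hypothesis X2 : intg (fun x => X x ^+ 2).

Lemma intg_X : intg X.
Proof.
apply: (intg_le mX (g := fun x => 1 + X x ^+ 2)); last by apply: intgD => //; exact: intg_cst.
move=> x; rewrite -(real_normK (num_real (X x))).
by have := sqr_ge0 (`|X x| - 1); have := normr_ge0 (X x); nra.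
Qed.

Lemma measurable_cosX s : measurable_fun setT (fun x => cos (s * X x)).
Proof.
have mc : measurable_fun setT (@cos R) := continuous_measurable_fun (@continuous_cos R).
apply: (measurableT_comp mc).
exact: measurable_funM.
Qed.

Lemma measurable_sinX s : measurable_fun setT (fun x => sin (s * X x)).
Proof.
have mc : measurable_fun setT (@sin R) := continuous_measurable_fun (@continuous_sin R).
apply: (measurableT_comp mc).
exact: measurable_funM.
Qed.

Lemma intg_cosX s : intg (fun x => cos (s * X x)).
Proof. by apply: (intg_bounded (measurable_cosX s) (K := 1)) => x; exact: cos_max. Qed.

Lemma intg_sinX s : intg (fun x => sin (s * X x)).
Proof. by apply: (intg_bounded (measurable_sinX s) (K := 1)) => x; exact: sin_max. Qed.

Lemma intg_XcosX s : intg (fun x => X x * cos (s * X x)).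
Proof.
apply: (intg_le _ (g := fun x => `|X x|)); last exact: (integrable_norm intg_X).
- by apply: measurable_funM => //; exact: measurable_cosX.
- by move=> x; rewrite normrM ler_piMr// cos_max.
Qed.

Lemma intg_XsinX s : intg (fun x => X x * sin (s * X x)).
Proof.
apply: (intg_le _ (g := fun x => `|X x|)); last exact: (integrable_norm intg_X).
- by apply: measurable_funM => //; exact: measurable_sinX.
- by move=> x; rewrite normrM ler_piMr// sin_max.
Qed.

Lemma Rintegral_norm_le f g : intg f -> intg g -> (forall x, `|f x| <= g x) ->
  `|\int[P]_x f x| <= \int[P]_x g x.
Proof.
move=> hf hg h; apply: (le_trans (le_normr_Rintegral _ hf)) => //.
by apply: le_Rintegral => //; exact: (integrable_norm hf).
Qed.

Lemma is_derive_char_cos s :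
  is_derive s (1:R) (fun s => \int[P]_x cos (s * X x)) (- \int[P]_x (X x * sin (s * X x))).
Proof.
apply: (is_derive_quadratic (K := 2 * \int[P]_x (X x ^+ 2))) => h.
rewrite mulrN opprK.
rewrite -RintegralZl//; last exact: intg_XsinX.
rewrite -RintegralB//; [|exact: intg_cosX..].
rewrite -RintegralD//; [|by apply: intgB; exact: intg_cosX|by apply: intgZ; exact: intg_XsinX].
rewrite mulrAC -RintegralZl//.
apply: Rintegral_norm_le.
- apply: intgD; first by apply: intgB; exact: intg_cosX.
  by apply: intgZ; exact: intg_XsinX.
- exact: intgZ.
move=> x; rewrite mulrDl mulrA.
apply: (le_trans (cos_taylor _ _)).
by rewrite exprMn -mulr_natl mulrA.
Qed.

Lemma is_derive_char_sin s :
  is_derive s (1:R) (fun s => \int[P]_x sin (s * X x)) (\int[P]_x (X x * cos (s * X x))).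
Proof.
apply: (is_derive_quadratic (K := 2 * \int[P]_x (X x ^+ 2))) => h.
rewrite -RintegralZl//; last exact: intg_XcosX.
rewrite -RintegralB//; [|exact: intg_sinX..].
rewrite -RintegralB//; [|by apply: intgB; exact: intg_sinX|by apply: intgZ; exact: intg_XcosX].
rewrite mulrAC -RintegralZl//.
apply: Rintegral_norm_le.
- apply: intgB; first by apply: intgB; exact: intg_sinX.
  by apply: intgZ; exact: intg_XcosX.
- exact: intgZ.
move=> x; rewrite mulrDl mulrA.
apply: (le_trans (sin_taylor _ _)).
by rewrite exprMn -mulr_natl mulrA.
Qed.

Lemma char_cos_bound v eps : 0 <= v ->
  (forall s, 0 <= s <= 1 ->
    `|\int[P]_x (X x * sin (s * X x)) - s * v * \int[P]_x cos (s * X x)| <= s * eps) ->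
  `|\int[P]_x cos (X x) - expR (- v / 2)| <= eps.
Proof.
move=> v0 h.
have := ode_bound v0 is_derive_char_cos (eps := eps).
have -> : \int[P]_x cos (1 * X x) = \int[P]_x cos (X x).
  by apply: eq_Rintegral => x _; rewrite mul1r.
have -> : \int[P]_x cos (0 * X x) = 1.
  by rewrite -[RHS]Rintegral_cst1; apply: eq_Rintegral => x _; rewrite mul0r cos0.
rewrite mulr1; apply => s hs; rewrite -normrN; apply: le_trans (h s hs).
by rewrite opprD opprK.
Qed.

Lemma char_sin_bound v eps : 0 <= v ->
  (forall s, 0 <= s <= 1 ->
    `|\int[P]_x (X x * cos (s * X x)) + s * v * \int[P]_x sin (s * X x)| <= s * eps) ->
  `|\int[P]_x sin (X x)| <= eps.
Proof.
move=> v0 h.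
have := ode_bound v0 is_derive_char_sin (eps := eps).
have -> : \int[P]_x sin (1 * X x) = \int[P]_x sin (X x).
  by apply: eq_Rintegral => x _; rewrite mul1r.
have -> : \int[P]_x sin (0 * X x) = 0.
  by rewrite -[RHS]Rintegral_cst1; apply: eq_Rintegral => x _; rewrite mul0r sin0.
by rewrite mulr0 subr0; apply.
Qed.

End char.

(** * Approximation by trigonometric polynomials *)

Section bernstein.
Variable R : realType.

(** The Bernstein weight [C(m, k) z^k (1 - z)^(m - k)], by Pascal recursion, so that its
    moments follow by induction on [m]. *)
Fixpoint bin_weight (z : R) (m k : nat) : R :=
  match m, k with
  | 0, 0 => 1
  | 0, _.+1 => 0
  | m'.+1, 0 => (1 - z) * bin_weight z m' 0
  | m'.+1, k'.+1 => z * bin_weight z m' k' + (1 - z) * bin_weight z m' k'.+1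
  end.

Lemma bin_weight_ge0 z m k : 0 <= z <= 1 -> 0 <= bin_weight z m k.
Proof.
move=> /andP[z0 z1]; elim: m k => [|m IH] [|k] //=.
  by rewrite mulr_ge0// subr_ge0.
by rewrite addr_ge0// mulr_ge0// subr_ge0.
Qed.

Lemma bin_weight_small z m k : (m < k)%N -> bin_weight z m k = 0.
Proof.
elim: m k => [|m IH] [|k]//= mk.
by rewrite !IH ?mulr0 ?addr0// ltnW.
Qed.

Lemma bin_sumS z m (f : nat -> R) :
  \sum_(k < m.+2) f k * bin_weight z m.+1 k =
  z * \sum_(k < m.+1) f k.+1 * bin_weight z m k +
  (1 - z) * \sum_(k < m.+1) f k * bin_weight z m k.
Proof.
rewrite big_ord_recl /=.
rewrite (eq_bigr (fun k : 'I_m.+1 => z * (f k.+1 * bin_weight z m k) +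
   (1 - z) * (f k.+1 * bin_weight z m k.+1))); last by move=> k _; rewrite /bump add1n; ring.
rewrite big_split /= -!mulr_sumr addrCA; congr (_ + _).
rewrite mulrCA -mulrDr; congr (_ * _).
transitivity (\sum_(k < m.+2) f k * bin_weight z m k).
  by rewrite [RHS]big_ord_recl; congr (_ + _).
by rewrite big_ord_recr /= bin_weight_small// mulr0 addr0.
Qed.

Lemma bin_sum1 z m : \sum_(k < m.+1) bin_weight z m k = 1.
Proof.
elim: m => [|m IH]; first by rewrite big_ord1.
have := bin_sumS z m (fun=> 1).
under eq_bigr do rewrite mul1r.
under [X in _ = z * X + _]eq_bigr do rewrite mul1r.
under [X in _ = _ + _ * X]eq_bigr do rewrite mul1r.
rewrite IH => ->; ring.
Qed.

Lemma bin_mean z m : \sum_(k < m.+1) k%:R * bin_weight z m k = m%:R * z.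
Proof.
elim: m => [|m IH]; first by rewrite big_ord1 !mul0r.
rewrite (bin_sumS z m (fun k => k%:R)) IH.
under eq_bigr do rewrite -natr1 mulrDl mul1r.
rewrite big_split /= IH bin_sum1 -natr1; ring.
Qed.

Lemma bin_var z m : \sum_(k < m.+1) (k%:R - m%:R * z) ^+ 2 * bin_weight z m k = m%:R * (z * (1 - z)).
Proof.
elim: m => [|m IH]; first by rewrite big_ord1 !mul0r subr0 expr0n /= mul0r.
rewrite (bin_sumS z m (fun k => (k%:R - m.+1%:R * z) ^+ 2)).
rewrite (eq_bigr (fun k : 'I_m.+1 => (k%:R - m%:R * z) ^+ 2 * bin_weight z m k +
   (2 * (1 - z)) * (k%:R * bin_weight z m k) + ((1 - z) ^+ 2 - 2 * (1 - z) * m%:R * z) * bin_weight z m k)); last first.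
  by move=> k _; rewrite -!natr1; ring.
rewrite [X in _ + _ * X](eq_bigr (fun k : 'I_m.+1 => (k%:R - m%:R * z) ^+ 2 * bin_weight z m k +
   (- 2 * z) * (k%:R * bin_weight z m k) + (z ^+ 2 + 2 * z * m%:R * z) * bin_weight z m k)); last first.
  by move=> k _; rewrite -!natr1; ring.
rewrite !big_split /= -!mulr_sumr IH bin_mean bin_sum1 -natr1; ring.
Qed.

Lemma bin_var_scaled z m : (0 < m)%N ->
  \sum_(k < m.+1) (k%:R / m%:R - z) ^+ 2 * bin_weight z m k = z * (1 - z) / m%:R.
Proof.
move=> m0; have mR : m%:R != 0 :> R by rewrite pnatr_eq0 -lt0n.
have := bin_var z m.
rewrite (eq_bigr (fun k : 'I_m.+1 => m%:R ^+ 2 * ((k%:R / m%:R - z) ^+ 2 * bin_weight z m k))); last first.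
  by move=> k _; field.
rewrite -mulr_sumr => h.
have m2 : m%:R ^+ 2 != 0 :> R by rewrite expf_neq0.
by apply: (mulfI m2); rewrite h; field.
Qed.

Section multi.
Variables (J : finType) (z : J -> R) (m : nat).
Hypothesis z01 : forall j, 0 <= z j <= 1.

(** The weight of a node of the grid of step [1 / m] on the cube: the law of
    independent binomial variables divided by [m], of means [z j]. *)
Definition mweight (u : {ffun J -> 'I_m.+1}) : R := \prod_j bin_weight (z j) m (u j).

Lemma mweight_ge0 u : 0 <= mweight u.
Proof. by apply: prodr_ge0 => j _; exact: bin_weight_ge0. Qed.

Lemma mweight_sum : \sum_u mweight u = 1.
Proof.
rewrite /mweight -(bigA_distr_bigA (fun j (k : 'I_m.+1) => bin_weight (z j) m k)) /=.
by rewrite big1// => j _; exact: bin_sum1.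
Qed.

Lemma mweight_var j0 : (0 < m)%N ->
  \sum_(u : {ffun J -> 'I_m.+1}) ((u j0)%:R / m%:R - z j0) ^+ 2 * mweight u <= m%:R^-1.
Proof.
move=> m0.
pose F j (k : 'I_m.+1) := (if j == j0 then (k%:R / m%:R - z j0) ^+ 2 else 1) * bin_weight (z j) m k.
have -> : \sum_(u : {ffun J -> 'I_m.+1}) ((u j0)%:R / m%:R - z j0) ^+ 2 * mweight u =
    \sum_(u : {ffun J -> 'I_m.+1}) \prod_j F j (u j).
  apply: eq_bigr => u _; rewrite /F big_split /=; congr (_ * _).
  by rewrite -big_mkcond /= big_pred1_eq.
rewrite -(bigA_distr_bigA F) (bigD1 j0)//= [X in _ * X]big1 ?mulr1; last first.
  move=> j /negbTE jj0; rewrite /F jj0; under eq_bigr do rewrite mul1r; exact: bin_sum1.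
rewrite /F eqxx bin_var_scaled// ler_piMl ?invr_ge0//.
by have /andP[a b] := z01 j0; nra.
Qed.

End multi.
End bernstein.

Section trigonometric_polynomials.
Variables (R : realType) (I : finType).
Implicit Types (y a : I -> R[i]) (f g : (I -> R[i]) -> R).

(** All real linear forms on [C^I] are of this shape. *)
Definition pairing a y : R := complex.Re (\sum_k a k * y k).

(** Phases are allowed so that sines, products and constants need no separate
    constructor. *)
Inductive trigpoly : ((I -> R[i]) -> R) -> Prop :=
| trigpoly_cos c a b : trigpoly (fun y => c * cos (pairing a y + b))
| trigpoly_add f g : trigpoly f -> trigpoly g -> trigpoly (fun y => f y + g y).

Lemma pairingD a b y : pairing (fun k => a k + b k) y = pairing a y + pairing b y.
Proof.
by rewrite /pairing -raddfD -big_split; congr complex.Re; apply: eq_bigr => k _; rewrite mulrDl.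
Qed.

Lemma pairingN a y : pairing (fun k => - a k) y = - pairing a y.
Proof.
by rewrite /pairing -raddfN -sumrN; congr complex.Re; apply: eq_bigr => k _; rewrite mulNr.
Qed.

Lemma pairing0 y : pairing (fun=> 0) y = 0.
Proof. by rewrite /pairing big1// => k _; rewrite mul0r. Qed.

Lemma trigpoly_cst c : trigpoly (fun=> c).
Proof.
have := trigpoly_cos c (fun=> 0) 0.
by under eq_fun do rewrite pairing0 addr0 cos0 mulr1.
Qed.

(** [2 cos u cos v = cos (u + v) + cos (u - v)]. *)
Lemma trigpoly_mul f g : trigpoly f -> trigpoly g -> trigpoly (fun y => f y * g y).
Proof.
move=> hf; elim: hf g => [c a b|f1 f2 _ IH1 _ IH2] g hg; last first.
  under eq_fun do rewrite mulrDl.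
  by apply: trigpoly_add; [exact: IH1|exact: IH2].
elim: hg => [c' a' b'|g1 g2 _ IH1 _ IH2]; last first.
  by under eq_fun do rewrite mulrDr; apply: trigpoly_add.
have h1 := trigpoly_cos (c * c' / 2) (fun k => a k + a' k) (b + b').
have h2 := trigpoly_cos (c * c' / 2) (fun k => a k + - a' k) (b - b').
have := trigpoly_add h1 h2; congr trigpoly; apply/funext => y.
rewrite !pairingD pairingN.
have -> : pairing a y + pairing a' y + (b + b') = (pairing a y + b) + (pairing a' y + b') by ring.
have -> : pairing a y - pairing a' y + (b - b') = (pairing a y + b) - (pairing a' y + b') by ring.
by rewrite cosD cosB; field.
Qed.

Lemma trigpoly_scale c f : trigpoly f -> trigpoly (fun y => c * f y).
Proof. by move=> h; apply: trigpoly_mul => //; exact: trigpoly_cst. Qed.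

Lemma trigpoly_sum (K : Type) (r : seq K) (F : K -> (I -> R[i]) -> R) :
  (forall k, trigpoly (F k)) -> trigpoly (fun y => \sum_(k <- r) F k y).
Proof.
move=> h; elim: r => [|k r IH].
  by under eq_fun do rewrite big_nil; exact: trigpoly_cst.
by under eq_fun do rewrite big_cons; apply: trigpoly_add.
Qed.

Lemma trigpoly_prod (K : Type) (r : seq K) (F : K -> (I -> R[i]) -> R) :
  (forall k, trigpoly (F k)) -> trigpoly (fun y => \prod_(k <- r) F k y).
Proof.
move=> h; elim: r => [|k r IH].
  by under eq_fun do rewrite big_nil; exact: trigpoly_cst.
by under eq_fun do rewrite big_cons; apply: trigpoly_mul.
Qed.

Lemma trigpoly_bin_weight (z : (I -> R[i]) -> R) m k : trigpoly z ->
  trigpoly (fun y => bin_weight (z y) m k).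
Proof.
move=> hz; have hz1 : trigpoly (fun y => 1 - z y).
  under eq_fun do rewrite -mulN1r.
  by apply: trigpoly_add; [exact: trigpoly_cst|exact: trigpoly_scale].
elim: m k => [|m IH] [|k] /=; [exact: trigpoly_cst|exact: trigpoly_cst| |].
  exact: trigpoly_mul.
by apply: trigpoly_add; exact: trigpoly_mul.
Qed.

(** The real coordinates of [C^I], indexed by [I * bool]: [true] selects the imaginary
    part. *)
Definition rcoord (y : I -> R[i]) (j : I * bool) : R :=
  if j.2 then complex.Im (y j.1) else complex.Re (y j.1).

Lemma coord_pairing s (j : I * bool) : exists a, forall y, pairing a y = s * rcoord y j.
Proof.
exists (fun k => (k == j.1)%:R * ((s%:C)%C * (if j.2 then - 'i else 1))) => y.
rewrite /pairing (bigD1 j.1)//= big1 ?addr0; last by move=> k /negbTE ->; rewrite !mul0r.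
rewrite eqxx mul1r /rcoord -mulrA ReM_real; congr (_ * _).
case: j.2; last by rewrite mul1r.
by case: (y j.1) => u v; rewrite -complexiE /=; ring.
Qed.

Lemma trigpoly_sin s (j : I * bool) : trigpoly (fun y => sin (s * rcoord y j)).
Proof.
have [a ha] := coord_pairing s j.
have := trigpoly_cos 1 a (- (pi / 2)); congr trigpoly; apply/funext => y.
by rewrite mul1r ha cosBpihalf.
Qed.

Definition nsq y : R := \sum_k nm (y k) ^+ 2.

Lemma nm_sqrE (z : R[i]) : nm z ^+ 2 = complex.Re z ^+ 2 + complex.Im z ^+ 2.
Proof. by rewrite /nm normc_def /= sqr_sqrtr// addr_ge0// sqr_ge0. Qed.

Lemma coord_le_nsq y j : rcoord y j ^+ 2 <= nsq y.
Proof.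
rewrite /nsq (bigD1 j.1)//= nm_sqrE /rcoord.
have h : 0 <= \sum_(i | i != j.1) nm (y i) ^+ 2 by apply: sumr_ge0 => i _; exact: sqr_ge0.
have := sqr_ge0 (complex.Re (y j.1)); have := sqr_ge0 (complex.Im (y j.1)).
by case: j.2; lra.
Qed.

Lemma nsq_ge0 y : 0 <= nsq y.
Proof. by apply: sumr_ge0 => i _; exact: sqr_ge0. Qed.

End trigonometric_polynomials.

Section wave.
Variable R : realType.

(** A continuous function on the line that inverts [u |-> (1 + sin u) / 2] on
    [[-1/2, 1/2]]: the argument of the arcsine is clamped to the image of that interval. *)
Definition clampsin (w : R) : R := asin (Num.max (- sin (2^-1)) (Num.min (sin (2^-1)) (2 * w - 1))).

Lemma half_lt_pihalf : (2^-1 : R) < pi / 2.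
Proof. by apply: lt_le_trans (pihalf_ge1 R); rewrite invf_lt1// ltr1n. Qed.

Lemma sinhalf_gt0 : 0 < sin (2^-1 : R).
Proof. by apply: sin_gt0_pihalf; rewrite invr_gt0 ltr0n /= half_lt_pihalf. Qed.

Lemma sinhalf_lt1 : sin (2^-1 : R) < 1.
Proof.
have h := half_lt_pihalf; have := pihalf_ge1 R => p1.
have c0 : 0 < cos (2^-1 : R).
  by apply: cos_gt0_pihalf; rewrite h andbT; apply: (@lt_trans _ _ 0); rewrite ?invr_gt0// oppr_lt0; lra.
have := cos2Dsin2 (2^-1 : R); have := sinhalf_gt0; nra.
Qed.

Lemma clampsinK u : `|u| <= 2^-1 -> clampsin ((1 + sin u) / 2) = u.
Proof.
rewrite ler_norml => /andP[u1 u2].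
have p1 := pihalf_ge1 R.
have hi (v : R) : - 2^-1 <= v -> v <= 2^-1 -> v \in `[(- (pi / 2)), pi / 2].
  by move=> v1 v2; rewrite in_itv/=; lra.
have m1 : - 2^-1 <= 2^-1 :> R by lra.
have s1 : sin u <= sin (2^-1).
  move: u2; rewrite le_eqVlt => /orP[/eqP->//|u2].
  by apply: ltW; rewrite ltr_sin ?hi//; lra.
have s2 : - sin (2^-1) <= sin u.
  rewrite -sinN; move: u1; rewrite le_eqVlt => /orP[/eqP->//|u1].
  by apply: ltW; rewrite ltr_sin ?hi//; lra.
rewrite /clampsin.
have -> : 2 * ((1 + sin u) / 2) - 1 = sin u by field.
by rewrite min_r// max_r// sinK// hi.
Qed.

Lemma clampsin_continuous : continuous clampsin.
Proof.
move=> w; rewrite /clampsin.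
have cm : continuous (fun t : R => Num.max (- sin (2^-1)) (Num.min (sin (2^-1)) t)).
  move=> t.
  have e : (fun t : R => Num.max (- sin (2^-1)) (Num.min (sin (2^-1)) t)) =
    (fun t => (- sin (2^-1) + (sin (2^-1) + t - `|sin (2^-1) - t|) / 2 +
      `|(- sin (2^-1)) - (sin (2^-1) + t - `|sin (2^-1) - t|) / 2|) / 2 ).
    by apply/funext => x; rewrite maxr_absE minr_absE.
  rewrite e; clear e.
  have c1 : continuous (fun t : R => (sin (2^-1) + t - `|sin (2^-1) - t|) / 2).
    move=> x; apply: cvgM; last exact: cvg_cst.
    apply: cvgB; first by apply: cvgD; [exact: cvg_cst|exact: cvg_id].
    by apply: cvg_norm; apply: cvgB; [exact: cvg_cst|exact: cvg_id].
  apply: cvgM; last exact: cvg_cst.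
  apply: cvgD; first by apply: cvgD; [exact: cvg_cst|exact: c1].
  by apply: cvg_norm; apply: cvgB; [exact: cvg_cst|exact: c1].
apply: (@continuous_comp _ _ _ (fun w : R => Num.max (- sin (2^-1)) (Num.min (sin (2^-1)) (2 * w - 1))) (@asin R)).
  apply: (@continuous_comp _ _ _ (fun w : R => 2 * w - 1) _ w _ (cm _)).
  apply: cvgB; last exact: cvg_cst.
  by apply: cvgM; [exact: cvg_cst|exact: cvg_id].
have s0 := sinhalf_gt0; have s1 := sinhalf_lt1.
apply: continuous_asin; apply/andP; split.
  by rewrite lt_max; apply/orP; left; lra.
by rewrite gt_max gt_min s1 /= andbT; lra.
Qed.

End wave.

Section approximation.
Variables (R : realType) (I : finType).
Local Notation V := (cspace R I).
Local Notation J := (I * bool)%type.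

Lemma continuous_scaleR (T : topologicalType) (h : T -> R) (L : R) :
  continuous h -> continuous (fun x => L * h x).
Proof. by move=> ch x; apply: cvgM; [exact: cvg_cst|exact: ch]. Qed.

Lemma continuousRD (T : topologicalType) (f g : T -> R) :
  continuous f -> continuous g -> continuous (fun x => f x + g x).
Proof. by move=> cf cg x; apply: cvgD; [exact: cf|exact: cg]. Qed.

Lemma ptws_continuous (T : topologicalType) (F : T -> V) :
  (forall k, continuous (fun x => F x k)) -> continuous F.
Proof.
move=> h x; apply/cvg_sup => k; apply/cvg_image.
  by rewrite eqEsubset; split=> v // _; exists (cst v).
move=> W /= hW; exists (@^~ k @^-1` W); first exact: (h k x _ hW).
by rewrite eqEsubset; split => [j [? + <-//]|j Wj]; exists (fun _ => j).
Qed.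

Lemma ptws_coord_continuous (k : I) : continuous (fun y : V => y k).
Proof. by move=> y; apply: (@proj_continuous I (fun=> R[i]) k). Qed.

(** Uniform continuity on the unit cube, by compactness, with one of the two points
    free to leave the cube. *)
Lemma cube_uniform (G : (J -> R) -> R) :
  continuous (fun v : 'rV[R]_#|{: J}| => G (fun j => v ord0 (enum_rank j))) ->
  forall e, 0 < e -> exists2 r : R, 0 < r & forall z w : J -> R,
    (forall j, 0 <= z j <= 1) -> (forall j, `|z j - w j| < r) -> `|G z - G w| <= e.
Proof.
move=> cG e e0.
pose F (v : 'rV[R]_#|{: J}|) := G (fun j => v ord0 (enum_rank j)).
pose K := [set v : 'rV[R]_#|{: J}| | forall i, `[(0:R), 1]%classic (v ord0 i)].
have cK : compact K.
  apply: (@rV_compact R _ (fun=> `[(0:R), 1]%classic)) => _; exact: segment_compact.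
pose P (r : R) (v : 'rV[R]_#|{: J}|) := forall w : 'rV[R]_#|{: J}|,
  (forall i, `|v ord0 i - w ord0 i| < r) -> `|F v - F w| <= e.
have cov : \forall r \near (0:R)^'+, K `<=` P r.
  apply: (iffLR (compact_near_coveringP K) cK) => v _.
  have e2 : 0 < e / 2 by rewrite divr_gt0.
  have := iffLR (@cvgrPdist_lt _ _ _ (nbhs v) _ _ _) (cG v) _ e2.
  move=> /(_ (nbhs_filter v)) /nbhs_ballP[r /= r0 hr].
  have r2 : 0 < r / 2 by rewrite divr_gt0.
  exists (ball v (r / 2), [set s | s < r / 2]) => /=.
    by split; [exact: nbhsx_ballx|exact: nbhs_right_lt].
  move=> [v' s] /= [[_ vv'] sr] w hw.
  have h1 : `|F v - F v'| < e / 2.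
    apply: hr; split => // i j; rewrite ord1.
    have := vv' ord0 j; rewrite /ball /= => h; apply: (lt_le_trans h).
    by move: r0; lra.
  have h2 : `|F v - F w| < e / 2.
    apply: hr; split => // i j; rewrite ord1 /ball /=.
    have := vv' ord0 j; rewrite /ball /= => h.
    rewrite (_ : v ord0 j - w ord0 j = (v ord0 j - v' ord0 j) + (v' ord0 j - w ord0 j)); last by ring.
    rewrite (le_lt_trans (ler_normD _ _))// (splitr r) ltrD//.
    exact: (lt_trans (hw j)).
  rewrite (_ : F v' - F w = (F v - F w) - (F v - F v')); last by ring.
  rewrite (le_trans (ler_normB _ _))// (splitr e) lerD// ltW//.
near (0:R)^'+ => r.
exists r; first by near: r; exact: nbhs_right_gt.
move=> z w hz hw.
have hP : K `<=` P r by near: r.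
pose vz : 'rV[R]_#|{: J}| := \row_i z (enum_val i).
pose vw : 'rV[R]_#|{: J}| := \row_i w (enum_val i).
have Ez : F vz = G z by congr G; apply/funext => j; rewrite mxE enum_rankK.
have Ew : F vw = G w by congr G; apply/funext => j; rewrite mxE enum_rankK.
rewrite -Ez -Ew; apply: hP.
  by move=> i; rewrite /= mxE in_itv /=; exact: hz.
by move=> i; rewrite !mxE; exact: hw.
Unshelve. all: by end_near. Qed.

(** The point of [C^I] that the wave coordinates [(1 + sin (y_j / L)) / 2] encode, when
    the real coordinates [y_j] are at most [L / 2]. *)
Definition unwave (L : R) (w : J -> R) : V :=
  fun k => Complex (L * clampsin (w (k, false))) (L * clampsin (w (k, true))).

(** Near the origin, [f] is a continuous function of the wave coordinates
    [z_j = (1 + sin (y_j / L)) / 2], and the Bernstein polynomial of that function,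
    evaluated at [z], is a trigonometric polynomial in [y].  Far away nothing is
    approximated, but there [e * (1 + nsq y)] exceeds the trivial bound [2 K]. *)
Lemma trig_approx (f : V -> R) (K : R) : continuous f -> (forall y, `|f y| <= K) ->
  forall e, 0 < e -> exists2 g, trigpoly g &
    forall y, `|f y - g y| <= e * (1 + nsq y).
Proof.
move=> cf fK e e0.
have K0 : 0 <= K by apply: (le_trans (normr_ge0 _) (fK (fun=> 0))).
(* chosen so that e * nsq y exceeds 2 K as soon as some coordinate exceeds L / 2 *)
pose L := 4 * (1 + K / e).
have L0 : 0 < L by rewrite mulr_gt0// ltr_wpDr// divr_ge0// ltW.
pose G w := f (unwave L w).
have cG : continuous (fun v : 'rV[R]_#|{: J}| => G (fun j => v ord0 (enum_rank j))).
  move=> v; apply: (@continuous_comp _ _ _ (fun v : 'rV[R]_#|{: J}| => unwave L (fun j => v ord0 (enum_rank j))) f v); last exact: cf.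
  have cc (j : J) : continuous (fun v : 'rV[R]_#|{: J}| => clampsin (v ord0 (enum_rank j))).
    move=> {}v; apply: (@continuous_comp _ _ _ (fun v : 'rV[R]_#|{: J}| => v ord0 (enum_rank j)) (@clampsin R) v).
      exact: coord_continuous.
    exact: clampsin_continuous.
  by apply: ptws_continuous => k; apply: Complex_continuous; apply: continuous_scaleR.
have e2 : 0 < e / 2 by rewrite divr_gt0.
have [r r0 hr] := cube_uniform cG e2.
pose D : R := #|{: J}|%:R.
have [m m0 hm] : exists2 m, (0 < m)%N & 2 * K * D / r ^+ 2 / m%:R <= e / 2.
  pose q := 2 * K * D / r ^+ 2 / (e / 2).
  have q0 : 0 <= q by rewrite !divr_ge0 ?mulr_ge0// ltW.
  exists (Num.truncn q).+1 => //.
  rewrite ler_pdivrMr// (mulrC (e / 2)) -ler_pdivrMr//.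
  by apply: ltW; exact: truncnS_gt.
pose z (y : I -> R[i]) (j : J) : R := (1 + sin (L^-1 * rcoord y j)) / 2.
have z01 y j : 0 <= z y j <= 1.
  have := sin_max (L^-1 * rcoord y j); rewrite ler_norml /z => /andP[a b].
  by apply/andP; split; lra.
pose node (u : {ffun J -> 'I_m.+1}) (j : J) : R := (u j)%:R / m%:R.
exists (fun y => \sum_(u : {ffun J -> 'I_m.+1}) G (node u) * mweight (z y) u).
  apply: trigpoly_sum => u; apply: trigpoly_scale; apply: trigpoly_prod => j.
  apply: trigpoly_bin_weight.
  have := trigpoly_scale 2^-1 (trigpoly_add (trigpoly_cst I (1 : R)) (trigpoly_sin L^-1 j)).
  by congr trigpoly; apply/funext => y; rewrite /z mulrC.
move=> y.
have ns := nsq_ge0 y.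
have -> : f y - \sum_(u : {ffun J -> 'I_m.+1}) G (node u) * mweight (z y) u =
   \sum_(u : {ffun J -> 'I_m.+1}) (f y - G (node u)) * mweight (z y) u.
  under [RHS]eq_bigr do rewrite mulrBl.
  by rewrite sumrB -mulr_sumr mweight_sum mulr1.
apply: (le_trans (ler_norm_sum _ _ _)).
under eq_bigr do rewrite normrM (ger0_norm (mweight_ge0 (z01 y) _)).
have [inbox|/existsNP[j0]] := pselect (forall j, `|L^-1 * rcoord y j| <= 2^-1).
  have fG : f y = G (z y).
    congr f; apply/funext => k; rewrite /unwave /z !clampsinK//.
    rewrite !mulrA mulfV ?gt_eqF// !mul1r /rcoord /=; by case: (y k).
  (* close nodes by uniform continuity, far nodes by Chebyshev *)
  have bnd (u : {ffun J -> 'I_m.+1}) : `|f y - G (node u)| <=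
     e / 2 + 2 * K / r ^+ 2 * \sum_j (node u j - z y j) ^+ 2.
    have S0 : 0 <= \sum_j (node u j - z y j) ^+ 2 by apply: sumr_ge0 => j _; exact: sqr_ge0.
    have r2 : 0 < r ^+ 2 by rewrite exprn_gt0.
    have [near_|/existsNP[j0 /negP]] := pselect (forall j, `|z y j - node u j| < r).
      rewrite fG (le_trans (hr _ _ (z01 y) near_))// lerDl mulr_ge0// divr_ge0// ?mulr_ge0// ltW//.
    rewrite -leNgt => far.
    apply: (@le_trans _ _ (2 * K)).
      rewrite (le_trans (ler_normB _ _))// mulr2n mulrDl mul1r lerD//; exact: fK.
    have rS : r ^+ 2 <= \sum_j (node u j - z y j) ^+ 2.
      rewrite (bigD1 j0)//= ler_wpDr ?sumr_ge0// => [j _|]; first exact: sqr_ge0.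
      rewrite -(real_normK (num_real (node u j0 - z y j0))) distrC.
      by rewrite lerXn2r ?nnegrE// ltW.
    rewrite -[leLHS]add0r; apply: lerD; first exact: ltW.
    have C0 : 0 <= 2 * K / r ^+ 2 by rewrite divr_ge0 ?mulr_ge0// ltW.
    apply: le_trans (ler_wpM2l C0 rS).
    by rewrite divfK// gt_eqF.
  apply: (@le_trans _ _ (\sum_(u : {ffun J -> 'I_m.+1}) (e / 2 * mweight (z y) u +
     2 * K / r ^+ 2 * \sum_j (node u j - z y j) ^+ 2 * mweight (z y) u))).
    apply: ler_sum => u _; apply: (le_trans (ler_wpM2r (mweight_ge0 (z01 y) u) (bnd u))).
    by rewrite mulrDl -(mulrA (2 * K / r ^+ 2)) mulr_suml.
  rewrite big_split /= -!mulr_sumr mweight_sum mulr1 exchange_big /=.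
  have -> : e * (1 + nsq y) = e / 2 + e / 2 + e * nsq y by field.
  rewrite ler_wpDr ?mulr_ge0 ?(ltW e0)//.
  rewrite lerD2l; apply: le_trans hm.
  rewrite -(mulrA (2 * K)) -(mulrA (2 * K * D)) (mulrAC _ D) -!mulrA.
  apply: ler_wpM2l => //; apply: ler_wpM2l => //.
  apply: ler_wpM2l; first by rewrite invr_ge0 exprn_ge0// ltW.
  apply: (@le_trans _ _ (\sum_(j : J) m%:R^-1)).
    by apply: ler_sum => j _; exact: mweight_var.
  by rewrite sumr_const -(mulr_natr m%:R^-1).
move=> /negP; rewrite -ltNge => out.
have hL : L * 2^-1 < `|rcoord y j0|.
  by move: out; rewrite normrM normfV (gtr0_norm L0) ltr_pdivlMl.
have hN : (L / 2) ^+ 2 <= nsq y.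
  apply: (le_trans _ (coord_le_nsq y j0)).
  rewrite -(real_normK (num_real (rcoord y j0))).
  by have := ltW L0; have := ltW hL; nra.
apply: (@le_trans _ _ (2 * K)).
  apply: (@le_trans _ _ (\sum_(u : {ffun J -> 'I_m.+1}) 2 * K * mweight (z y) u)).
    apply: ler_sum => u _; apply: ler_wpM2r; first exact: mweight_ge0.
    by rewrite (le_trans (ler_normB _ _))// mulr2n mulrDl mul1r lerD//; exact: fK.
  by rewrite -mulr_sumr mweight_sum mulr1.
have : (1 + K / e) <= nsq y.
  apply: le_trans hN; rewrite /L.
  have : 0 <= K / e by rewrite divr_ge0// ltW.
  set q := K / e => q0; have -> : (4 * (1 + q) / 2) ^+ 2 = 4 * (1 + q) ^+ 2 by field.
  nra.
rewrite -(ler_pM2l e0) => h.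
have eK : e * (1 + K / e) = e + K by field; rewrite gt_eqF.
rewrite eK in h; rewrite mulrDr mulr1.
have h4 : (L / 2) ^+ 2 = 4 * (1 + K / e) ^+ 2 by rewrite /L; field; rewrite gt_eqF.
have : e * (4 * (1 + K / e) ^+ 2) <= e * nsq y by rewrite ler_pM2l// -h4.
have -> : e * (4 * (1 + K / e) ^+ 2) = 4 * (e + K) * (1 + K / e) by rewrite -eK; ring.
have : 0 <= K / e by rewrite divr_ge0// ltW.
set q := K / e => q0; nra.
Qed.

End approximation.

(** * The continuity theorem *)

Section trig_continuity.
Variables (R : realType) (I : finType).
Local Notation V := (cspace R I).

Lemma pairing_continuous a : continuous (pairing a : V -> R).
Proof.
apply: continuousC_Re; apply: continuousC_sum => k; apply: continuousCM.
  exact: cst_continuous.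
exact: ptws_coord_continuous.
Qed.

Lemma trigpoly_continuous g : trigpoly g -> continuous (g : V -> R).
Proof.
elim=> [c a b|f1 f2 _ c1 _ c2]; last exact: (continuousRD c1 c2).
apply: (@continuous_scaleR _ _ (fun y : V => cos (pairing a y + b))) => y.
have cp : continuous (fun y : V => pairing a y + b).
  exact: (continuousRD (@pairing_continuous a) (@cst_continuous _ _ b)).
exact: (continuous_comp (cp y) (@continuous_cos R _)).
Qed.

Lemma trigpoly_bounded g : @trigpoly R I g -> exists K, forall y, `|g y| <= K.
Proof.
elim=> [c a b|f1 f2 _ [K1 h1] _ [K2 h2]].
  by exists `|c| => y; rewrite normrM ler_piMr// cos_max.
by exists (K1 + K2) => y; rewrite (le_trans (ler_normD _ _))// lerD.
Qed.

End trig_continuity.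

Section levy.
Variables (R : realType) (I : finType).
Local Notation V := (cspace R I).

Section one.
Context d (Om : measurableType d) (P : probability Om R) (X : Om -> V).
Hypothesis mX : forall f : V -> R, continuous f -> measurable_fun setT (f \o X).

Lemma intg_trigpoly g : trigpoly g -> P.-integrable setT (EFin \o (fun w => g (X w))).
Proof.
move=> tg; have [K hK] := trigpoly_bounded tg.
apply: (@intg_bounded _ _ _ P _ K); last by move=> w; exact: hK.
exact: (mX (trigpoly_continuous tg)).
Qed.

Lemma intg_bounded_continuous (f : V -> R) K : continuous f -> (forall y, `|f y| <= K) ->
  P.-integrable setT (EFin \o (fun w => f (X w))).
Proof.
by move=> cf hK; apply: (@intg_bounded _ _ _ P _ K); [exact: (mX cf)|move=> w; exact: hK].
Qed.

Hypothesis X2 : P.-integrable setT (EFin \o (fun w => nsq (X w))).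

Lemma trig_approx_int (f g : V -> R) K e : continuous f -> (forall y, `|f y| <= K) ->
  trigpoly g -> 0 <= e -> (forall y, `|f y - g y| <= e * (1 + nsq y)) ->
  `|\int[P]_w f (X w) - \int[P]_w g (X w)| <= e * (1 + \int[P]_w nsq (X w)).
Proof.
move=> cf hK tg e0 h.
have i1 := intg_bounded_continuous cf hK; have i2 := intg_trigpoly tg.
rewrite -RintegralB//.
have i3 : P.-integrable setT (EFin \o (fun w => 1 + nsq (X w))).
  by apply: intgD => //; exact: intg_cst.
apply: (le_trans (Rintegral_norm_le (intgB i1 i2) (intgZ e i3) _)).
  by move=> w; exact: h.
rewrite RintegralZl// RintegralD//; last exact: intg_cst.
by rewrite Rintegral_cst1.
Qed.

End one.

Variables (d : nat -> measure_display) (Om : forall n, measurableType (d n))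
  (P : forall n, probability (Om n) R) (X : forall n, Om n -> V)
  (d' : measure_display) (Om' : measurableType d') (P' : probability Om' R)
  (Y : Om' -> V).
Arguments X : clear implicits.
Hypothesis mX : forall n (f : V -> R), continuous f -> measurable_fun setT (f \o X n).
Hypothesis mY : forall f : V -> R, continuous f -> measurable_fun setT (f \o Y).
Hypothesis X2 : forall n, (P n).-integrable setT (EFin \o (fun w => nsq (X n w))).
Hypothesis Y2 : P'.-integrable setT (EFin \o (fun w => nsq (Y w))).
Variable M : R.
Hypothesis tight : \forall n \near \oo, \int[P n]_w nsq (X n w) <= M.
Hypothesis cvg_cos : forall a,
  \int[P n]_w cos (pairing a (X n w)) @[n --> \oo] --> \int[P']_w cos (pairing a (Y w)).
Hypothesis cvg_sin : forall a,
  \int[P n]_w sin (pairing a (X n w)) @[n --> \oo] --> \int[P']_w sin (pairing a (Y w)).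

Lemma cvg_trigpoly g : trigpoly g ->
  \int[P n]_w g (X n w) @[n --> \oo] --> \int[P']_w g (Y w).
Proof.
elim=> [c a b|g1 g2 t1 c1 t2 c2]; last first.
  rewrite (RintegralD measurableT (intg_trigpoly P' mY t1) (intg_trigpoly P' mY t2)).
  under eq_fun do rewrite (RintegralD measurableT (intg_trigpoly _ (@mX _) t1) (intg_trigpoly _ (@mX _) t2)).
  exact: cvgD.
have key d0 (T : measurableType d0) (Q : probability T R) (Z : T -> V) :
    (forall f : V -> R, continuous f -> measurable_fun setT (f \o Z)) ->
    \int[Q]_w (c * cos (pairing a (Z w) + b)) =
    c * cos b * \int[Q]_w cos (pairing a (Z w)) - c * sin b * \int[Q]_w sin (pairing a (Z w)).
  move=> mZ.
  have mp : measurable_fun setT (fun w => pairing a (Z w)) := mZ _ (@pairing_continuous _ _ a).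
  have ic : Q.-integrable setT (EFin \o (fun w => cos (pairing a (Z w)))).
    apply: (@intg_bounded _ _ _ Q _ 1) => [|w]; last exact: cos_max.
    have mc : measurable_fun setT (@cos R) := continuous_measurable_fun (@continuous_cos R).
    exact: (measurableT_comp mc).
  have is_ : Q.-integrable setT (EFin \o (fun w => sin (pairing a (Z w)))).
    apply: (@intg_bounded _ _ _ Q _ 1) => [|w]; last exact: sin_max.
    have mc : measurable_fun setT (@sin R) := continuous_measurable_fun (@continuous_sin R).
    exact: (measurableT_comp mc).
  rewrite -!RintegralZl// -RintegralB//; [|exact: intgZ..].
  by apply: eq_Rintegral => w _; rewrite cosD; ring.
rewrite (key _ _ _ _ mY); under eq_fun do rewrite (key _ _ _ _ (@mX _)).
apply: cvgB; apply: cvgM.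
- exact: cvg_cst.
- exact: cvg_cos.
- exact: cvg_cst.
- exact: cvg_sin.
Qed.

(** Bounded second moments make the error [e (1 + nsq y)] of [trig_approx] small in
    mean, uniformly in [n]; expectations of trigonometric polynomials converge by
    assumption. *)
Theorem levy_continuity : cvg_in_distribution P X P' Y.
Proof.
move=> f cf [K [_ bK]].
have {bK}[K' hK] : exists K', forall y, `|f y| <= K'.
  by exists (K + 1) => y; apply: (bK (K + 1)) => //; rewrite ltrDl.
have iX n := intg_bounded_continuous (P n) (@mX n) cf hK.
have iY := intg_bounded_continuous P' mY cf hK.
have eE d0 (T : measurableType d0) (Q : probability T R) (Z : T -> V) :
   Q.-integrable setT (EFin \o (fun w => f (Z w))) ->
   ('E_Q[f \o Z] = (\int[Q]_w f (Z w))%:E)%E.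
  move=> iZ; rewrite unlock /Rintegral fineK//.
  exact: (integrable_fin_num _ iZ).
rewrite (eE _ _ _ _ iY).
under eq_fun do rewrite (eE _ _ _ _ (iX _)).
apply: cvg_EFin; first by near=> n.
rewrite [X in X @ _](_ : _ = (fun n => \int[P n]_w f (X n w)))//.
apply/cvgrPdist_le => e e0.
pose MY := \int[P']_w nsq (Y w).
have MY0 : 0 <= MY by apply: Rintegral_ge0 => w _; exact: nsq_ge0.
pose M' := Num.max 0 M.
have M0 : 0 <= M' by rewrite le_max lexx.
pose e' := e / (MY + M' + 3).
have D0 : 0 < MY + M' + 3 by lra.
have e'0 : 0 < e' by rewrite divr_gt0.
have [g tg hg] := trig_approx cf hK e'0.
have cg := iffLR (@cvgrPdist_le _ _ _ \oo _ _ _) (cvg_trigpoly tg) e' e'0.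
near=> n.
have h1 := trig_approx_int (@mX n) (@X2 n) cf hK tg (ltW e'0) hg.
have h2 := trig_approx_int mY Y2 cf hK tg (ltW e'0) hg.
have h3 : `|\int[P']_w g (Y w) - \int[P n]_w g (X n w)| <= e' by near: n; exact: cg.
have h4 : \int[P n]_w nsq (X n w) <= M'.
  apply: (@le_trans _ _ M); last by rewrite le_max lexx orbT.
  by near: n; exact: tight.
have -> : \int[P']_w f (Y w) - \int[P n]_w f (X n w) =
  (\int[P']_w f (Y w) - \int[P']_w g (Y w)) + (\int[P']_w g (Y w) - \int[P n]_w g (X n w))
  - (\int[P n]_w f (X n w) - \int[P n]_w g (X n w)) by ring.
apply: (le_trans (ler_normB _ _)).
apply: (le_trans (lerD (ler_normD _ _) (lexx _))).
apply: (le_trans (lerD (lerD h2 h3) h1)).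
rewrite -/MY.
have -> : e = e' * (MY + M' + 3) by rewrite /e' divfK// gt_eqF.
have : e' * \int[P n]_w nsq (X n w) <= e' * M' by rewrite ler_pM2l.
rewrite !mulrDr; lra.
Unshelve. all: by end_near. Qed.

End levy.

Section char_unique.
Variables (R : realType) (I : finType).
Local Notation V := (cspace R I).
Context d (Om : measurableType d) (P : probability Om R) (X : Om -> V).
Context d' (Om' : measurableType d') (P' : probability Om' R) (Y : Om' -> V).
Hypothesis mX : forall f : V -> R, continuous f -> measurable_fun setT (f \o X).
Hypothesis mY : forall f : V -> R, continuous f -> measurable_fun setT (f \o Y).
Hypothesis X2 : P.-integrable setT (EFin \o (fun w => nsq (X w))).
Hypothesis Y2 : P'.-integrable setT (EFin \o (fun w => nsq (Y w))).
Hypothesis eq_cos : forall a, \int[P]_w cos (pairing a (X w)) = \int[P']_w cos (pairing a (Y w)).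
Hypothesis eq_sin : forall a, \int[P]_w sin (pairing a (X w)) = \int[P']_w sin (pairing a (Y w)).

(** A constant sequence of laws converges to each law with the same
    characteristic function. *)
Lemma char_unique (f : V -> R) : continuous f -> bounded_fun f ->
  ('E_P[f \o X] = 'E_P'[f \o Y])%E.
Proof.
move=> cf bf.
have := @levy_continuity R I (fun=> d) (fun=> Om) (fun=> P) (fun=> X) d' Om' P' Y
  (fun=> mX) mY (fun=> X2) Y2 (\int[P]_w nsq (X w)) _ _ _ f cf bf.
move=> /(_ _ _ _)/cvg_lim <-//.
- by rewrite lim_cst.
- by near=> n.
- by move=> a; rewrite eq_cos; exact: cvg_cst.
- by move=> a; rewrite eq_sin; exact: cvg_cst.
Unshelve. all: by end_near. Qed.

End char_unique.

(** * The normal law *)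

Section normal_law.
Variables (R : realType) (s : R).
Hypothesis s0 : s != 0.
Local Notation leb := (@lebesgue_measure R).
Local Notation nu := (@normal_prob R 0 s).
Local Notation pdf := (@normal_pdf R 0 s).
Local Notation RN := (Radon_Nikodym_SigmaFinite.f nu leb).

(** The Radon-Nikodym derivative of the normal law is its density, because
    [normal_prob] is defined as the integral of the density. *)
Lemma ae_density : ae_eq leb setT RN (EFin \o pdf).
Proof.
have dom := @normal_prob_dominates R 0 s.
apply: integral_ae_eq => //.
- exact: (Radon_Nikodym_SigmaFinite.f_integrable dom).
- by apply/measurable_EFinP; exact: measurable_normal_pdf.
- by move=> E _ mE; rewrite -(Radon_Nikodym_SigmaFinite.f_integral dom mE).
Qed.

Lemma ge0_integral_normal (f : R -> R) : measurable_fun setT f -> (forall x, 0 <= f x) ->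
  (\int[nu]_x (f x)%:E = \int[leb]_x (f x * pdf x)%:E)%E.
Proof.
move=> mf f0; have dom := @normal_prob_dominates R 0 s.
rewrite -(Radon_Nikodym_SigmaFinite.change_of_variables dom)//; last first.
  exact/measurable_EFinP.
apply: ae_eq_integral => //.
- apply: emeasurable_funM; first exact/measurable_EFinP.
  exact: (measurable_int _ (Radon_Nikodym_SigmaFinite.f_integrable dom)).
- by apply/measurable_EFinP; apply: measurable_funM => //; exact: measurable_normal_pdf.
- apply: filterS ae_density => x /= h _; rewrite h//.
Qed.

Lemma integrable_normal (f : R -> R) : measurable_fun setT f ->
  nu.-integrable setT (EFin \o f) <-> leb.-integrable setT (EFin \o (fun x => f x * pdf x)).
Proof.
move=> mf.
have e : (\int[nu]_x (`|(f x)%:E|) = \int[leb]_x (`|(f x * pdf x)%:E|))%E.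
  transitivity (\int[nu]_x (`|f x|)%:E)%E; first by [].
  rewrite ge0_integral_normal//; last exact: measurableT_comp.
  by apply: eq_integral => x _; rewrite abse_EFin normrM (ger0_norm (normal_pdf_ge0 _ _ _)).
split=> /integrableP[_ h]; apply/integrableP; split.
- by apply/measurable_EFinP; apply: measurable_funM => //; exact: measurable_normal_pdf.
- by rewrite /= -e.
- exact/measurable_EFinP.
- by rewrite /= e.
Qed.

Lemma Rintegral_normal (f : R -> R) : nu.-integrable setT (EFin \o f) ->
  \int[nu]_x f x = \int[leb]_x (f x * pdf x).
Proof.
move=> hf; have mf : measurable_fun setT f by apply/measurable_EFinP; exact: measurable_int hf.
have hn := integrable_norm hf.
have key (g : R -> R) : measurable_fun setT g -> (forall x, 0 <= g x) ->
    \int[nu]_x g x = \int[leb]_x (g x * pdf x).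
  by move=> mg g0; rewrite /Rintegral ge0_integral_normal.
have -> : \int[nu]_x f x = \int[nu]_x (`|f x| + f x) - \int[nu]_x `|f x|.
  by rewrite RintegralD//= addrAC subrr add0r.
rewrite key; last 2 first.
  by apply: measurable_funD => //; exact: measurableT_comp.
  by move=> x; rewrite -lerBlDr sub0r -normrN ler_norm.
rewrite key//; last exact: measurableT_comp.
have h1 := iffLR (integrable_normal mf) hf.
have h2 := iffLR (@integrable_normal (fun x => `|f x|) (measurableT_comp (@normr_measurable R setT) mf)) hn.
transitivity (\int[leb]_x (`|f x| * pdf x + f x * pdf x) - \int[leb]_x (`|f x| * pdf x)).
  by congr (_ - _); apply: eq_Rintegral => x _; rewrite mulrDl.
by rewrite RintegralD//= addrAC subrr add0r.
Qed.

Lemma centered_normal_pdfE x : pdf x = normal_peak s * expR (- x ^+ 2 / (s ^+ 2 *+ 2)).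
Proof. by rewrite normal_pdfE// /normal_fun subr0. Qed.

(** [u exp(- 2 u) <= exp(- u)] for [u = x^2 / (4 s^2)] compares [x^2] times the density
    with a normal density of twice the variance. *)
Lemma sqr_normal_integrable : nu.-integrable setT (EFin \o (fun x : R => x ^+ 2)).
Proof.
apply/integrable_normal; first exact: measurable_funX.
have s2 : 0 < s ^+ 2 by rewrite exprn_even_gt0.
set s' := Num.sqrt 2 * s.
have s'0 : s' != 0 by rewrite mulf_neq0// gt_eqF// sqrtr_gt0.
have s'2 : s' ^+ 2 = 2 * s ^+ 2 by rewrite exprMn sqr_sqrtr.
have p0 := normal_peak_gt0 s'0.
pose c := normal_peak s * (4 * s ^+ 2) / normal_peak s'.
have := integrableZl measurableT c (@integrable_normal_pdf R 0 s').
apply: le_integrable => //.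
  apply/measurable_EFinP; apply: measurable_funM; first exact: measurable_funX.
  exact: measurable_normal_pdf.
move=> x _; change (`|x ^+ 2 * pdf x|%:E <= `|c * normal_pdf 0 s' x|%:E)%E.
rewrite lee_fin normrM (ger0_norm (sqr_ge0 x)).
rewrite (ger0_norm (normal_pdf_ge0 _ _ _)) (le_trans _ (ler_norm _))//.
rewrite centered_normal_pdfE normal_pdfE// /normal_fun subr0 s'2.
set u := x ^+ 2 / (4 * s ^+ 2).
have u0 : 0 <= u by rewrite divr_ge0 ?sqr_ge0// mulr_ge0// ltW.
have -> : - x ^+ 2 / (s ^+ 2 *+ 2) = - u - u by rewrite /u; field.
have -> : - x ^+ 2 / (2 * s ^+ 2 *+ 2) = - u by rewrite /u; field.
have -> : x ^+ 2 = 4 * s ^+ 2 * u by rewrite /u; field.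
have -> : c * (normal_peak s' * expR (- u)) = 4 * s ^+ 2 * (normal_peak s * expR (- u)).
  by rewrite /c; field; rewrite gt_eqF.
rewrite -(mulrA (4 * s ^+ 2) u) ler_wpM2l//; first by rewrite mulr_ge0// ltW.
rewrite mulrCA ler_wpM2l//; first exact: normal_peak_ge0.
rewrite expRD mulrA ler_piMl ?expR_ge0//.
rewrite -[leRHS](expRxMexpNx_1 u) ler_wpM2r ?expR_ge0//.
by apply: le_trans (expR_ge1Dx u); rewrite lerDr.
Qed.

(** The fundamental theorem of calculus on [[-k, k]], as [k] tends to infinity. *)
Lemma Rintegral_derive0 (F f : R -> R) : (forall x : R, is_derive x (1:R) F (f x)) ->
  continuous f -> leb.-integrable setT (EFin \o f) ->
  F k%:R @[k --> \oo] --> (0 : R) -> F (- k%:R) @[k --> \oo] --> (0 : R) ->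
  \int[leb]_x f x = 0.
Proof.
move=> dF cf intf Fp Fm.
have mf : measurable_fun setT f by exact: continuous_measurable_fun.
have cF : continuous F.
  by move=> x; apply/differentiable_continuous/derivable1_diffP; have [] := dF x.
pose fk k : R -> \bar R := (EFin \o f) \_ `[- k%:R, k%:R].
have fc : (\int[leb]_x fk k x)%E @[k --> \oo] --> (\int[leb]_x (f x)%:E)%E.
  apply: (@dominated_cvg _ _ _ leb setT measurableT fk (EFin \o f) (fun x => `|f x|%:E)) => //.
  - move=> k; apply/(measurable_restrictT _ _).1; first exact: measurable_itv.
    by apply: measurable_funTS; exact/measurable_EFinP.
  - move=> x _; apply: cvg_near_cst; near=> k.
    rewrite /fk patchE mem_set//= in_itv/= -ler_norml.
    by near: k; exact: nbhs_infty_ger.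
  - by apply: (integrable_norm intf).
  - move=> k x _; rewrite /fk patchE; case: ifP => _ //=.
    by rewrite normr0 lee_fin.
have fF : \forall k \near \oo, (\int[leb]_x fk k x)%E = (F k%:R - F (- k%:R))%:E.
  near=> k; have k0 : (0 : R) < k%:R by rewrite ltr0n; near: k; exact: nbhs_infty_gt.
  rewrite -integral_mkcond (@continuous_FTC2 _ f F)//.
  - by rewrite (lt_trans _ k0)// oppr_lt0.
  - exact: continuous_subspaceT.
  - split=> [x _||].
    + by have [] := dF x.
    + exact: (cvg_at_right_filter (cF _)).
    + exact: (cvg_at_left_filter (cF _)).
  - by move=> x _; rewrite derive1E; have [_ ->] := dF x.
have : (\int[leb]_x fk k x)%E @[k --> \oo] --> (0 : R)%:E.
  apply: cvg_trans; first by apply: near_eq_cvg; apply: filterS fF => k ->.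
  apply: cvg_EFin; first by apply: nearW.
  by rewrite -[X in _ --> X](subrr 0); exact: (cvgB Fp Fm).
move=> /cvg_lim c0; move/cvg_lim : fc => fc.
rewrite /Rintegral -fc// c0//.
Unshelve. all: by end_near. Qed.

Lemma is_derive_normal_pdf x : is_derive x (1:R) pdf (- (x / s ^+ 2) * pdf x).
Proof.
rewrite (funext centered_normal_pdfE).
have h1 : is_derive x (1:R) (fun x : R => - x ^+ 2 / (s ^+ 2 *+ 2)) (- (x / s ^+ 2)).
  apply: (is_derive_quadratic (K := (s ^+ 2 *+ 2)^-1)) => h.
  rewrite [X in `|X|](_ : _ = - ((s ^+ 2 *+ 2)^-1 * h ^+ 2)); last by field.
  by rewrite normrN ger0_norm// mulr_ge0 ?sqr_ge0// invr_ge0 mulrn_wge0// sqr_ge0.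
have h2 := @is_derive1_comp R expR (fun x : R => - x ^+ 2 / (s ^+ 2 *+ 2)) x _ _ (is_derive_expR _) h1.
have h3 := is_deriveZ (normal_peak s) h2.
by apply: (is_derive_eq h3); rewrite -![_ *: _]/(_ * _); ring.
Qed.

Lemma pdf_cvg0 (a : R ^nat) : (forall k, k%:R <= `|a k|) -> pdf (a k) @[k --> \oo] --> (0 : R).
Proof.
move=> ha; have s2 : 0 < s ^+ 2 by rewrite exprn_even_gt0.
apply: (@squeeze_cvgr _ _ _ _ (fun=> 0) (fun k => normal_peak s * (s ^+ 2 *+ 2) * k%:R^-1)).
- near=> k; have k0 : (0 : R) < k%:R by rewrite ltr0n; near: k; exact: nbhs_infty_gt.
  rewrite normal_pdf_ge0/= centered_normal_pdfE -mulrA ler_wpM2l ?normal_peak_ge0//.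
  have t0 : 0 < s ^+ 2 *+ 2 by rewrite pmulrn_lgt0.
  rewrite mulNr expRN -[X in _ <= X * _]invrK -invfM lef_pV2 ?posrE ?expR_gt0//; last first.
    by rewrite mulr_gt0// invr_gt0.
  apply: le_trans (expR_ge1Dx _).
  rewrite mulrC; apply: (@le_trans _ _ (a k ^+ 2 / (s ^+ 2 *+ 2))); last by rewrite lerDr.
  rewrite ler_pM2r ?invr_gt0//.
  rewrite -(real_normK (num_real (a k))).
  apply: (@le_trans _ _ (k%:R ^+ 2)); last by rewrite ler_sqr ?nnegrE.
  by rewrite expr2 ler_peMl ?ler1n// -(ltr0n R).
- exact: cvg_cst.
- rewrite -[X in _ --> X](mulr0 (normal_peak s * (s ^+ 2 *+ 2))); apply: cvgM; first exact: cvg_cst.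
  by rewrite -cvg_shiftS; exact: cvg_harmonic.
Unshelve. all: by end_near. Qed.

(** The derivative of [s^2 g pdf] is [(s^2 g' - x g) pdf], since [pdf' = - x pdf / s^2]. *)
Lemma normal_ibp (g g' : R -> R) (K K' : R) : (forall x : R, is_derive x (1:R) g (g' x)) ->
  continuous g' -> (forall x, `|g x| <= K) -> (forall x, `|g' x| <= K') ->
  \int[nu]_x (x * g x) = s ^+ 2 * \int[nu]_x g' x.
Proof.
move=> dg cg' hg hg'.
have cg : continuous g.
  by move=> x; apply/differentiable_continuous/derivable1_diffP; have [] := dg x.
have mg := continuous_measurable_fun cg; have mg' := continuous_measurable_fun cg'.
have ig' : nu.-integrable setT (EFin \o g') := intg_bounded nu mg' hg'.
have mi : measurable_fun setT (fun x : R => x) := @measurable_id _ R setT.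
have ix := @intg_X _ _ _ nu (fun x => x) mi sqr_normal_integrable.
have ig : nu.-integrable setT (EFin \o (fun x => x * g x)).
  apply: (@intg_le _ _ _ nu _ (fun x => K * `|x|)).
  - exact: measurable_funM.
  - by move=> x; rewrite normrM mulrC ler_wpM2r.
  - by apply: intgZ; exact: (integrable_norm ix).
have i2 : nu.-integrable setT (EFin \o (fun x => s ^+ 2 * g' x - x * g x)).
  by apply: intgB => //; exact: intgZ.
have := @Rintegral_derive0 (fun x => s ^+ 2 * g x * pdf x) (fun x => (s ^+ 2 * g' x - x * g x) * pdf x).
move=> /(_ _ _ _ _ _).
rewrite -Rintegral_normal// RintegralB//; last exact: intgZ.
rewrite RintegralZl// => h; apply/eqP; rewrite eq_sym -subr_eq0; apply/eqP; apply: h.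
- move=> x; have dp := is_derive_normal_pdf x; have dgx := dg x.
  apply: (is_derive_eq (is_deriveM (is_deriveZ (s ^+ 2) dgx) dp)).
  change (s ^+ 2 * g x * (- (x / s ^+ 2) * pdf x) + pdf x * (s ^+ 2 * g' x) =
    (s ^+ 2 * g' x - x * g x) * pdf x).
  by field.
- move=> x; apply: cvgM; last exact: continuous_normal_pdf.
  apply: cvgB; first by apply: cvgM; [exact: cvg_cst|exact: cg'].
  by apply: cvgM; [exact: cvg_id|exact: cg].
- apply/integrable_normal => //.
  by apply: measurable_funB; apply: measurable_funM.
- apply: norm_cvg0; apply: (@squeeze_cvgr _ _ _ _ (fun=> 0) (fun k => s ^+ 2 * K * pdf k%:R)).
  + near=> k; rewrite normr_ge0/= normrM (ger0_norm (normal_pdf_ge0 _ _ _)).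
    by rewrite ler_wpM2r ?normal_pdf_ge0// (normrM (s ^+ 2)) ger0_norm ?sqr_ge0// ler_wpM2l// sqr_ge0.
  + exact: cvg_cst.
  + rewrite -[X in _ --> X](mulr0 (s ^+ 2 * K)); apply: cvgM; first exact: cvg_cst.
    by apply: pdf_cvg0 => k; rewrite ler_norm.
- apply: norm_cvg0; apply: (@squeeze_cvgr _ _ _ _ (fun=> 0) (fun k => s ^+ 2 * K * pdf (- k%:R))).
  + near=> k; rewrite normr_ge0/= normrM (ger0_norm (normal_pdf_ge0 _ _ _)).
    by rewrite ler_wpM2r ?normal_pdf_ge0// (normrM (s ^+ 2)) ger0_norm ?sqr_ge0// ler_wpM2l// sqr_ge0.
  + exact: cvg_cst.
  + rewrite -[X in _ --> X](mulr0 (s ^+ 2 * K)); apply: cvgM; first exact: cvg_cst.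
    by apply: pdf_cvg0 => k; rewrite normrN ler_norm.
Unshelve. all: by end_near. Qed.

(** By [normal_ibp], the differential equation of [char_cos_bound] and
    [char_sin_bound] holds with no error. *)
Lemma normal_char t : \int[nu]_x cos (t * x) = expR (- (t ^+ 2 * s ^+ 2) / 2) /\
  \int[nu]_x sin (t * x) = 0.
Proof.
have mi : measurable_fun setT (fun x : R => t * x) by apply: measurable_funM.
have X2 : nu.-integrable setT (EFin \o (fun x => (t * x) ^+ 2)).
  by under eq_fun do rewrite exprMn; apply: intgZ; exact: sqr_normal_integrable.
have dl u (x : R) : is_derive x (1:R) (fun x => u * x) u.
  by apply: (is_derive_quadratic (K := 0)) => h; rewrite mul0r normr_le0; apply/eqP; ring.
have dc u x : is_derive x (1:R) (fun x => cos (u * x)) (- sin (u * x) * u).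
  exact: (@is_derive1_comp R cos (fun x => u * x) x _ _ (is_derive_cos _) (dl u x)).
have ds u x : is_derive x (1:R) (fun x => sin (u * x)) (cos (u * x) * u).
  exact: (@is_derive1_comp R sin (fun x => u * x) x _ _ (is_derive_sin _) (dl u x)).
have cu u : continuous (fun x : R => u * x) by move=> x; exact: (cvgM (cvg_cst u) cvg_id).
have v0 : 0 <= t ^+ 2 * s ^+ 2 by rewrite mulr_ge0 ?sqr_ge0.
split; apply/eqP; rewrite -subr_eq0 -normr_le0 ?subr0.
- have := @char_cos_bound _ _ _ nu (fun x => t * x) mi X2 (t ^+ 2 * s ^+ 2) 0 v0; apply => r _; rewrite mulr0 normr_le0 subr_eq0; apply/eqP.
  transitivity (t * \int[nu]_x (x * sin (r * t * x))).
    rewrite -RintegralZl//; last first.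
      by apply: (@intg_XsinX _ _ _ nu (fun x => x) _ sqr_normal_integrable) => //.
    by apply: eq_Rintegral => x _; rewrite !mulrA.
  rewrite (@normal_ibp _ (fun x => cos (r * t * x) * (r * t)) 1 `|r * t|).
  - rewrite mulrA. 
    under eq_Rintegral do rewrite mulrC.
    rewrite RintegralZl//; last first.
      exact: (@intg_cosX _ _ _ nu (fun x => x) _ _).
    under [in RHS]eq_Rintegral do rewrite mulrA.
    ring.
  - move=> x; apply: cvgM; last exact: cvg_cst.
    exact: (continuous_comp (cu _ _) (@continuous_cos R _)).
  - by move=> x; exact: sin_max.
  - by move=> x; rewrite normrM ler_piMl// cos_max.
- have := @char_sin_bound _ _ _ nu (fun x => t * x) mi X2 (t ^+ 2 * s ^+ 2) 0 v0; apply => r _; rewrite mulr0 normr_le0 addr_eq0; apply/eqP.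
  transitivity (t * \int[nu]_x (x * cos (r * t * x))).
    rewrite -RintegralZl//; last first.
      by apply: (@intg_XcosX _ _ _ nu (fun x => x) _ sqr_normal_integrable) => //.
    by apply: eq_Rintegral => x _; rewrite !mulrA.
  rewrite (@normal_ibp _ (fun x => - sin (r * t * x) * (r * t)) 1 `|r * t|).
  - rewrite mulrA. 
    under eq_Rintegral do rewrite mulNr -mulrN mulrC.
    rewrite RintegralZl//; last first.
      exact: (@intg_sinX _ _ _ nu (fun x => x) _ _).
    under [in RHS]eq_Rintegral do rewrite mulrA.
    ring.
  - move=> x; apply: cvgM; last exact: cvg_cst.
    apply: cvgN; exact: (continuous_comp (cu _ _) (@continuous_sin R _)).
  - by move=> x; exact: cos_max.
  - by move=> x; rewrite normrM normrN ler_piMl// sin_max.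
Qed.

End normal_law.

Section law.
Variable R : realType.

(** Continuous approximations of the indicator of the open half-line below [x]. *)
Definition ramp (x : R) (k : nat) (y : R) : R := Num.min 1 (Num.max 0 (k%:R * (x - y))).

Lemma ramp_continuous x k : continuous (ramp x k).
Proof.
move=> y; apply: (@continuous_min R _ (fun=> 1) (fun y => Num.max 0 (k%:R * (x - y)))).
  exact: cst_continuous.
apply: (@continuous_max R _ (fun=> 0) (fun y => k%:R * (x - y))).
  exact: cst_continuous.
apply: cvgM; first exact: cvg_cst.
by apply: cvgB; [exact: cvg_cst|exact: cvg_id].
Qed.

Lemma ramp_bound x k y : `|ramp x k y| <= 1.
Proof.
rewrite ger0_norm ?ge_min ?lexx//.
by rewrite le_min ler01/= le_max lexx.
Qed.

Lemma ramp_cvg x y : ramp x k y @[k --> \oo] --> (\1_(`]-oo, x[%classic) y : R).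
Proof.
rewrite indicE; have [yx|xy] := ltP y x.
  rewrite mem_set ?in_itv//=; apply: cvg_near_cst; near=> k.
  rewrite /ramp; apply/min_idPl; rewrite le_max; apply/orP; right.
  rewrite -ler_pdivrMr ?subr_gt0// mul1r.
  by near: k; exact: nbhs_infty_ger.
rewrite memNset/=; last by rewrite in_itv/= ltNge xy.
apply: cvg_near_cst; near=> k.
rewrite /ramp (max_idPl _) ?(min_idPr _)//.
by rewrite mulr_ge0_le0// subr_le0.
Unshelve. all: by end_near. Qed.

Lemma ramp_integral d (T : measurableType d) (P : probability T R) (X : T -> R) x :
  measurable_fun setT X ->
  (\int[P]_w (ramp x k (X w))%:E)%E @[k --> \oo] --> P (X @^-1` `]-oo, x[%classic).
Proof.
move=> mX; have mA : measurable (X @^-1` `]-oo, x[%classic).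
  by rewrite -[_ @^-1` _]setTI; apply: mX => //; exact: measurable_itv.
have -> : P (X @^-1` `]-oo, x[%classic) = (\int[P]_w (\1_(`]-oo, x[%classic) (X w))%:E)%E.
  transitivity (\int[P]_w (\1_(X @^-1` `]-oo, x[%classic) w)%:E)%E; last exact: eq_integral.
  by rewrite integral_indic// setIT.
apply: (@dominated_cvg _ _ _ P setT measurableT _ _ (fun=> 1%E)) => //.
- move=> k; apply/measurable_EFinP; apply: measurableT_comp => //.
  exact: (continuous_measurable_fun (@ramp_continuous x k)).
- by move=> w _; apply: cvg_EFin; [exact: nearW|exact: ramp_cvg].
- exact: intg_cst.
- by move=> k w _; rewrite lee_fin ramp_bound.
Qed.

(** Open half-lines generate the Borel sets and are stable by intersection; their
    measures are limits of integrals of continuous functions. *)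
Lemma law_eq d (T : measurableType d) (P : probability T R) (X : T -> R)
    (nu : probability (measurableTypeR R) R) : measurable_fun setT X ->
  (forall g : R -> R, continuous g -> (forall y, `|g y| <= 1) ->
    (\int[P]_w (g (X w))%:E = \int[nu]_y (g y)%:E)%E) ->
  forall A : set R, measurable A -> P (X @^-1` A) = nu A.
Proof.
move=> mX h A mA.
pose Xm : {RV P >-> measurableTypeR R} := HB.pack_for {RV P >-> measurableTypeR R} X
  (isMeasurableFun.Build _ _ T (measurableTypeR R) X mX).
change (distribution P Xm A = nu A).
have := @measure_unique _ R (measurableTypeR R) (@RGenInftyO.G R)
  (fun k => `]-oo, (k%:R : R)[%classic) _ _ _ _ (distribution P Xm) nu; apply => //.
- exact: RGenInftyO.measurableE.
- move=> _ _ [x ->] [y ->]; exists (Num.min x y).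
  by apply/seteqP; split => z /=; rewrite !in_itv/= lt_min => /andP.
- by move=> i; exists i%:R.
- apply/seteqP; split => // x _.
  near \oo => k; exists k => //=; rewrite in_itv/=.
  by near: k; exact: nbhs_infty_gtr.
- move=> _ [x ->].
  have := @ramp_integral _ _ P X x mX.
  have := @ramp_integral _ _ nu (fun y => y) x (@measurable_id _ _ _).
  have -> : (fun k => \int[P]_w (ramp x k (X w))%:E)%E = (fun k => \int[nu]_y (ramp x k y)%:E)%E.
    by apply/funext => k; rewrite h//; [exact: ramp_continuous|exact: ramp_bound].
  by move=> c1 c2; exact: (cvg_unique _ c2 c1).
- move=> k; rewrite (le_lt_trans (probability_le1 _ _)) ?ltry//.
Unshelve. all: by end_near. Qed.

End law.

Section real_char.
Variable R : realType.
Local Notation V := (cspace R unit).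

(** Real variables are viewed in [C^unit], where [char_unique] is available. *)
Lemma embed_continuous : continuous ((fun x : R => (fun=> x%:C%C)) : R -> V).
Proof.
apply: ptws_continuous => k; apply: Complex_continuous.
  by move=> x; exact: cvg_id.
exact: cst_continuous.
Qed.

Section one.
Context d (T : measurableType d) (P : probability T R) (X : T -> R).
Hypothesis mX : measurable_fun setT X.
Let Xc w : V := fun=> (X w)%:C%C.

Lemma embed_measurable (f : V -> R) : continuous f -> measurable_fun setT (f \o Xc).
Proof.
move=> cf; have c : continuous (fun x : R => f (fun=> x%:C%C)).
  by move=> x; apply: (@continuous_comp R V R (fun x _ => x%:C%C) f x); [exact: embed_continuous|exact: cf].
exact: (measurableT_comp (continuous_measurable_fun c) mX).
Qed.

Hypothesis X2 : P.-integrable setT (EFin \o (fun w => X w ^+ 2)).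

Lemma embed_sq : P.-integrable setT (EFin \o (fun w => nsq (Xc w))).
Proof.
rewrite (_ : (fun w => nsq (Xc w)) = fun w => X w ^+ 2)//.
by apply/funext => w; rewrite /nsq (big_pred1 tt) ?nm_real ?real_normK ?num_real// => -[].
Qed.

Lemma embed_pairing a w : pairing a (Xc w) = complex.Re (a tt) * X w.
Proof.
rewrite /pairing (big_pred1 tt) => [|[]//].
by rewrite /Xc mulrC ReM_real mulrC.
Qed.

End one.

Context d (T : measurableType d) (P : probability T R) (X : T -> R).
Context d' (T' : measurableType d') (P' : probability T' R) (X' : T' -> R).
Hypothesis mX : measurable_fun setT X.
Hypothesis X2 : P.-integrable setT (EFin \o (fun w => X w ^+ 2)).
Hypothesis mX' : measurable_fun setT X'.
Hypothesis X2' : P'.-integrable setT (EFin \o (fun w => X' w ^+ 2)).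
Hypothesis eq_cos : forall s, \int[P]_w cos (s * X w) = \int[P']_w cos (s * X' w).
Hypothesis eq_sin : forall s, \int[P]_w sin (s * X w) = \int[P']_w sin (s * X' w).

Lemma real_char_unique (g : R -> R) : continuous g -> (forall y, `|g y| <= 1) ->
  (\int[P]_w (g (X w))%:E = \int[P']_w (g (X' w))%:E)%E.
Proof.
move=> cg bg.
have := @char_unique R unit _ _ P (fun w _ => (X w)%:C%C) _ _ P' (fun w _ => (X' w)%:C%C)
  (embed_measurable mX) (embed_measurable mX') (embed_sq X2) (embed_sq X2') _ _
  (fun y => g (complex.Re (y tt))).
move=> e; suff: ('E_P[g \o X] = 'E_P'[g \o X'])%E by rewrite !unlock.
apply: e.
- by move=> a; under eq_Rintegral do rewrite embed_pairing; rewrite eq_cos;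
    under [RHS]eq_Rintegral do rewrite embed_pairing.
- by move=> a; under eq_Rintegral do rewrite embed_pairing; rewrite eq_sin;
    under [RHS]eq_Rintegral do rewrite embed_pairing.
- move=> y; apply: (@continuous_comp V R R (fun y => complex.Re (y tt)) g y); last exact: cg.
  by apply: continuousC_Re; exact: ptws_coord_continuous.
- by exists 1; split => // M M1 y _ /=; apply: le_trans (bg _) (ltW M1).
Qed.

End real_char.

Section gaussian_char.
Context (R : realType) d (T : measurableType d) (P : probability T R) (X : T -> R) (v : R).
Hypothesis mX : measurable_fun setT X.
Hypothesis X2 : P.-integrable setT (EFin \o (fun w => X w ^+ 2)).
Hypothesis char_cos : forall s, \int[P]_w cos (s * X w) = expR (- (s ^+ 2 * v) / 2).
Hypothesis char_sin : forall s, \int[P]_w sin (s * X w) = 0.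

(** The derivative at 0 of the integral of [sin (s X)]. *)
Lemma char_mean : \int[P]_w X w = 0.
Proof.
have h := is_derive_char_sin mX X2 0.
transitivity (\int[P]_w (X w * cos (0 * X w))).
  by apply: eq_Rintegral => w _; rewrite mul0r cos0 mulr1.
rewrite -(@derive_val _ _ _ _ _ _ _ h) (funext char_sin).
exact: derive_cst.
Qed.

Lemma char_deriv s : \int[P]_w (X w * sin (s * X w)) = s * v * expR (- (s ^+ 2 * v) / 2).
Proof.
have h := is_derive_char_cos mX X2 s.
apply: oppr_inj; rewrite -(@derive_val _ _ _ _ _ _ _ h) (funext char_cos).
have h1 : is_derive s (1:R) (fun s : R => - (s ^+ 2 * v) / 2) (- (s * v)).
  apply: (is_derive_quadratic (K := `|v|)) => t.
  rewrite [X in `|X|](_ : _ = - (v / 2 * t ^+ 2)); last by field.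
  rewrite normrN normrM (ger0_norm (sqr_ge0 _)) ler_wpM2r ?sqr_ge0//.
  by rewrite normrM ler_piMr// ger0_norm// invf_le1// ler1n.
have h2 := @is_derive1_comp R expR _ s _ _ (is_derive_expR _) h1.
by rewrite (@derive_val _ _ _ _ _ _ _ h2); ring.
Qed.

(** [X sin (t X) / t] converges to [X^2] as [t] tends to 0 and is dominated by it, while its
    integral is [v exp(- t^2 v / 2)]. *)
Lemma char_variance : \int[P]_w (X w ^+ 2) = v.
Proof.
pose e (k : nat) : R := k.+1%:R^-1.
have e0 k : 0 < e k by rewrite invr_gt0.
have c1 : (\int[P]_w (X w * ((e k)^-1 * sin (e k * X w)))%:E)%E @[k --> \oo] -->
    (\int[P]_w (X w ^+ 2)%:E)%E.
  apply: (@dominated_cvg _ _ _ P setT measurableT _ _ (fun w => (X w ^+ 2)%:E)) => //.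
  - move=> k; apply/measurable_EFinP; apply: measurable_funM => //.
    by apply: measurable_funM => //; exact: measurable_sinX.
  - move=> w _; apply: cvg_EFin; first exact: nearW.
    rewrite expr2; apply: cvgM; first exact: cvg_cst.
    apply/cvgrPdist_le => eps eps0; near=> k.
    have -> : X w - (e k)^-1 * sin (e k * X w) = (e k)^-1 * (e k * X w - sin (e k * X w)).
      by field; rewrite gt_eqF.
    have := sin_taylor 0 (e k * X w).
    rewrite add0r sin0 cos0 mulr1 subr0 distrC => h.
    rewrite normrM gtr0_norm ?invr_gt0// ler_pdivrMl//.
    apply: (le_trans h); rewrite exprMn.
    have -> : e k ^+ 2 * X w ^+ 2 *+ 2 = e k * (e k * (X w ^+ 2 *+ 2)) by ring.
    rewrite ler_pM2l// /e.
    rewrite ler_pdivrMl// -ler_pdivrMr//.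
    near: k; have := nbhs_infty_ger (X w ^+ 2 *+ 2 / eps).
    by apply: filterS => k /le_trans; apply; rewrite ler_nat.
  - move=> k w _; rewrite lee_fin normrM expr2 -[leRHS]ger0_norm ?sqr_ge0//.
    rewrite !(normrM (X w)) ler_wpM2l// normrM gtr0_norm ?invr_gt0// ler_pdivrMl//.
    by rewrite (le_trans (sin_le_norm _))// normrM gtr0_norm.
have c2 : (\int[P]_w (X w * ((e k)^-1 * sin (e k * X w)))%:E)%E @[k --> \oo] --> v%:E.
  have i k : P.-integrable setT (EFin \o (fun w => X w * sin (e k * X w))) by exact: intg_XsinX.
  rewrite (_ : (fun k => _) = (fun k => (v * expR (- (e k ^+ 2 * v) / 2))%:E)); last first.
    apply/funext => k.
    transitivity ((\int[P]_w ((e k)^-1 * (X w * sin (e k * X w))))%:E).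
      rewrite fineK; last by apply: integrable_fin_num => //; exact: intgZ.
      by apply: eq_integral => w _; congr (_%:E); rewrite mulrCA.
    rewrite RintegralZl// char_deriv; congr (_%:E); field.
    by rewrite gt_eqF.
  apply: cvg_EFin; first exact: nearW.
  have h := @cvg_harmonic R.
  have c0 : - (e k ^+ 2 * v) / 2 @[k --> \oo] --> (0 : R).
    rewrite (_ : 0 = - (0 * 0 * v) / 2); last by rewrite !mul0r oppr0 mul0r.
    apply: cvgM; last exact: cvg_cst.
    by apply: cvgN; apply: cvgM; [exact: (cvgM h h)|exact: cvg_cst].
  rewrite -[X in _ --> X](mulr1 v) -[X in v * X]expR0; apply: cvgM; first exact: cvg_cst.
  exact: (cvg_comp _ expR c0 (@continuous_expR _ _)).
have u := cvg_unique _ c1 c2.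
by rewrite /Rintegral u.
Unshelve. all: by end_near. Qed.

(** The normal law of variance [v], or the point mass at 0 when [v = 0], has the same
    characteristic function. *)
Lemma char_gaussian : gaussian_rv P X.
Proof.
have v0 : 0 <= v by rewrite -char_variance; apply: Rintegral_ge0 => w _; exact: sqr_ge0.
exists 0, (Num.sqrt v) => A mA.
have id_m : measurable_fun setT (fun y : R => y) := @measurable_id _ R setT.
case: ifPn => s0.
- have {}s0 : v = 0.
    by apply/eqP; rewrite eq_le v0 andbT -sqrtr_eq0.
  have := @law_eq R _ _ P X (dirac (0 : measurableTypeR R) : probability (measurableTypeR R) R); apply => // g cg bg.
  apply: (@real_char_unique R _ _ P X _ _ (dirac (0 : measurableTypeR R) : probability (measurableTypeR R) R) (fun y => y)) => //.
  + apply/integrableP; split; [by apply/measurable_EFinP; exact: measurable_funX|].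
    rewrite integral_dirac//=.
      by rewrite diracT mul1e expr0n/= normr0 ltry.
    by apply/measurable_EFinP; apply: measurableT_comp => //; exact: measurable_funX.
  + move=> s; rewrite char_cos s0 mulr0 oppr0 mul0r expR0 /Rintegral integral_dirac//.
      by rewrite diracT mul1e /= mulr0 cos0.
    apply/measurable_EFinP; exact: (@measurable_cosX _ _ _ (fun y => y) id_m).
  + move=> s; rewrite char_sin /Rintegral integral_dirac//.
      by rewrite diracT mul1e /= mulr0 sin0.
    apply/measurable_EFinP; exact: (@measurable_sinX _ _ _ (fun y => y) id_m).
- have := @law_eq R _ _ P X (normal_prob (0 : R) (Num.sqrt v) : probability (measurableTypeR R) R); apply => // g cg bg.
  apply: (@real_char_unique R _ _ P X _ _ (normal_prob 0 (Num.sqrt v)) (fun y => y)) => //.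
  + exact: sqr_normal_integrable.
  + by move=> s; rewrite char_cos (normal_char s0 s).1 sqr_sqrtr.
  + by move=> s; rewrite char_sin (normal_char s0 s).2.
Qed.

End gaussian_char.

(** * Gaussian vectors with prescribed covariance *)

Section product_integral.
Context (R : realType) d1 (T1 : measurableType d1) (P1 : probability T1 R).
Context d2 (T2 : measurableType d2) (P2 : probability T2 R).
Local Notation intg1 f := (P1.-integrable setT (EFin \o f)).
Local Notation intg2 f := (P2.-integrable setT (EFin \o f)).
Variables (f : T1 -> R) (g : T2 -> R).
Hypotheses (intf : intg1 f) (intgg : intg2 g).

Lemma prod_measurable : measurable_fun setT (fun z : T1 * T2 => f z.1 * g z.2).
Proof.
have mf : measurable_fun setT f by apply/measurable_EFinP; exact: measurable_int intf.
have mg : measurable_fun setT g by apply/measurable_EFinP; exact: measurable_int intgg.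
apply: measurable_funM.
  exact: (measurableT_comp mf measurable_fst).
exact: (measurableT_comp mg measurable_snd).
Qed.

Lemma prod_integrable :
  (P1 \x P2)%E.-integrable setT (EFin \o (fun z : T1 * T2 => f z.1 * g z.2)).
Proof.
apply/integrable12ltyP; first by apply/measurable_EFinP; exact: prod_measurable.
have gn := integrable_norm intgg; have fn := integrable_norm intf.
rewrite (_ : (fun x => _) = (fun x => (\int[P2]_y `|g y|)%:E * (`|f x|)%:E)%E); last first.
  apply/funext => x /=.
  rewrite (_ : (fun y => _) = (fun y => `|f x|%:E * (`|g y|)%:E)%E); last first.
    by apply/funext => y; rewrite -EFinM -normrM.
  rewrite integralZl// muleC fineK//.
  exact: integrable_fin_num.
rewrite integralZl//.
have := integrable_fin_num measurableT fn => h.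
by rewrite -(fineK h) -EFinM ltry.
Qed.

Lemma Rintegral_prod :
  \int[(P1 \x P2)%E]_z (f z.1 * g z.2) = \int[P1]_x f x * \int[P2]_y g y.
Proof.
rewrite {1}/Rintegral -(integral12_prod_meas1 prod_integrable) /=.
rewrite (_ : (fun x => _) = (fun x => (\int[P2]_y g y)%:E * (f x)%:E)%E); last first.
  apply/funext => x.
  transitivity (\int[P2]_y ((f x)%:E * (g y)%:E))%E; first exact: eq_integral.
  rewrite integralZl// muleC fineK//.
  exact: integrable_fin_num.
rewrite integralZl// mulrC /Rintegral.
have h := integrable_fin_num measurableT intf.
by rewrite -[in LHS](fineK h) -EFinM.
Qed.

End product_integral.

Section gaussian_space.
Variable R : realType.

(** Independent standard normal variables, described by their joint characteristic
    function instead of a product law. *)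
Definition gauss_family n d (Om : measurableType d) (P : probability Om R) (Z : 'I_n -> Om -> R) :=
  [/\ forall k, measurable_fun setT (Z k),
      forall k, P.-integrable setT (EFin \o (fun w => Z k w ^+ 2)),
      forall b : 'I_n -> R, \int[P]_w cos (\sum_k b k * Z k w) = expR (- (\sum_k b k ^+ 2) / 2)
    & forall b : 'I_n -> R, \int[P]_w sin (\sum_k b k * Z k w) = 0].

(** Adding one normal factor to the product space multiplies the characteristic
    functions, by the addition formulas and Fubini. *)
Lemma gauss_family_exists n : exists d (Om : measurableType d) (P : probability Om R)
  (Z : 'I_n -> Om -> R), gauss_family P Z.
Proof.
pose nu : probability (measurableTypeR R) R := normal_prob (0 : R) 1.
have one0 : (1 : R) != 0 by rewrite oner_neq0.
elim: n => [|n [d [Om [P [Z [mZ Z2 Zcos Zsin]]]]]].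
  exists _, (measurableTypeR R), nu, (fun _ _ => 0); split; [by case|by case|..] => b.
    under eq_Rintegral do rewrite big_ord0 cos0.
    by rewrite big_ord0 oppr0 mul0r expR0 Rintegral_cst1.
  under eq_Rintegral do rewrite big_ord0 sin0.
  by rewrite Rintegral_cst1.
pose Z' (k : 'I_n.+1) (z : Om * measurableTypeR R) : R :=
  oapp (fun j => Z j z.1) (z.2 : R) (unlift ord0 k).
have mid : measurable_fun setT (fun y : measurableTypeR R => (y : R)) := @measurable_id _ _ _.
have nu2 := sqr_normal_integrable one0 : nu.-integrable setT (EFin \o (fun x : R => x ^+ 2)).
have sumE b z : \sum_k b k * Z' k z = b ord0 * z.2 + \sum_k b (lift ord0 k) * Z k z.1.
  rewrite big_ord_recl /Z' unlift_none; congr (_ + _).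
  by apply: eq_bigr => k _; rewrite liftK.
have mA b : measurable_fun setT (fun w => \sum_k b k * Z k w).
  by apply: measurable_sum => k; apply: measurable_funM.
have mc : measurable_fun setT (@cos R) := continuous_measurable_fun (@continuous_cos R).
have ms : measurable_fun setT (@sin R) := continuous_measurable_fun (@continuous_sin R).
have ic b : P.-integrable setT (EFin \o (fun w => cos (\sum_k b k * Z k w))).
  by apply: (@intg_bounded _ _ _ P _ 1 (measurableT_comp mc (mA b))) => w; exact: cos_max.
have isn b : P.-integrable setT (EFin \o (fun w => sin (\sum_k b k * Z k w))).
  by apply: (@intg_bounded _ _ _ P _ 1 (measurableT_comp ms (mA b))) => w; exact: sin_max.
have jc t : nu.-integrable setT (EFin \o (fun y : R => cos (t * y))) :=
  @intg_cosX _ _ _ nu (fun y => y) mid t.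
have js t : nu.-integrable setT (EFin \o (fun y : R => sin (t * y))) :=
  @intg_sinX _ _ _ nu (fun y => y) mid t.
exists _, (Om * measurableTypeR R)%type, (P \x nu)%E, Z'; split.
- move=> k; rewrite /Z'; case: unliftP => [j _|_] /=.
    exact: (measurableT_comp (mZ j) measurable_fst).
  exact: measurable_snd.
- move=> k; rewrite /Z'; case: unliftP => [j _|_] /=.
    have := prod_integrable (Z2 j) (intg_cst nu 1).
    by under eq_fun do rewrite mulr1.
  have := prod_integrable (intg_cst P 1) nu2.
  by under eq_fun do rewrite mul1r.
- move=> b; pose b' k := b (lift ord0 k).
  transitivity (\int[(P \x nu)%E]_z (cos (\sum_k b' k * Z k z.1) * cos (b ord0 * z.2) -
      sin (\sum_k b' k * Z k z.1) * sin (b ord0 * z.2))).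
    by apply: eq_Rintegral => z _; rewrite sumE addrC cosD.
  rewrite RintegralB//; [|exact: (prod_integrable (ic _) (jc _))|exact: (prod_integrable (isn _) (js _))].
  rewrite (Rintegral_prod (ic b') (jc (b ord0))) (Rintegral_prod (isn b') (js (b ord0))).
  rewrite Zcos Zsin mul0r subr0 (normal_char one0 _).1 -expRD; congr expR.
  by rewrite big_ord_recl /b'; field.
- move=> b; pose b' k := b (lift ord0 k).
  transitivity (\int[(P \x nu)%E]_z (sin (\sum_k b' k * Z k z.1) * cos (b ord0 * z.2) +
      cos (\sum_k b' k * Z k z.1) * sin (b ord0 * z.2))).
    by apply: eq_Rintegral => z _; rewrite sumE addrC sinD.
  rewrite RintegralD//; [|exact: (prod_integrable (isn _) (jc _))|exact: (prod_integrable (ic _) (js _))].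
  rewrite (Rintegral_prod (isn b') (jc (b ord0))) (Rintegral_prod (ic b') (js (b ord0))).
  by rewrite Zsin mul0r add0r (normal_char one0 _).2 mulr0.
Qed.

End gaussian_space.

Section cholesky.
Variable R : realType.

(** Cholesky decomposition: the first row and column are eliminated, and the Schur
    complement is again positive semidefinite.  When the corner [a] vanishes so does
    its row, and the convention [0^-1 = 0] lets the same formulas cover this case. *)
Lemma psd_factor n (M : 'M[R]_n) : M^T = M -> (forall x : 'rV_n, 0 <= (x *m M *m x^T) ord0 ord0) ->
  exists B : 'M[R]_n, M = B *m B^T.
Proof.
elim: n M => [|n IH] M symM posM.
  by exists 0; apply/matrixP => -[].
change 'M[R]_(1 + n) in M.
have {}posM : forall x : 'rV_(1 + n), 0 <= (x *m M *m x^T) ord0 ord0 := posM.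
pose a := M ord0 ord0; pose r : 'rV_n := ursubmx M; pose D := drsubmx M.
have eM : M = block_mx a%:M r r^T D.
  rewrite -[LHS]submxK; congr block_mx.
    by rewrite [LHS]mx11_scalar !mxE; congr (M _ _)%:M; apply/val_inj.
  by rewrite /r -{1}symM -trmx_ursub.
have symD : D^T = D by rewrite /D trmx_drsub symM.
(* the values of the form on the row vectors (s, y) *)
have quad_ge0 (s : R) (y : 'rV_n) : 0 <= a * s ^+ 2 + 2 * s * (r *m y^T) ord0 ord0 + (y *m D *m y^T) ord0 ord0.
  have := posM (row_mx s%:M y); rewrite eM; set q := (r *m y^T) ord0 ord0.
  have eq1 : r *m y^T = q%:M by rewrite [LHS]mx11_scalar.
  have eq2 : y *m r^T = q%:M by rewrite -[LHS]trmxK trmx_mul trmxK eq1 tr_scalar_mx.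
  rewrite mul_row_block tr_row_mx mul_row_col tr_scalar_mx mul_mx_scalar mulmxDl.
  rewrite !mul_scalar_mx eq2 -scalemxAl eq1 !scale_scalar_mx.
  by rewrite !mxE eqxx !mulr1n; congr (0 <= _); ring.
(* otherwise the quadratic form, affine in s along r, would take negative values *)
have r0 : a = 0 -> r = 0.
  move=> a0; pose c := (r *m r^T) ord0 ord0; pose e := (r *m D *m r^T) ord0 ord0.
  have cE : c = \sum_j r ord0 j ^+ 2 by rewrite /c mxE; apply: eq_bigr => j _; rewrite [r^T _ _]mxE.
  have [c0|c0] := eqVneq c 0.
    apply/rowP => j; rewrite [RHS]mxE; apply/eqP; rewrite -sqrf_eq0.
    move: cE; rewrite c0 => /esym/eqP; rewrite psumr_eq0; last by move=> ? _; exact: sqr_ge0.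
    by move=> /allP/(_ j); rewrite mem_index_enum; apply.
  have := quad_ge0 (- (e + 1) / (2 * c)) r; rewrite a0 mul0r add0r -/c -/e.
  have -> : 2 * (- (e + 1) / (2 * c)) * c + e = - 1 by field.
  by rewrite oppr_ge0 ler10.
have a0 : 0 <= a.
  by have := quad_ge0 1 0; rewrite trmx0 mulmx0 mul0mx mul0mx !mxE mulr0 !addr0 expr1n mulr1.
have [||B eB] := IH (D - a^-1 *: (r^T *m r)).
- by rewrite linearB /= linearZ /= trmx_mul trmxK symD.
(* the Schur complement at y is the form at its minimum in s *)
- move=> y; have := quad_ge0 (- a^-1 * (r *m y^T) ord0 ord0) y.
  set q := (r *m y^T) ord0 ord0.
  have eq1 : r *m y^T = q%:M by rewrite [LHS]mx11_scalar.
  have eq2 : y *m r^T = q%:M by rewrite -[LHS]trmxK trmx_mul trmxK eq1 tr_scalar_mx.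
  rewrite mulmxBr mulmxBl -scalemxAr -scalemxAl (mulmxA y) -(mulmxA _ r) eq1 eq2.
  rewrite mul_scalar_mx !scale_scalar_mx.
  move: (y *m D *m y^T) => W h; rewrite mxE [X in _ + X]mxE [X in _ - X]mxE eqxx mulr1n.
  apply: le_trans h _; rewrite le_eqVlt; apply/orP; left; apply/eqP.
  have [->|an0] := eqVneq a 0; first by rewrite invr0; ring.
  by field.
pose C := block_mx (Num.sqrt a)%:M 0 ((Num.sqrt a)^-1 *: r^T) B.
exists C; change (M = C *m C^T :> 'M[R]_(1 + n)).
rewrite /C eM tr_block_mx mulmx_block !trmx0 !mulmx0 !mul0mx !addr0 tr_scalar_mx linearZ /= trmxK.
have sr : Num.sqrt a *: ((Num.sqrt a)^-1 *: r) = r.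
  have [z|nz] := eqVneq a 0; first by rewrite r0// !scaler0.
  by rewrite scalerA divff ?scale1r// sqrtr_eq0 -ltNge lt_neqAle eq_sym nz.
congr block_mx.
- by rewrite mul_scalar_mx scale_scalar_mx -expr2 sqr_sqrtr.
- by rewrite mul_scalar_mx sr.
- by rewrite mul_mx_scalar -{1}sr; apply/matrixP => i j; rewrite !mxE.
- rewrite -eB -scalemxAl -scalemxAr scalerA -invfM -expr2 sqr_sqrtr//.
  by rewrite addrC subrK.
Qed.

End cholesky.

Section row_vector_measurability.
Context (R : realType) d (T : measurableType d) (n : nat) (W : T -> 'rV[R]_n).
Hypothesis mW : forall k, measurable_fun setT (fun w => W w ord0 k).

(** An open set is the countable union of the rational boxes that it contains. *)
Lemma open_row_measurable (O : set 'rV[R]_n) : open O -> measurable (W @^-1` O).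
Proof.
move=> oO.
pose box (i : 'rV[rat]_n * nat) : set 'rV[R]_n :=
  [set v | forall k, `|v ord0 k - ratr (i.1 ord0 k)| < i.2.+1%:R^-1].
have mbox i : measurable (W @^-1` box i).
  have -> : W @^-1` box i = \bigcap_(k in [set: 'I_n])
      (fun w => W w ord0 k) @^-1` [set x : R | `|x - ratr (i.1 ord0 k)| < i.2.+1%:R^-1].
    apply/seteqP; split=> [w h k _|w h k]; first exact: h.
    exact: (h k).
  apply: fin_bigcap_measurable => // k _; rewrite -[X in measurable X]setTI.
  apply: mW => //; apply: open_measurable.
  apply: (@open_comp _ _ (fun x : R => `|x - ratr (i.1 ord0 k)|) [set y | y < i.2.+1%:R^-1]).
    move=> x _; apply: (@continuous_comp _ _ _ (fun x : R => x - ratr (i.1 ord0 k)) Num.norm).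
      by apply: cvgB; [exact: cvg_id|exact: cvg_cst].
    exact: norm_continuous.
  exact: open_lt.
have -> : W @^-1` O = \bigcup_i (if `[< box i `<=` O >] then W @^-1` box i else set0).
  apply/seteqP; split=> [w /= Ow|w [i _]]; last first.
    by case: asboolP => // h wi; exact: h.
  have := oO _ Ow => /nbhs_ballP[e /= e0 he].
  have [k hk] : exists k : nat, 2 * k.+1%:R^-1 < e.
    near \oo => k; exists k.
    rewrite ltr_pdivrMr// mulrC -ltr_pdivrMr//.
    have : 2 / e < k%:R by near: k; exact: nbhs_infty_gtr.
    by move=> /lt_le_trans; apply; rewrite ler_nat.
  have ex l : exists q : rat, `|W w ord0 l - ratr q| < k.+1%:R^-1.
    have : W w ord0 l - k.+1%:R^-1 < W w ord0 l + k.+1%:R^-1.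
      by rewrite ltrD2l gtrN// invr_gt0.
    move=> /rat_in_itvoo[q]; rewrite in_itv/= => /andP[h1 h2]; exists q.
    move: (k.+1%:R^-1) h1 h2 => u h1 h2.
    by rewrite ltr_norml; apply/andP; split; lra.
  exists (\row_l sval (cid (ex l)), k) => //.
  have wb : box (\row_l sval (cid (ex l)), k) (W w).
    by move=> l /=; rewrite mxE; case: cid.
  case: asboolP => // -[] v hv; apply: he.
  split=> // i l; rewrite (ord1 i) /ball/=.
  apply: lt_trans hk.
  have := hv l; have := wb l => /=; rewrite (distrC (v _ _)) => h1 h2.
  rewrite -[X in `|X|](subrKA (ratr ((\row_l sval (cid (ex l))) ord0 l))).
  by apply: (le_lt_trans (ler_normD _ _)); rewrite mulr_natl mulr2n ltrD.
apply: countable_bigcupT_measurable => // i.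
by case: asboolP.
Unshelve. all: by end_near. Qed.

End row_vector_measurability.

Lemma sum_pair_bool (V : nmodType) (I : finType) (F : I * bool -> V) :
  \sum_j F j = \sum_x (F (x, true) + F (x, false)).
Proof.
rewrite (eq_bigr (fun p => F (p.1, p.2))); last by case.
rewrite -(pair_bigA _ (fun (x : I) (b : bool) => F (x, b))) /=.
by apply: eq_bigr => x _; rewrite big_bool.
Qed.

Section covariance_form.
Variables (R : realType) (I : finType) (tau sigma : I -> I -> R[i]).
Implicit Types a b c : I -> R[i].
Local Notation V := (cspace R I).
Local Notation J := (I * bool)%type.

(** For a centered vector [G] with [E[G_x G_y] = tau x y] and
    [E[G_x conj(G_y)] = sigma x y], this is [E[pairing a G * pairing b G]], since
    [Re z Re w = Re (z w + z conj(w)) / 2]. *)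
Definition cov_form a b : R :=
  2^-1 * complex.Re (\sum_x \sum_y (a x * b y * tau x y + a x * (b y)^* * sigma x y)).

Lemma cov_formDl a b c : cov_form (fun x => a x + b x) c = cov_form a c + cov_form b c.
Proof.
rewrite /cov_form -mulrDr -raddfD -big_split; congr (_ * complex.Re _).
apply: eq_bigr => x _; rewrite -big_split; apply: eq_bigr => y _ /=; ring.
Qed.

Lemma cov_formZl (r : R) a b : cov_form (fun x => r%:C%C * a x) b = r * cov_form a b.
Proof.
rewrite /cov_form [RHS]mulrCA; set X := (X in r * complex.Re X).
rewrite -(ReM_real r X) /X mulr_sumr; congr (_ * complex.Re _).
apply: eq_bigr => x _; rewrite mulr_sumr; apply: eq_bigr => y _ /=; ring.
Qed.

Lemma cov_form0l b : cov_form (fun=> 0) b = 0.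
Proof. by rewrite /cov_form big1 ?mulr0// => x _; rewrite big1// => y _; rewrite !mul0r addr0. Qed.

Lemma cov_form_suml (K : Type) (r : seq K) (c : K -> R) (e : K -> I -> R[i]) b :
  cov_form (fun x => \sum_(k <- r) (c k)%:C%C * e k x) b = \sum_(k <- r) c k * cov_form (e k) b.
Proof.
elim: r => [|k r IH].
  rewrite big_nil -[RHS](cov_form0l b); congr cov_form.
  by apply/funext => x; rewrite big_nil.
rewrite big_cons -IH -cov_formZl -cov_formDl; congr cov_form.
by apply/funext => x; rewrite big_cons.
Qed.

Hypothesis tau_sym : forall x y, tau x y = tau y x.
Hypothesis sigma_herm : forall x y, (sigma x y)^* = sigma y x.

Lemma cov_formC a b : cov_form a b = cov_form b a.
Proof.
rewrite /cov_form exchange_big /=; congr (_ * _).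
rewrite !raddf_sum; apply: eq_bigr => x _; rewrite !raddf_sum; apply: eq_bigr => y _ /=.
rewrite !raddfD /=; congr (_ + _); first by rewrite tau_sym; congr complex.Re; ring.
rewrite -sigma_herm !conjE.
case: (a y) (b x) (sigma x y) => a1 a2 [b1 b2] [s1 s2] /=; ring.
Qed.

Hypothesis cov_form_ge0 : forall a, 0 <= cov_form a a.

(** The real basis [1], [i] of each coordinate line. *)
Definition cunit (j : J) : I -> R[i] := fun x => (x == j.1)%:R * (if j.2 then 'i else 1).

Lemma coord_decomposition a : a = (fun x => \sum_(j : J) (rcoord a j)%:C%C * cunit j x).
Proof.
apply/funext => x; rewrite sum_pair_bool (bigD1 x)//= [X in _ + X]big1 ?addr0; last first.
  by move=> y /negbTE yx; rewrite /cunit /= eq_sym yx !mul0r !mulr0 addr0.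
rewrite /cunit /= eqxx !mul1r mulr1 /rcoord /= -complexiE.
by case: (a x) => u v; apply/eqP; rewrite eq_complex /=; apply/andP; split; apply/eqP; ring.
Qed.

(** The Gram matrix of [cov_form] on the real basis is positive semidefinite, hence of
    the form [B B^T]; apply [B] to independent standard normal variables. *)
Theorem gaussian_vector_exists : exists d (Om : measurableType d) (P : probability Om R)
    (G : {RV P >-> borel V}),
  [/\ forall a, \int[P]_w cos (pairing a (G w)) = expR (- cov_form a a / 2),
      forall a, \int[P]_w sin (pairing a (G w)) = 0
    & P.-integrable setT (EFin \o (fun w => nsq (G w : V)))].
Proof.
pose n := #|{: J}|.
pose M : 'M[R]_n := \matrix_(k, l) cov_form (cunit (enum_val k)) (cunit (enum_val l)).
have expand a : cov_form a a = \sum_k \sum_l rcoord a (enum_val k) * rcoord a (enum_val l) * M k l.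
  have e b : cov_form a b = \sum_(k < n) rcoord a (enum_val k) * cov_form (cunit (enum_val k)) b.
    rewrite {1}(coord_decomposition a) cov_form_suml.
    by rewrite (reindex (@enum_val _ (mem {: J})))//=; exact/onW_bij/enum_val_bij.
  rewrite e; apply: eq_bigr => k _; rewrite cov_formC e mulr_sumr; apply: eq_bigr => l _.
  by rewrite mxE mulrA cov_formC.
have [B eB] : exists B : 'M[R]_n, M = B *m B^T.
  apply: psd_factor; first by apply/matrixP => k l; rewrite !mxE cov_formC.
  move=> x; pose a : I -> R[i] := fun y => Complex (x ord0 (enum_rank (y, false))) (x ord0 (enum_rank (y, true))).
  have ca (k : 'I_n) : rcoord a (enum_val k) = x ord0 k.
    rewrite /rcoord /a; case E : (enum_val k) => [y [|]] /=; rewrite -E enum_valK//.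
  have := cov_form_ge0 a; rewrite expand.
  rewrite !mxE; congr (0 <= _); rewrite exchange_big; apply: eq_bigr => l _.
  rewrite [x^T _ _]mxE mxE mulr_suml; apply: eq_bigr => k _.
  by rewrite !ca mulrAC.
have [d [Om [P [Z [mZ Z2 Zcos Zsin]]]]] := gauss_family_exists R n.
pose W w : 'rV[R]_n := \row_k \sum_l B k l * Z l w.
have mW k : measurable_fun setT (fun w => W w ord0 k).
  under eq_fun do rewrite mxE.
  by apply: measurable_sum => l; apply: measurable_funM.
pose psi (v : 'rV[R]_n) : V :=
  fun x => Complex (v ord0 (enum_rank (x, false))) (- v ord0 (enum_rank (x, true))).
have cpsi : continuous psi.
  apply: ptws_continuous => x; apply: Complex_continuous.
    exact: coord_continuous.
  by move=> v; have h := @coord_continuous R 1 n ord0 (enum_rank (x, true)) v; exact: (cvgN h).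
have mG : @measurable_fun _ _ Om (borel V) setT (psi \o W).
  apply: (@measurability _ _ Om (borel V) setT (psi \o W) (@open V)) => //.
  move=> _ [A oA <-]; rewrite setTI.
  have oA' : open (psi @^-1` A) by move/continuousP : cpsi; exact.
  exact: (open_row_measurable mW oA').
pose G : {RV P >-> borel V} := HB.pack_for {RV P >-> borel V} (psi \o W)
  (isMeasurableFun.Build _ _ Om (borel V) (psi \o W) mG).
have pairG a w : pairing a (G w) = \sum_l (\sum_k rcoord a (enum_val k) * B k l) * Z l w.
  transitivity (\sum_(j : J) rcoord a j * W w ord0 (enum_rank j)).
    rewrite /pairing raddf_sum.
    rewrite sum_pair_bool; apply: eq_bigr => x _; rewrite /rcoord /=.
    by case: (a x) => u v /=; ring.
  rewrite (reindex (@enum_val _ (mem {: J})))/=; last exact/onW_bij/enum_val_bij.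
  under eq_bigr do rewrite enum_valK mxE mulr_sumr.
  rewrite exchange_big; apply: eq_bigr => l _; rewrite mulr_suml; apply: eq_bigr => k _.
  by rewrite mulrA.
exists d, Om, P, G; split=> [a|a|].
- under eq_Rintegral do rewrite pairG.
  rewrite Zcos; congr (expR (- _ / 2)); rewrite expand.
  under eq_bigr do rewrite expr2 mulr_suml.
  rewrite exchange_big; apply: eq_bigr => k _.
  under eq_bigr do rewrite mulr_sumr.
  rewrite exchange_big; apply: eq_bigr => l _.
  rewrite eB mxE mulr_sumr; apply: eq_bigr => r _; rewrite mxE; ring.
- by under eq_Rintegral do rewrite pairG; rewrite Zsin.
- have ZZ k l : P.-integrable setT (EFin \o (fun w => Z k w * Z l w)).
    apply: (@intg_le _ _ _ P _ (fun w => Z k w ^+ 2 + Z l w ^+ 2)); last exact: intgD.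
      exact: measurable_funM.
    move=> w; rewrite normrM -(real_normK (num_real (Z k w))) -(real_normK (num_real (Z l w))).
    by have := sqr_ge0 (`|Z k w| - `|Z l w|); have := normr_ge0 (Z k w); have := normr_ge0 (Z l w); nra.
  rewrite (_ : (fun w => nsq _) =
    (fun w => \sum_(k < n) \sum_(l < n) \sum_(l' < n) B k l * B k l' * (Z l w * Z l' w))).
    by apply: intg_sum => k; apply: intg_sum => l; apply: intg_sum => l'; exact: intgZ.
  apply/funext => w; transitivity (\sum_(j : J) W w ord0 (enum_rank j) ^+ 2).
    rewrite sum_pair_bool /nsq; apply: eq_bigr => x _.
    by rewrite nm_sqrE /= sqrrN addrC.
  rewrite (reindex (@enum_val _ (mem {: J})))/=; last exact/onW_bij/enum_val_bij.
  apply: eq_bigr => k _; rewrite enum_valK mxE expr2 mulr_suml.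
  apply: eq_bigr => l _; rewrite mulr_sumr; apply: eq_bigr => l' _.
  by rewrite mulrACA.
Qed.

End covariance_form.

Lemma cspace_measurable (R : realType) (I : finType) (f : cspace R I -> R) :
  continuous f -> measurable_fun [set: borel (cspace R I)] f.
Proof.
move=> /continuousP cf; apply: (measurability _ (RGenOpens.measurableE R)).
move=> _ [_ [a [b ->] <-]]; rewrite setTI.
by apply: sub_gen_smallest; apply: cf; exact: interval_open.
Qed.

Section gaussian_vector.
Context (R : realType) (I : finType) (tau sigma : I -> I -> R[i]).
Context d (Om : measurableType d) (P : probability Om R) (G : {RV P >-> borel (cspace R I)}).
Local Notation V := (cspace R I).
Local Notation cov := (cov_form tau sigma).
Hypothesis tau_sym : forall x y, tau x y = tau y x.
Hypothesis sigma_herm : forall x y, (sigma x y)^* = sigma y x.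
Hypothesis char_cos : forall a, \int[P]_w cos (pairing a (G w)) = expR (- cov a a / 2).
Hypothesis char_sin : forall a, \int[P]_w sin (pairing a (G w)) = 0.
Hypothesis G2 : P.-integrable setT (EFin \o (fun w => nsq (G w : V))).

(** Each modulus [nm (y k)] is at most the square root of [nsq y]. *)
Lemma pairing_sqr_le a (y : I -> R[i]) : pairing a y ^+ 2 <= (\sum_k nm (a k)) ^+ 2 * nsq y.
Proof.
have h : `|pairing a y| <= (\sum_k nm (a k)) * Num.sqrt (nsq y).
  apply: (le_trans (Re_ge0_le_norm _)); apply: (le_trans (nm_sum _ _ _)).
  rewrite mulr_suml; apply: ler_sum => k _; rewrite nmM ler_wpM2l ?nm_ge0//.
  rewrite -[leLHS]ger0_norm ?nm_ge0// -sqrtr_sqr ler_wsqrtr//.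
  by rewrite /nsq (bigD1 k)//= lerDl sumr_ge0// => ? _; exact: sqr_ge0.
rewrite -(sqr_sqrtr (nsq_ge0 y)) -exprMn -[leLHS]real_normK ?num_real// ler_sqr// nnegrE.
exact: le_trans h.
Qed.

Lemma pairing_measurable a : measurable_fun setT (fun w => pairing a (G w)).
Proof.
have c : measurable_fun [set: borel V] (pairing a : V -> R).
  exact: cspace_measurable (@pairing_continuous R I a).
have mG : measurable_fun setT G := measurable_funPT G.
exact: (measurableT_comp c mG).
Qed.

Lemma pairing_sqr_integrable a : P.-integrable setT (EFin \o (fun w => pairing a (G w) ^+ 2)).
Proof.
apply: (@intg_le _ _ _ P _ (fun w => (\sum_k nm (a k)) ^+ 2 * nsq (G w : V))).
- by apply: measurable_funX; exact: pairing_measurable.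
- by move=> w; rewrite ger0_norm ?sqr_ge0//; exact: pairing_sqr_le.
- exact: intgZ.
Qed.

Lemma pairingZ (s : R) (a y : I -> R[i]) : pairing (fun k => s%:C%C * a k) y = s * pairing a y.
Proof.
rewrite /pairing -ReM_real mulr_sumr; congr complex.Re.
by apply: eq_bigr => k _; rewrite mulrA.
Qed.

Lemma pairing_char_cos a s : \int[P]_w cos (s * pairing a (G w)) = expR (- (s ^+ 2 * cov a a) / 2).
Proof.
under eq_Rintegral do rewrite -pairingZ.
by rewrite char_cos cov_formZl cov_formC// cov_formZl mulrA.
Qed.

Lemma pairing_char_sin a s : \int[P]_w sin (s * pairing a (G w)) = 0.
Proof. by under eq_Rintegral do rewrite -pairingZ; rewrite char_sin. Qed.

Lemma pairing_mean a : \int[P]_w pairing a (G w) = 0.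
Proof.
exact: (char_mean (pairing_measurable a) (pairing_sqr_integrable a) (pairing_char_sin a)).
Qed.

Lemma pairing_variance a : \int[P]_w (pairing a (G w) ^+ 2) = cov a a.
Proof.
exact: (char_variance (pairing_measurable a) (pairing_sqr_integrable a) (pairing_char_cos a)).
Qed.

Lemma pairing_mul_integrable a b :
  P.-integrable setT (EFin \o (fun w => pairing a (G w) * pairing b (G w))).
Proof.
have ia := pairing_sqr_integrable a; have ib := pairing_sqr_integrable b.
apply: (@intg_le _ _ _ P _ (fun w => pairing a (G w) ^+ 2 + pairing b (G w) ^+ 2)); last exact: intgD.
  by apply: measurable_funM; exact: pairing_measurable.
move=> w; rewrite normrM -(real_normK (num_real (pairing a _))) -(real_normK (num_real (pairing b _))).
move: (pairing a _) (pairing b _) => u v.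
by have := sqr_ge0 (`|u| - `|v|); have := normr_ge0 u; have := normr_ge0 v; nra.
Qed.

(** Polarization of [pairing_variance]. *)
Lemma pairing_covariance a b : \int[P]_w (pairing a (G w) * pairing b (G w)) = cov a b.
Proof.
have ia := pairing_sqr_integrable a; have ib := pairing_sqr_integrable b.
have iab := pairing_mul_integrable a b.
have e : \int[P]_w (pairing (fun k => a k + b k) (G w) ^+ 2) =
    \int[P]_w (pairing a (G w) ^+ 2) + 2 * \int[P]_w (pairing a (G w) * pairing b (G w)) +
    \int[P]_w (pairing b (G w) ^+ 2).
  have i2 := intgZ 2 iab; rewrite -RintegralZl//.
  rewrite -(RintegralD measurableT ia i2) -(RintegralD measurableT (intgD ia i2) ib).
  by apply: eq_Rintegral => w _; rewrite pairingD; ring.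
move: e; rewrite !pairing_variance cov_formDl.
rewrite (cov_formC tau_sym sigma_herm a) (cov_formC tau_sym sigma_herm b) !cov_formDl.
rewrite (cov_formC tau_sym sigma_herm b a); lra.
Qed.

Definition dirac_coef x (u : R[i]) : I -> R[i] := fun z => (z == x)%:R * u.

Lemma pairing_dirac x u y : pairing (dirac_coef x u) y = complex.Re (u * y x).
Proof.
rewrite /pairing (bigD1 x)//= big1 ?addr0; last first.
  by move=> z /negbTE zx; rewrite /dirac_coef zx !mul0r.
by rewrite /dirac_coef eqxx mul1r.
Qed.

Lemma cov_dirac x y u v : cov (dirac_coef x u) (dirac_coef y v) =
  2^-1 * complex.Re (u * v * tau x y + u * v^* * sigma x y).
Proof.
rewrite /cov_form (bigD1 x)//= [X in _ + X]big1 ?addr0; last first.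
  by move=> z /negbTE zx; rewrite big1// => ? _; rewrite /dirac_coef zx !mul0r addr0.
rewrite (bigD1 y)//= big1 ?addr0; last first.
  by move=> z /negbTE zx; rewrite /dirac_coef zx !mul0r rmorph0 !(mulr0, mul0r) addr0.
by rewrite /dirac_coef !eqxx !mul1r.
Qed.

Let re x w := pairing (dirac_coef x 1) (G w).
Let im x w := pairing (dirac_coef x (- 'i)) (G w).

Let reE x w : complex.Re (G w x) = re x w.
Proof. by rewrite /re pairing_dirac mul1r. Qed.

Let imE x w : complex.Im (G w x) = im x w.
Proof. by rewrite /im pairing_dirac; case: (G w x) => u v; rewrite -complexiE /=; ring. Qed.

Lemma gaussian_vector_centered : centered_gaussian_vector G.
Proof.
split=> [a b|k].
- have e w : \sum_k (a k * complex.Re (G w k) + b k * complex.Im (G w k)) =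
      pairing (fun k => Complex (a k) (- b k)) (G w).
    rewrite /pairing raddf_sum; apply: eq_bigr => k _ /=.
    by case: (G w k) => u v /=; ring.
  rewrite (funext e); apply: char_gaussian.
  + exact: pairing_measurable.
  + exact: pairing_sqr_integrable.
  + exact: pairing_char_cos.
  + exact: pairing_char_sin.
- have mean0 a : ('E_P[fun w => pairing a (G w)] = 0)%E.
    rewrite unlock -[LHS]fineK; last first.
      apply: integrable_fin_num => //.
      exact: (intg_X (pairing_measurable a) (pairing_sqr_integrable a)).
    by congr (_%:E); exact: pairing_mean.
  split.
    by rewrite (funext (reE k)); exact: mean0.
  by rewrite (funext (imE k)); exact: mean0.
Qed.

Let Ni_conj : (- 'i : R[i])^* = 'i.
Proof. by rewrite conjE -complexiE /=; apply/eqP; rewrite eq_complex /= oppr0 opprK !eqxx. Qed.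

Lemma gaussian_vector_tau x y : cexpectation P (fun w => G w x * G w y) = tau x y.
Proof.
rewrite cexpectationE.
rewrite (_ : (fun w => complex.Re _) = (fun w => re x w * re y w - im x w * im y w)); last first.
  by apply/funext => w; rewrite -!reE -!imE; case: (G w x) (G w y) => ? ? [].
rewrite (_ : (fun w => complex.Im _) = (fun w => re x w * im y w + im x w * re y w)); last first.
  by apply/funext => w; rewrite -!reE -!imE; case: (G w x) (G w y) => ? ? [].
rewrite RintegralB//; [|exact: pairing_mul_integrable..].
rewrite RintegralD//; [|exact: pairing_mul_integrable..].
rewrite /re /im !pairing_covariance !cov_dirac !Ni_conj !conjC1 -complexiE.
case: (tau x y) (sigma x y) => t1 t2 [s1 s2] /=.
by apply/eqP; rewrite eq_complex /=; apply/andP; split; apply/eqP; field.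
Qed.

Lemma gaussian_vector_sigma x y : cexpectation P (fun w => G w x * (G w y)^*) = sigma x y.
Proof.
rewrite cexpectationE.
rewrite (_ : (fun w => complex.Re _) = (fun w => re x w * re y w + im x w * im y w)); last first.
  by apply/funext => w; rewrite -!reE -!imE conjE; case: (G w x) (G w y) => ? ? [? ?] /=; ring.
rewrite (_ : (fun w => complex.Im _) = (fun w => im x w * re y w - re x w * im y w)); last first.
  by apply/funext => w; rewrite -!reE -!imE conjE; case: (G w x) (G w y) => ? ? [? ?] /=; ring.
rewrite RintegralB//; [|exact: pairing_mul_integrable..].
rewrite RintegralD//; [|exact: pairing_mul_integrable..].
rewrite /re /im !pairing_covariance !cov_dirac !Ni_conj !conjC1 -complexiE.
case: (tau x y) (sigma x y) => t1 t2 [s1 s2] /=.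
by apply/eqP; rewrite eq_complex /=; apply/andP; split; apply/eqP; field.
Qed.

End gaussian_vector.

(** * The vector of bilinear statistics *)

Section diagonal.
Variables (R : realType) (n : nat).
Implicit Types A : 'M[R[i]]_n.

Lemma diag_mulmx k A (B : 'M[R[i]]_(n, k)) a b : is_diag_mx A -> (A *m B) a b = A a a * B a b.
Proof.
move=> /is_diag_mxP dA; rewrite mxE (bigD1 a)//= big1 ?addr0// => c ca.
by rewrite dA ?mul0r// eq_sym.
Qed.

Lemma is_diag_trmxC A : is_diag_mx A -> is_diag_mx (A ^t*).
Proof.
move=> /is_diag_mxP dA; apply/is_diag_mxP => a b ab.
by rewrite !mxE dA ?rmorph0// eq_sym.
Qed.

Lemma trmxC_coord A a b : (A ^t*) a b = (A b a)^*.
Proof. by rewrite !mxE. Qed.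

End diagonal.

Section lift.
Variables (R : realType) (p q : nat).
Local Notation I := ('I_p * 'I_p * 'I_q)%type.

(** The covariances of the limit vector: the indices of the columns are paired by
    exchange in [E[G G]], and by identity in [E[G conj(G)]]. *)
Definition lift_tau (tau : 'I_q -> 'I_q -> R[i]) (x y : I) : R[i] :=
  (x.1.1 == y.1.2)%:R * (x.1.2 == y.1.1)%:R * tau x.2 y.2.

Definition lift_sigma (sigma : 'I_q -> 'I_q -> R[i]) (x y : I) : R[i] :=
  (x.1.1 == y.1.1)%:R * (x.1.2 == y.1.2)%:R * sigma x.2 y.2.

Lemma lift_tau_sym tau : (forall m n, tau m n = tau n m) ->
  forall x y, lift_tau tau x y = lift_tau tau y x.
Proof.
move=> h x y; rewrite /lift_tau h; congr (_ * _).
by rewrite mulrC (eq_sym x.1.2) (eq_sym x.1.1).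
Qed.

Lemma lift_sigma_herm sigma : (forall m n, (sigma m n)^* = sigma n m) ->
  forall x y, (lift_sigma sigma x y)^* = lift_sigma sigma y x.
Proof.
move=> h x y; rewrite /lift_sigma !rmorphM /= h !rmorph_nat.
by rewrite (eq_sym x.1.1) (eq_sym x.1.2).
Qed.

Lemma sum_triple (V : nmodType) (F : I -> V) :
  \sum_x F x = \sum_i \sum_j \sum_m F (i, j, m).
Proof.
rewrite (eq_bigr (fun x => F (x.1, x.2))); last by case.
rewrite -(pair_bigA _ (fun (u : 'I_p * 'I_p) (m : 'I_q) => F (u, m))) /=.
rewrite (eq_bigr (fun u => \sum_m F (u.1, u.2, m))); last by case.
by rewrite -(pair_bigA _ (fun (i j : 'I_p) => \sum_m F (i, j, m))).
Qed.

Lemma cov_form_lift tau sigma (a : I -> R[i]) :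
  cov_form (lift_tau tau) (lift_sigma sigma) a a =
  2^-1 * complex.Re (\sum_i \sum_j \sum_m \sum_n (a (i, j, m) * a (j, i, n) * tau m n +
     a (i, j, m) * (a (i, j, n))^* * sigma m n)).
Proof.
rewrite /cov_form; congr (_ * complex.Re _).
rewrite sum_triple; apply: eq_bigr => i _; apply: eq_bigr => j _; apply: eq_bigr => m _.
rewrite big_split big_split /=; congr (_ + _).
- rewrite sum_triple (bigD1 j)//= [X in _ + X]big1 ?addr0; last first.
    move=> k kj; rewrite big1// => l _; rewrite big1// => n _.
    by rewrite /lift_tau /= (eq_sym j) (negbTE kj) mulr0 mul0r mulr0.
  rewrite (bigD1 i)//= [X in _ + X]big1 ?addr0; last first.
    by move=> l li; rewrite big1// => n _; rewrite /lift_tau /= (eq_sym i) (negbTE li) !mul0r mulr0.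
  by apply: eq_bigr => n _; rewrite /lift_tau /= !eqxx !mul1r.
- rewrite sum_triple (bigD1 i)//= [X in _ + X]big1 ?addr0; last first.
    move=> k ki; rewrite big1// => l _; rewrite big1// => n _.
    by rewrite /lift_sigma /= (eq_sym i) (negbTE ki) !mul0r mulr0.
  rewrite (bigD1 j)//= [X in _ + X]big1 ?addr0; last first.
    by move=> l lj; rewrite big1// => n _; rewrite /lift_sigma /= (eq_sym j) (negbTE lj) mulr0 mul0r mulr0.
  by apply: eq_bigr => n _; rewrite /lift_sigma /= !eqxx !mul1r.
Qed.

End lift.

Section model.
Variables (R : realType) (p q n' : nat).
Local Notation n := n'.+1.
Local Notation M := 'M[R[i]]_n.
Local Notation I := ('I_p * 'I_p * 'I_q)%type.
Variables (t : 'I_p -> 'I_n) (T : 'I_q -> M).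
Hypothesis diagT : forall m, is_diag_mx (T m).
Hypothesis trT : forall m, \tr (T m) = 0.

Definition entry m (a : 'I_n) : R[i] := T m a a.

(** The vector whose law the theorem studies, as a function of the unitary matrix. *)
Definition stat (V : M) : cspace R I := fun x =>
  (Num.sqrt (n%:R : R))%:C%C * cdot (col (t x.1.1) V) (T x.2 *m col (t x.1.2) V).

Lemma statE V x : stat V x = (sn R n')%:C%C * bil t (entry x.2) x.1.1 x.1.2 V.
Proof.
rewrite /stat /sn; congr (_ * _); rewrite /cdot mxE /bil; apply: eq_bigr => a _.
by rewrite diag_mulmx// !mxE mulrA.
Qed.

Definition tr_tau m1 m2 : R[i] := n%:R^-1 * \tr (T m1 *m T m2).
Definition tr_sigma m1 m2 : R[i] := n%:R^-1 * \tr (T m1 *m (T m2) ^t*).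
Definition tr4 m : R[i] := n%:R^-1 * \tr ((T m *m (T m) ^t*) ^+ 2).

Lemma tr_tauE m1 m2 : tr_tau m1 m2 = ntr (fun a => entry m1 a * entry m2 a).
Proof.
by rewrite /tr_tau /ntr; congr (_ * _); apply: eq_bigr => a _; rewrite diag_mulmx.
Qed.

Lemma tr_sigmaE m1 m2 : tr_sigma m1 m2 = ntr (fun a => entry m1 a * (entry m2 a)^*).
Proof.
rewrite /tr_sigma /ntr; congr (_ * _); apply: eq_bigr => a _.
by rewrite diag_mulmx// trmxC_coord.
Qed.

Definition m4 (be : 'I_n -> R[i]) : R := n%:R^-1 * \sum_a nm (be a) ^+ 4.

Lemma tr4E m : tr4 m = (m4 (entry m))%:C%C.
Proof.
rewrite /tr4 /m4 rmorphM /= fmorphV rmorph_nat; congr (_ * _).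
rewrite rmorph_sum /=; apply: eq_bigr => a _.
rewrite expr2 -mulmxE -mulmxA diag_mulmx// diag_mulmx ?is_diag_trmxC// diag_mulmx// trmxC_coord.
by rewrite (exprM _ 2 2) rmorphXn /= nm_sqr expr2 /entry mulrA.
Qed.

Lemma tr_tau_sym m1 m2 : tr_tau m1 m2 = tr_tau m2 m1.
Proof. by rewrite !tr_tauE /ntr; congr (_ * _); apply: eq_bigr => a _; rewrite mulrC. Qed.

Lemma tr_sigma_herm m1 m2 : (tr_sigma m1 m2)^* = tr_sigma m2 m1.
Proof.
rewrite !tr_sigmaE /ntr rmorphM /= fmorphV rmorph_nat; congr (_ * _).
by rewrite rmorph_sum; apply: eq_bigr => a _ /=; rewrite rmorphM /= conjCK mulrC.
Qed.

Section linear_form.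
Variable a : I -> R[i].

Definition coef i j (b : 'I_n) : R[i] := \sum_m a (i, j, m) * entry m b.
(** The family [h] for which [pairing a (stat V)] is the real quadratic form
    [quad t h V]: the Hermitian part of [coef]. *)
Definition hcoef i j (b : 'I_n) : R[i] := 2^-1 * (coef i j b + (coef j i b)^*).

Lemma conj_half : (2^-1 : R[i])^* = 2^-1.
Proof. by rewrite fmorphV rmorph_nat. Qed.

Lemma hcoef_conj i j b : (hcoef i j b)^* = hcoef j i b.
Proof. by rewrite /hcoef rmorphM rmorphD /= conjCK conj_half addrC. Qed.

Lemma coef_tr i j : \sum_b coef i j b = 0.
Proof.
rewrite exchange_big /= big1// => m _; rewrite -mulr_sumr.
by have := trT m; rewrite /mxtrace => ->; rewrite mulr0.
Qed.

Lemma hcoef_tr i j : \sum_b hcoef i j b = 0.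
Proof.
by rewrite -mulr_sumr big_split /= -rmorph_sum !coef_tr rmorph0 addr0 mulr0.
Qed.

Lemma bil_conj (be : 'I_n -> R[i]) i j V :
  bil t (fun b => (be b)^*) i j V = (bil t be j i V)^*.
Proof.
rewrite /bil rmorph_sum; apply: eq_bigr => b _.
by rewrite !rmorphM /= conjCK; ring.
Qed.

Lemma bilD (be ga : 'I_n -> R[i]) i j V :
  bil t (fun b => be b + ga b) i j V = bil t be i j V + bil t ga i j V.
Proof. by rewrite /bil -big_split; apply: eq_bigr => b _ /=; ring. Qed.

Lemma bilZ c (be : 'I_n -> R[i]) i j V :
  bil t (fun b => c * be b) i j V = c * bil t be i j V.
Proof. by rewrite /bil mulr_sumr; apply: eq_bigr => b _ /=; ring. Qed.

Lemma bil_coef i j V : bil t (coef i j) i j V = \sum_m a (i, j, m) * bil t (entry m) i j V.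
Proof.
under [RHS]eq_bigr do rewrite mulr_sumr.
rewrite exchange_big; apply: eq_bigr => b _ /=.
by rewrite /coef mulr_sumr mulr_suml; apply: eq_bigr => m _; ring.
Qed.

Lemma pairing_stat V : pairing a (stat V) = complex.Re (quad t hcoef V).
Proof.
rewrite /quad ReM_real /pairing.
pose S := \sum_i \sum_j bil t (coef i j) i j V.
have -> : \sum_k a k * stat V k = (sn R n')%:C%C * S.
  rewrite sum_triple mulr_sumr; apply: eq_bigr => i _; rewrite mulr_sumr; apply: eq_bigr => j _.
  rewrite bil_coef mulr_sumr; apply: eq_bigr => m _.
  by rewrite statE /=; ring.
rewrite ReM_real; congr (_ * _).
have -> : \sum_i \sum_j bil t (hcoef i j) i j V = 2^-1 * (S + S^*).
  rewrite /S rmorph_sum mulrDr !mulr_sumr.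
  under [X in _ + X]eq_bigr do rewrite rmorph_sum mulr_sumr.
  rewrite [X in _ + X]exchange_big /= -big_split; apply: eq_bigr => i _ /=.
  rewrite mulr_sumr -big_split; apply: eq_bigr => j _ /=.
  by rewrite /hcoef bilZ bilD bil_conj mulrDr.
case: S => u v; rewrite conjE /=.
by rewrite !addr0 expr0n addr0 mul0r oppr0 mul0r subr0; field.
Qed.

(** The asymptotic variance [qvar] of the linear form, as a manifestly nonnegative
    number. *)
Definition stat_var : R := \sum_i \sum_j m2 (hcoef i j).

Lemma stat_var_ge0 : 0 <= stat_var.
Proof. by apply: sumr_ge0 => i _; apply: sumr_ge0 => j _; exact: m2_ge0. Qed.

Lemma qvarE : qvar hcoef = stat_var%:C%C.
Proof.
rewrite /qvar /stat_var rmorph_sum; apply: eq_bigr => i _; rewrite rmorph_sum; apply: eq_bigr => j _ /=.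
rewrite (bigD1 j)//= [X in _ + X]big1 ?addr0; last first.
  by move=> k /negbTE kj; rewrite big1// => l _; rewrite kj !mul0r.
rewrite (bigD1 i)//= big1 ?addr0; last first.
  by move=> l; rewrite eq_sym => /negbTE li; rewrite li mulr0 mul0r.
rewrite !eqxx !mul1r /ntr /m2 rmorphM /= fmorphV rmorph_nat; congr (_ * _).
rewrite rmorph_sum; apply: eq_bigr => b _ /=.
by rewrite nm_sqr hcoef_conj.
Qed.

Lemma ntr_coef i j k l : ntr (fun b => coef i j b * coef k l b) =
  \sum_m1 \sum_m2 a (i, j, m1) * a (k, l, m2) * tr_tau m1 m2.
Proof.
under [RHS]eq_bigr do under eq_bigr do rewrite tr_tauE /ntr mulrCA mulr_sumr.
under [RHS]eq_bigr do rewrite -mulr_sumr exchange_big.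
rewrite -mulr_sumr exchange_big /=; congr (_ * _); apply: eq_bigr => b _.
rewrite /coef mulr_suml; apply: eq_bigr => m1 _; rewrite mulr_sumr; apply: eq_bigr => m2 _.
by ring.
Qed.

Lemma ntr_coef_conj i j k l : ntr (fun b => coef i j b * (coef k l b)^*) =
  \sum_m1 \sum_m2 a (i, j, m1) * (a (k, l, m2))^* * tr_sigma m1 m2.
Proof.
under [RHS]eq_bigr do under eq_bigr do rewrite tr_sigmaE /ntr mulrCA mulr_sumr.
under [RHS]eq_bigr do rewrite -mulr_sumr exchange_big.
rewrite -mulr_sumr exchange_big /=; congr (_ * _); apply: eq_bigr => b _.
rewrite /coef mulr_suml; apply: eq_bigr => m1 _; rewrite rmorph_sum mulr_sumr; apply: eq_bigr => m2 _.
by rewrite /= rmorphM /=; ring.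
Qed.

(** Expanding [h_ij h_ji] gives four traces; the last two are conjugate to the
    first two after exchanging [i] and [j]. *)
Lemma stat_var_cov : stat_var = cov_form (lift_tau tr_tau) (lift_sigma tr_sigma) a a.
Proof.
rewrite cov_form_lift -[LHS]/(complex.Re stat_var%:C%C) -qvarE.
have -> : qvar hcoef = \sum_i \sum_j ntr (fun b => hcoef i j b * hcoef j i b).
  rewrite qvarE /stat_var rmorph_sum; apply: eq_bigr => i _; rewrite rmorph_sum; apply: eq_bigr => j _ /=.
  rewrite /ntr /m2 rmorphM /= fmorphV rmorph_nat; congr (_ * _).
  rewrite rmorph_sum; apply: eq_bigr => b _ /=.
  by rewrite nm_sqr hcoef_conj.
pose F i j := ntr (fun b => coef i j b * coef j i b) + ntr (fun b => coef i j b * (coef i j b)^*).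
have -> : \sum_i \sum_j \sum_m \sum_n0 (a (i, j, m) * a (j, i, n0) * tr_tau m n0 +
     a (i, j, m) * (a (i, j, n0))^* * tr_sigma m n0) = \sum_i \sum_j F i j.
  apply: eq_bigr => i _; apply: eq_bigr => j _; rewrite /F ntr_coef ntr_coef_conj -big_split.
  by apply: eq_bigr => m _ /=; rewrite -big_split.
have hF i j : ntr (fun b => hcoef i j b * hcoef j i b) = 2^-1 * (2^-1 * (F i j + (F j i)^*)).
  have cn (f : 'I_n -> R[i]) : (ntr f)^* = ntr (fun b => (f b)^*).
    by rewrite /ntr rmorphM /= fmorphV rmorph_nat rmorph_sum.
  rewrite /F rmorphD /= !cn /ntr -!mulrDr -!big_split /= !(mulrCA _ n%:R^-1); congr (_ * _).
  rewrite !mulr_sumr; apply: eq_bigr => b _.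
  by rewrite /hcoef !rmorphM /= !conjCK; ring.
pose S := \sum_i \sum_j F i j.
transitivity (complex.Re (2^-1 * (2^-1 * (S + S^*)))).
  congr complex.Re; rewrite /S rmorph_sum.
  under [X in _ + X]eq_bigr do rewrite rmorph_sum.
  rewrite [X in _ + X]exchange_big /= -big_split !mulr_sumr; apply: eq_bigr => i _ /=.
  rewrite -big_split !mulr_sumr; apply: eq_bigr => j _ /=.
  exact: hF.
rewrite -/S; have h2 : (2^-1 : R[i]) = (2^-1 : R)%:C%C by rewrite fmorphV rmorph_nat.
rewrite h2 !ReM_real; by case: S => u v; rewrite conjE /=; field.
Qed.

End linear_form.

Section char.
Hypothesis t_inj : injective t.
Variable mu : probability (borel M) R.
Hypothesis Hmu : is_haar mu.

Lemma stat_continuous : continuous (stat : M -> cspace R I).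
Proof.
apply: ptws_continuous => x.
rewrite (_ : (fun V => stat V x) = (fun V : M => (sn R n')%:C%C * bil t (entry x.2) x.1.1 x.1.2 V)).
  by have [] := niceZ (sn R n')%:C%C (nice_bil t (entry x.2) x.1.1 x.1.2).
by apply/funext => V; rewrite statE.
Qed.

Lemma stat_measurable (f : cspace R I -> R) : continuous f -> measurable_fun [set: borel M] (f \o stat).
Proof.
move=> cf; apply: continuous_borel_measurable => V.
by apply: continuous_comp; [exact: stat_continuous|exact: cf].
Qed.

Lemma stat_nsqE V : nsq (stat V) = n%:R * \sum_x nm (bil t (entry x.2) x.1.1 x.1.2 V) ^+ 2.
Proof.
rewrite /nsq mulr_sumr; apply: eq_bigr => x _.
rewrite statE nmM exprMn nm_real ger0_norm ?sn_sqr//; exact: ltW (sn_gt0 _ _).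
Qed.

Lemma bil_nm2_integrable be i j :
  mu.-integrable setT (EFin \o (fun V => nm (bil t be i j V) ^+ 2)).
Proof.
have [cF [K hK]] := nice_nm2 (nice_bil t be i j).
have h := (nice_cintegrable Hmu (nice_nm2 (nice_bil t be i j))).1.
exact: h.
Qed.

Lemma stat_nsq_integrable : mu.-integrable setT (EFin \o (fun V => nsq (stat V))).
Proof.
under eq_fun do rewrite stat_nsqE.
by apply: intgZ; apply: intg_sum => x; exact: bil_nm2_integrable.
Qed.

Lemma entry_tr m : \sum_b entry m b = 0.
Proof. by have := trT m. Qed.

Lemma stat_nsq_bound : \int[mu]_V nsq (stat V) <= \sum_(x : I) 4 * m2 (entry x.2).
Proof.
under eq_Rintegral do rewrite stat_nsqE.
rewrite RintegralZl//; last by apply: intg_sum => x; exact: bil_nm2_integrable.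
rewrite Rintegral_sum; last by move=> x; exact: bil_nm2_integrable.
rewrite mulr_sumr; apply: ler_sum => x _.
have := haar_bil_var0 t_inj Hmu x.1.1 x.1.2 (entry_tr x.2).
rewrite -(ler_pM2l (_ : 0 < n%:R)) ?ltr0n// => h; apply: le_trans h _.
have n0 : n%:R != 0 :> R by rewrite pnatr_eq0.
by rewrite le_eqVlt; apply/orP; left; apply/eqP; move: (n%:R) n0 => z z0; field.
Qed.

(** [haar_quad_char] splits, by real and imaginary parts, into the hypotheses of
    [char_cos_bound] and [char_sin_bound]. *)
Lemma stat_char (a : I -> R[i]) :
  `|\int[mu]_V cos (pairing a (stat V)) - expR (- stat_var a / 2)| <= qerr (hcoef a) /\
  `|\int[mu]_V sin (pairing a (stat V))| <= qerr (hcoef a).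
Proof.
pose X (V : borel M) : R := complex.Re (quad t (hcoef a) V).
have eX V : pairing a (stat V) = X V := pairing_stat a V.
have mX : measurable_fun setT X.
  have := stat_measurable (@pairing_continuous R I a).
  by rewrite (_ : _ \o _ = X)//; apply/funext.
have X2 : mu.-integrable setT (EFin \o (fun V => X V ^+ 2)).
  apply: (@intg_le _ _ _ mu _ (fun V => (\sum_k nm (a k)) ^+ 2 * nsq (stat V))).
  - exact: measurable_funX.
  - by move=> V; rewrite ger0_norm ?sqr_ge0// -eX; exact: pairing_sqr_le.
  - by apply: intgZ; exact: stat_nsq_integrable.
have key (s : R) : 0 <= s <= 1 ->
  `|\int[mu]_V (X V * sin (s * X V)) - s * stat_var a * \int[mu]_V cos (s * X V)| <= s * qerr (hcoef a) /\
  `|\int[mu]_V (X V * cos (s * X V)) + s * stat_var a * \int[mu]_V sin (s * X V)| <= s * qerr (hcoef a).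
  move=> /andP[s0 s1].
  have := haar_quad_char t_inj Hmu (hcoef_conj a) (hcoef_tr a) s.
  rewrite (ger0_norm s0) qvarE !cexpectationE.
  rewrite (_ : (fun V => complex.Re (quad t (hcoef a) V * _)) = (fun V => X V * cos (s * X V))); last first.
    by apply/funext => V; rewrite {1}(quad_real t (hcoef_conj a) V) ReM_real.
  rewrite (_ : (fun V => complex.Im (quad t (hcoef a) V * _)) = (fun V => X V * sin (s * X V))); last first.
    by apply/funext => V; rewrite {1}(quad_real t (hcoef_conj a) V) ImM_real.
  rewrite -[fun V => complex.Re (equad _ _ _ V)]/(fun V => cos (s * X V)).
  rewrite -[fun V => complex.Im (equad _ _ _ V)]/(fun V => sin (s * X V)).
  set c := \int[mu]_V cos _; set si := \int[mu]_V sin _.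
  set xc := \int[mu]_V (_ * cos _); set xs := \int[mu]_V (_ * sin _).
  have -> : (xc +i* xs)%C - 'i * s%:C%C * (stat_var a)%:C%C * (c +i* si)%C =
    ((xc + s * stat_var a * si) +i* (xs - s * stat_var a * c))%C.
    by rewrite -complexiE; apply/eqP; rewrite eq_complex /=; apply/andP; split; apply/eqP; ring.
  move=> h; split; apply: le_trans h.
    exact: (Im_ge0_le_norm ((xc + s * stat_var a * si) +i* (xs - s * stat_var a * c))%C).
  exact: (Re_ge0_le_norm ((xc + s * stat_var a * si) +i* (xs - s * stat_var a * c))%C).
rewrite (_ : (fun V => cos _) = (fun V => cos (X V))); last by apply/funext => V; rewrite eX.
rewrite (_ : (fun V => sin _) = (fun V => sin (X V))); last by apply/funext => V; rewrite eX.
split.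
  by apply: (char_cos_bound mX X2 (stat_var_ge0 a)) => s hs; have [] := key s hs.
by apply: (char_sin_bound mX X2 (stat_var_ge0 a)) => s hs; have [] := key s hs.
Qed.

End char.
End model.

(** * The limit *)

Section error_bound.
Variables (R : realType) (p q n' : nat).
Local Notation n := n'.+1.
Local Notation I := ('I_p * 'I_p * 'I_q)%type.

Lemma sum_sqr_le (x : 'I_q -> R) : (\sum_m x m) ^+ 2 <= q%:R * \sum_m x m ^+ 2.
Proof.
apply: (@le_trans _ _ (\sum_(m < q) \sum_(k < q) (2^-1 * x m ^+ 2 + 2^-1 * x k ^+ 2))).
  rewrite expr2 mulr_suml; apply: ler_sum => m _; rewrite mulr_sumr; apply: ler_sum => k _.
  by have := sqr_ge0 (x m - x k); nra.
rewrite le_eqVlt; apply/orP; left; apply/eqP; set S := \sum_m x m ^+ 2.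
transitivity (\sum_(m < q) (q%:R * 2^-1 * x m ^+ 2 + 2^-1 * S)).
  apply: eq_bigr => m _.
  by rewrite big_split /= sumr_const card_ord -mulr_sumr -/S -(mulr_natl (2^-1 * x m ^+ 2) q) mulrA.
by rewrite big_split /= -mulr_sumr -/S sumr_const card_ord -(mulr_natl _ q); field.
Qed.

Implicit Types f g : 'I_n -> R[i].

Lemma n_unit : (n%:R : R) * n%:R^-1 = 1.
Proof. by rewrite divff// pnatr_eq0. Qed.

Lemma ni_gt0 : 0 < n%:R^-1 :> R. Proof. by rewrite invr_gt0 ltr0n. Qed.

Lemma m4_ge0 f : 0 <= m4 f.
Proof. by rewrite mulr_ge0 ?invr_ge0// sumr_ge0// => b _; rewrite exprn_ge0 ?nm_ge0. Qed.

Lemma m2_le_m4 f : m2 f <= 1 + m4 f.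
Proof.
rewrite -n_unit mulrC -mulrDr ler_pM2l ?ni_gt0//.
have -> : (n%:R : R) = \sum_(b < n) 1 by rewrite sumr_const card_ord.
rewrite -big_split; apply: ler_sum => b _ /=.
by have := sqr_ge0 (nm (f b) ^+ 2 - 1); have := sqr_ge0 (nm (f b)); nra.
Qed.

Lemma m2M_le f g : m2 (fun b => f b * g b) <= m4 f + m4 g.
Proof.
rewrite -mulrDr ler_pM2l ?ni_gt0// -big_split; apply: ler_sum => b _ /=.
rewrite nmM exprMn.
by have := sqr_ge0 (nm (f b) ^+ 2 - nm (g b) ^+ 2);
  have := sqr_ge0 (nm (f b)); have := sqr_ge0 (nm (g b)); nra.
Qed.

Variables (T : 'I_q -> 'M[R[i]]_n) (a : I -> R[i]) (K : R).
Hypothesis hK : forall m, m4 (entry T m) <= K.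

Let A := \sum_x nm (a x).

Lemma nm_coef_le i j b : nm (coef T a i j b) <= A * \sum_m nm (entry T m b).
Proof.
apply: (le_trans (nm_sum _ _ _)); rewrite mulr_sumr; apply: ler_sum => m _.
rewrite nmM ler_wpM2r ?nm_ge0// /A (bigD1 (i, j, m))//= lerDl.
by apply: sumr_ge0 => x _; exact: nm_ge0.
Qed.

Lemma nm_hcoef_le i j b : nm (hcoef T a i j b) <= A * \sum_m nm (entry T m b).
Proof.
have h2 : (2^-1 : R[i]) = (2^-1 : R)%:C%C by rewrite fmorphV rmorph_nat.
rewrite /hcoef nmM h2 nm_real ger0_norm//.
have h := nmD (coef T a i j b) (coef T a j i b)^*; rewrite nmJ in h.
have h1 := nm_coef_le i j b; have h3 := nm_coef_le j i b.
lra.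
Qed.

Let L := A ^+ 4 * (q%:R ^+ 3 * (\sum_(m < q) K)).

(** [sum_sqr_le] applied twice bounds the fourth power of a sum of [q] terms by
    [q^3] times the sum of the fourth powers. *)
Lemma m4_hcoef_le i j : m4 (hcoef T a i j) <= L.
Proof.
have A0 : 0 <= A by apply: sumr_ge0 => x _; exact: nm_ge0.
apply: (@le_trans _ _ (A ^+ 4 * (q%:R ^+ 3 * \sum_m m4 (entry T m)))); last first.
  rewrite ler_wpM2l ?exprn_ge0// ler_wpM2l ?exprn_ge0//.
  by apply: ler_sum => m _; exact: hK.
rewrite /m4 -mulr_sumr exchange_big /= !(mulrCA _ n%:R^-1) ler_pM2l ?ni_gt0// !mulr_sumr.
apply: ler_sum => b _; set S := \sum_m nm (entry T m b).
have S0 : 0 <= S by apply: sumr_ge0 => x _; exact: nm_ge0.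
apply: (@le_trans _ _ ((A * S) ^+ 4)).
  by apply: lerXn2r; rewrite ?nnegrE ?nm_ge0 ?mulr_ge0//; exact: nm_hcoef_le.
rewrite exprMn ler_wpM2l ?exprn_ge0//.
have h1 := sum_sqr_le (fun m => nm (entry T m b)); rewrite -/S in h1.
have h2 := sum_sqr_le (fun m => nm (entry T m b) ^+ 2).
rewrite (exprM _ 2 2); apply: (@le_trans _ _ ((q%:R * \sum_m nm (entry T m b) ^+ 2) ^+ 2)).
  by apply: lerXn2r => //; rewrite nnegrE ?sqr_ge0// mulr_ge0// sumr_ge0// => m _; exact: sqr_ge0.
have -> : q%:R ^+ 3 = q%:R ^+ 2 * q%:R :> R by rewrite -exprSr.
rewrite exprMn -[leRHS]mulrA ler_wpM2l ?exprn_ge0//.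
apply: (le_trans h2); rewrite ler_wpM2l//.
by apply: ler_sum => m _; rewrite -exprM.
Qed.

Definition err_const : R :=
  \sum_(i < p) \sum_(j < p) \sum_(k < p) \sum_(l < p) (9 + 16 * L).

Lemma qerr_le : qerr (hcoef T a) <= (sn R n')^-1 * err_const.
Proof.
rewrite /qerr ler_wpM2l//; first by rewrite invr_ge0 ltW// sn_gt0.
apply: ler_sum => i _; apply: ler_sum => j _; apply: ler_sum => k _; apply: ler_sum => l _.
have h1 := m2M_le (hcoef T a i j) (hcoef T a k l).
have h2 := m2_le_m4 (hcoef T a i j); have h3 := m2_le_m4 (hcoef T a k l).
have h4 := m4_hcoef_le i j; have h5 := m4_hcoef_le k l.
lra.
Qed.

End error_bound.

Section limits.
Variable R : realType.

Lemma cvg_ReZ (u : nat -> R[i]) (l c : R[i]) : u N @[N --> \oo] --> l ->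
  complex.Re (c * u N) @[N --> \oo] --> complex.Re (c * l).
Proof.
move=> ul; have cc : continuous (fun z : R[i] => complex.Re (c * z)).
  apply: (continuousC_Re (F := fun z : R[i] => c * z)).
  apply: (continuousCM (F := fun=> c) (G := fun z : R[i] => z)); first exact: cst_continuous.
  by move=> z; exact: cvg_id.
exact: (cvg_comp _ _ ul (cc l)).
Qed.

Lemma cvg_Rsum (J : Type) (r : seq J) (F : nat -> J -> R) (l : J -> R) :
  (forall j, F N j @[N --> \oo] --> l j) ->
  \sum_(j <- r) F N j @[N --> \oo] --> \sum_(j <- r) l j.
Proof.
move=> h; elim: r => [|j r IH].
  by rewrite big_nil; under eq_fun do rewrite big_nil; exact: cvg_cst.
rewrite big_cons; under eq_fun do rewrite big_cons.
by apply: cvgD; [exact: h|exact: IH].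
Qed.

Lemma cvg_squeeze_dist (u w e : nat -> R) (l : R) :
  (\forall N \near \oo, `|u N - w N| <= e N) -> e N @[N --> \oo] --> (0 : R) ->
  w N @[N --> \oo] --> l -> u N @[N --> \oo] --> l.
Proof.
move=> ue e0 wl.
have d0 : (u N - w N) @[N --> \oo] --> (0 : R).
  apply: norm_cvg0; apply: (@squeeze_cvgr _ _ _ _ (fun=> 0) e) => //; last exact: cvg_cst.
  by apply: filterS ue => N ->; rewrite normr_ge0.
have -> : u = (fun N => (u N - w N) + w N) by apply/funext => N; rewrite subrK.
by rewrite -(add0r l); exact: cvgD.
Qed.

End limits.

Section convergence.
Variables (R : realType) (p q : nat).
Local Notation I := ('I_p * 'I_p * 'I_q)%type.
Local Notation V := (cspace R I).
Variables (T : forall N : nat, 'I_q -> 'M[R[i]]_N.+1) (sigma2 tau2 : 'I_q -> 'I_q -> R[i]).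
Variable (t : forall N : nat, 'I_p -> 'I_N.+1).
Hypothesis diagT : forall N m, is_diag_mx (T N m).
Hypothesis trT : forall N m, \tr (T N m) = 0.
Hypothesis cvg_sigma : forall m n, tr_sigma (T N) m n @[N --> \oo] --> sigma2 m n.
Hypothesis cvg_tau : forall m n, tr_tau (T N) m n @[N --> \oo] --> tau2 m n.
Arguments cvg_sigma : clear implicits.
Arguments cvg_tau : clear implicits.
Hypothesis t_inj : forall N, (p <= N.+1)%N -> injective (@t N).

(** The normalized traces have these symmetries for each [N]. *)
Lemma tau_sym m n : tau2 m n = tau2 n m.
Proof.
have h := cvg_tau n m.
rewrite (_ : (fun N => _) = (fun N => tr_tau (T N) m n)) in h; last first.
  by apply/funext => N; exact: tr_tau_sym.
exact: (cvg_unique _ (cvg_tau m n) h).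
Qed.

Lemma sigma_herm m n : (sigma2 m n)^* = sigma2 n m.
Proof.
have h := cvg_comp _ _ (cvg_sigma m n) (@conj_continuous R (sigma2 m n)).
have e : (fun N => tr_sigma (T N) n m) = (fun N => (tr_sigma (T N) m n)^*).
  by apply/funext => N; rewrite tr_sigma_herm.
have h' := cvg_sigma n m; rewrite e in h'.
exact: (cvg_unique _ h h').
Qed.

Local Notation cov := (cov_form (@lift_tau R p q tau2) (@lift_sigma R p q sigma2)).

Lemma cvg_stat_var (a : I -> R[i]) : stat_var (T N) a @[N --> \oo] --> cov a a.
Proof.
under eq_fun do rewrite stat_var_cov// cov_form_lift raddf_sum.
rewrite cov_form_lift raddf_sum; apply: cvgM; first exact: cvg_cst.
apply: cvg_Rsum => i; under eq_fun do rewrite raddf_sum.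
rewrite raddf_sum; apply: cvg_Rsum => j; under eq_fun do rewrite raddf_sum.
rewrite raddf_sum; apply: cvg_Rsum => m; under eq_fun do rewrite raddf_sum.
rewrite raddf_sum; apply: cvg_Rsum => n; under eq_fun do rewrite raddfD.
rewrite raddfD; apply: cvgD; apply: cvg_ReZ.
  exact: cvg_tau.
exact: cvg_sigma.
Qed.

(** A limit of variances. *)
Lemma cov_ge0 (a : I -> R[i]) : 0 <= cov a a.
Proof.
have h := @cvg_stat_var a.
rewrite -(cvg_lim (@Rhausdorff R) h); apply: limr_ge; first by apply/cvg_ex; exists (cov a a).
by apply: nearW => N; exact: stat_var_ge0.
Qed.

Variable K : R.
Hypothesis bounded4 : \forall N \near \oo, forall m, m4 (entry (T N) m) <= K.
Variable mu : forall N, probability (borel 'M[R[i]]_N.+1) R.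
Hypothesis haar_mu : forall N, is_haar (mu N).
Context d' (Om' : measurableType d') (P' : probability Om' R) (G : {RV P' >-> borel V}).
Hypothesis char_cos : forall a, \int[P']_w cos (pairing a (G w)) = expR (- cov a a / 2).
Hypothesis char_sin : forall a, \int[P']_w sin (pairing a (G w)) = 0.
Hypothesis G2 : P'.-integrable setT (EFin \o (fun w => nsq (G w : V))).

(** The square root of [1 / (N + 1)] tends to 0. *)
Lemma cvg_err (a : I -> R[i]) : (sn R N)^-1 * err_const a K @[N --> \oo] --> (0 : R).
Proof.
rewrite -[X in _ --> X](mul0r (err_const a K)); apply: cvgM; last exact: cvg_cst.
have h := @cvg_harmonic R.
have s := cvg_comp _ _ h (@sqrt_continuous R 0).
rewrite sqrtr0 in s.
rewrite (_ : (fun N => (sn R N)^-1) = Num.sqrt \o @harmonic R)//.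
by apply/funext => N; rewrite /= /sn sqrtrV.
Qed.

(** The columns are distinct only once [p <= N + 1], so all estimates hold eventually. *)
Lemma stat_cvg : cvg_in_distribution mu (fun N => stat (@t N) (T N)) P' G.
Proof.
apply: (@levy_continuity R I _ (fun N => borel 'M[R[i]]_N.+1) mu (fun N => stat (@t N) (T N))
  _ _ P' G _ _ _ G2 (\sum_(x : I) 4 * (1 + K))).
- by move=> N f cf; exact: stat_measurable.
- move=> f cf; have mG : measurable_fun setT G := measurable_funPT G.
  exact: (measurableT_comp (cspace_measurable cf) mG).
- by move=> N; apply: stat_nsq_integrable.
- near=> N; have ti : injective (@t N) by apply: t_inj; near: N; exists p => // k /= /leqW.
  apply: (le_trans (stat_nsq_bound (diagT N) (trT N) ti (haar_mu N))).
  apply: ler_sum => x _; rewrite ler_pM2l//; apply: (le_trans (m2_le_m4 _)); rewrite lerD2l.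
  by move: x.2; near: N.
- move=> a; rewrite char_cos.
  apply: (@cvg_squeeze_dist _ _ (fun N => expR (- stat_var (T N) a / 2)) (fun N => (sn R N)^-1 * err_const a K)).
  + near=> N; have ti : injective (@t N) by apply: t_inj; near: N; exists p => // k /= /leqW.
    have [h _] := stat_char (diagT N) (trT N) ti (haar_mu N) a.
    by apply: (le_trans h); apply: qerr_le; near: N.
  + exact: cvg_err.
  + apply: (cvg_comp _ expR); last exact: continuous_expR.
    by apply: cvgM; [apply: cvgN; exact: cvg_stat_var|exact: cvg_cst].
- move=> a; rewrite char_sin.
  apply: (@cvg_squeeze_dist _ _ (fun N => 0) (fun N => (sn R N)^-1 * err_const a K)).
  + near=> N; have ti : injective (@t N) by apply: t_inj; near: N; exists p => // k /= /leqW.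
    have [_ h] := stat_char (diagT N) (trT N) ti (haar_mu N) a.
    by rewrite subr0; apply: (le_trans h); apply: qerr_le; near: N.
  + exact: cvg_err.
  + exact: cvg_cst.
Unshelve. all: by end_near. Qed.

End convergence.

Theorem theoremA5 (R : realType) (p q : nat)
    (T : forall N : nat, 'I_q -> 'M[R[i]]_N.+1)
    (sigma2 tau2 : 'I_q -> 'I_q -> R[i])
    (d : nat -> measure_display) (Om : forall N : nat, measurableType (d N))
    (P : forall N : nat, probability (Om N) R)
    (U : forall N : nat, {RV (P N) >-> borel 'M[R[i]]_N.+1})
    (t : forall N : nat, 'I_p -> 'I_N.+1) :
  (forall N m, is_diag_mx (T N m)) ->
  (forall N m, \tr (T N m) = 0) ->
  (forall m n, N.+1%:R^-1 * \tr (T N m *m (T N n) ^t*) @[N --> \oo]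
                 --> sigma2 m n) ->
  (forall m n, N.+1%:R^-1 * \tr (T N m *m T N n) @[N --> \oo]
                 --> tau2 m n) ->
  (forall m (k : nat), (1 <= k)%N ->
     (fun N => N.+1%:R^-1 * \tr ((T N m *m (T N m) ^t*) ^+ k) : R[i])
       =O_\oo (fun=> 1 : R[i])) ->
  (forall N, is_haar (distribution (P N) (U N))) ->
  (forall N, (p <= N.+1)%N -> injective (t N)) ->
  exists (d' : measure_display) (Om' : measurableType d')
    (P' : probability Om' R)
    (G : {RV P' >-> borel (cspace R ('I_p * 'I_p * 'I_q)%type)}),
    [/\ centered_gaussian_vector G,
        forall i j m k l n,
          cexpectation P' (fun w => G w (i, j, m) * G w (k, l, n)) =
            (i == l)%:R * (j == k)%:R * tau2 m n,
        forall i j m k l n,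
          cexpectation P' (fun w => G w (i, j, m) * (G w (k, l, n))^*) =
            (i == k)%:R * (j == l)%:R * sigma2 m n
      & cvg_in_distribution P
          (fun N w => (fun x =>
             (Num.sqrt (N.+1%:R : R))%:C%C *
             cdot (col (t N x.1.1) (U N w))
                  (T N x.2 *m col (t N x.1.2) (U N w)))
             : cspace R ('I_p * 'I_p * 'I_q)%type)
          P' G].
Proof.
move=> diagT trT cvg_sigma cvg_tau bounded haar_U t_inj.
have ts := lift_tau_sym (p := p) (tau_sym diagT cvg_tau).
have sh := lift_sigma_herm (p := p) (sigma_herm diagT cvg_sigma).
have cg := @cov_ge0 R p q T sigma2 tau2 diagT cvg_sigma cvg_tau.
have [d' [Om' [P' [G [Gcos Gsin G2]]]]] := gaussian_vector_exists ts sh cg.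
exists d', Om', P', G; split.
- exact: (gaussian_vector_centered ts sh Gcos Gsin G2).
- by move=> i j m k l n; rewrite (gaussian_vector_tau ts sh Gcos G2).
- by move=> i j m k l n; rewrite (gaussian_vector_sigma ts sh Gcos G2).
have [K hK] : exists K : R, \forall N \near \oo, forall m, m4 (entry (T N) m) <= K.
  have h m : exists Km : R, \forall N \near \oo, m4 (entry (T N) m) <= Km.
    have /eqO_exP[c c0 hc] := bounded m 2 isT.
    exists (complex.Re c); apply: filterS hc => N.
    rewrite normr1 mulr1 -[X in `|X| <= _]/(tr4 (T N) m) tr4E// => /Re_le.
    by rewrite -/(nm _) nm_real ger0_norm// m4_ge0.
  have [Km hKm] := choice h.
  exists (\sum_m `|Km m|); apply: filter_forall => m.
  apply: filterS (hKm m) => N /le_trans; apply.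
  rewrite (bigD1 m)//= (le_trans (ler_norm _))// lerDl.
  by apply: sumr_ge0.
move=> f cf bf.
have lim := stat_cvg diagT trT cvg_sigma cvg_tau t_inj hK haar_U Gcos Gsin G2 cf bf.
have transfer N : ('E_(distribution (P N) (U N))[f \o stat (t N) (T N)] =
    'E_(P N)[fun w => f (stat (t N) (T N) (U N w))])%E.
  have mf := stat_measurable (t N) (diagT N) cf.
  have [K' hK'] : exists K', forall y, `|f y| <= K'.
    by case: bf => K0 [_ bK]; exists (K0 + 1) => y; apply: (bK (K0 + 1)) => //; rewrite ltrDl.
  have mU : measurable_fun setT (U N) := measurable_funPT (U N).
  rewrite !unlock integral_distribution//; first exact/measurable_EFinP.
  apply: (@intg_bounded _ _ _ (P N) (fun w => f (stat (t N) (T N) (U N w))) K').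
    exact: (measurableT_comp mf mU).
  by move=> w; exact: hK'.
rewrite (funext transfer) in lim.
exact: lim.
Qed.
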